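(* Given an $n$-node $m$-edge undirected unweighted graph $G$ and an integer $k\ge 2$, there is a randomized algorithm that computes for each vertex $v$ an estimate $\hat c_v$ such that $SC(v)\le \hat c_v\le SC(v)+2\left\lceil \frac{SC(v)}{2(k-1)}\right\rceil$, in $\tilde O(m^{2-2/k}n^{1/k})$ time with high probability.
   Context: For a vertex $v$, $SC(v)$ is the length of a shortest (simple) cycle containing $v$. $\tilde O$ hides polylogarithmic factors; ''with high probability'' means with probability $1-1/\mathrm{poly}(n)$. *)

(* Defs.v *)
(* MathComp / MathComp-Analysis. *)
From HB Require Import structures.
From mathcomp Require Import all_boot all_order all_algebra.
From mathcomp Require Import reals exp.

Set Implicit Arguments.
Unset Strict Implicit.
Unset Printing Implicit Defensive.

Import Order.TTheory GRing.Theory Num.Theory.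

(** * Graphs and shortest cycles *)

Record sgraph (n : nat) := SGraph {
  adj :> rel 'I_n;
  adj_sym : symmetric adj;
  adj_irr : irreflexive adj }.

Definition edges n (G : sgraph n) : {set {set 'I_n}} :=
  [set [set p.1; p.2] | p : 'I_n * 'I_n & G p.1 p.2].

(* Every edge occurs exactly once, in one of its two orientations; the order
   of the edges and the orientations are arbitrary. *)
Definition edge_listing n (G : sgraph n) (es : seq ('I_n * 'I_n)) : bool :=
  perm_eq [seq [set p.1; p.2] | p <- es] (enum (edges G)).

(* [ucycleb] asks for pairwise distinct vertices, consecutive ones (cyclically)
   being adjacent.  It also accepts an edge traversed back and forth, which
   [2 < l] excludes. *)
Definition has_cycle n (G : sgraph n) (v : 'I_n) (l : nat) : bool :=
  (2 < l) && [exists c : l.-tuple 'I_n, ucycleb G c && (v \in c)].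

(* [None] is infinity: no cycle contains v. *)
Definition SC n (G : sgraph n) (v : 'I_n) : option nat :=
  ohead [seq l <- iota 0 n.+1 | has_cycle G v l].

Lemma has_cycle_size n (G : sgraph n) v l : has_cycle G v l -> l <= n.
Proof.
case/andP=> _ /existsP[c /andP[/andP[_ Uc] _]].
by rewrite -(size_tuple c) -(card_uniqP Uc) -[leqRHS]card_ord max_card.
Qed.

Lemma SC_SomeP n (G : sgraph n) v s :
  SC G v = Some s <->
  has_cycle G v s /\ forall l, has_cycle G v l -> s <= l.
Proof.
have memF l : (l \in [seq l <- iota 0 n.+1 | has_cycle G v l]) = has_cycle G v l.
  rewrite mem_filter mem_iota add0n ltnS /=.
  by case: (boolP (has_cycle G v l)) => // /has_cycle_size ->.
have sF : sorted ltn [seq l <- iota 0 n.+1 | has_cycle G v l].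
  by apply: sorted_filter; [exact: ltn_trans | exact: iota_ltn_sorted].
rewrite /SC; case: [seq l <- _ | _] memF sF => [|x t] memF sF /=.
  by split=> // -[]; rewrite -memF.
have xmin l : has_cycle G v l -> x <= l.
  rewrite -memF inE => /predU1P[-> //|lt].
  by have /allP/(_ _ lt)/ltnW := order_path_min ltn_trans sF.
have xc : has_cycle G v x by rewrite -memF mem_head.
split=> [[<-] // | [sc smin]]; congr Some.
by apply/eqP; rewrite eqn_leq xmin // smin.
Qed.

Lemma SC_NoneP n (G : sgraph n) v :
  SC G v = None <-> forall l, ~~ has_cycle G v l.
Proof.
split=> [SN l | nc].
  apply/negP=> cl; have ex : exists l, has_cycle G v l by exists l.
  suff : SC G v = Some (ex_minn ex) by rewrite SN.
  by apply/SC_SomeP; case: ex_minnP.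
by case E: (SC G v) => [s|] //; have [+ _] := (SC_SomeP G v s).1 E; rewrite (negPf (nc s)).
Qed.

Definition ceil_divn (x y : nat) : nat := (x + y.-1) %/ y.

(* The estimate c is a machine word; since cycle lengths are positive, the word
   0 stands for the estimate infinity, which is the only admissible one when
   SC(v) is infinite, and is not admissible otherwise. *)
Definition good_estimate (k : nat) (sc : option nat) (c : nat) : bool :=
  if sc is Some s then s <= c <= s + 2 * ceil_divn s (2 * (k - 1))
  else c == 0.

(** * Randomized word RAM

  A program is a fixed syntactic object manipulating w-bit words, held in
  finitely many registers and in finitely many arrays indexed by words (a
  program mentions only finitely many of either).  Its text does not depend on
  the input nor on w.  One step executes one instruction or evaluates one
  guard; expressions have a size bounded by that of the program, so this is
  the usual unit-cost measure up to a constant factor. *)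

Inductive binop := Add | Sub | Mul | Div | Mod | Eq | Lt.

Inductive expr :=
  | Const of nat
  | Reg of nat
  | Get of nat & expr                  (* Get a i       a[i]              *)
  | Bin of binop & expr & expr.

Inductive cmd :=
  | Skip
  | Assign of nat & expr               (* Assign x e    x := e            *)
  | Store of nat & expr & expr         (* Store a i e   a[i] := e         *)
  | Flip of nat                        (* Flip x        x := fair coin    *)
  | Seq of cmd & cmd
  | If of expr & cmd & cmd
  | While of expr & cmd.

Record config := Config {
  todo : seq cmd;                      (* what remains to be executed     *)
  regs : nat -> nat;
  arrs : nat -> nat -> nat;
  coins : seq bool }.                  (* coins not yet consumed          *)

(* Subtraction is truncated at 0, and x / 0 = 0, x mod 0 = x. *)
Definition binop_fun (o : binop) (x y : nat) : nat :=
  match o with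
  | Add => x + y
  | Sub => x - y
  | Mul => x * y
  | Div => x %/ y
  | Mod => x %% y
  | Eq => x == y
  | Lt => x < y
  end.

Fixpoint eval (w : nat) (r : nat -> nat) (a : nat -> nat -> nat) (e : expr)
    : nat :=
  match e with
  | Const c => c %% 2 ^ w
  | Reg x => r x
  | Get t i => a t (eval w r a i)
  | Bin o e1 e2 => binop_fun o (eval w r a e1) (eval w r a e2) %% 2 ^ w
  end.

Definition upd (A : Type) (f : nat -> A) (x : nat) (v : A) : nat -> A :=
  fun y => if y == x then v else f y.

Definition step (w : nat) (s : config) : config :=
  let: Config q r a cs := s in
  match q with
  | [::] => s
  | Skip :: q => Config q r a cs
  | Assign x e :: q => Config q (upd r x (eval w r a e)) a cs
  | Store t i e :: q =>
      Config q r
        (upd a t (upd (a t) (eval w r a i) (eval w r a e))) cs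
  | Flip x :: q => Config q (upd r x (head false cs)) a (behead cs)
  | Seq c1 c2 :: q => Config (c1 :: c2 :: q) r a cs
  | If e c1 c2 :: q =>
      Config ((if eval w r a e != 0 then c1 else c2) :: q) r a cs
  | While e c :: q =>
      Config (if eval w r a e != 0 then c :: While e c :: q else q) r a cs
  end.

Definition halted (s : config) : bool := nilp (todo s).

(** * Input, output and success probability *)

(* Registers 0, 1, 2 hold n, m, k; arrays 0 and 1 hold the first and second
   endpoints of the listed edges; everything else is 0. *)
Definition init (P : cmd) n (es : seq ('I_n * 'I_n)) (k : nat)
    (cs : seq bool) : config :=
  Config [:: P]
    (nth 0 [:: n; size es; k])
    (fun t => nth 0 (nth [::] [:: [seq val p.1 | p <- es];
                                  [seq val p.2 | p <- es]] t))
    cs.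

(* The estimate for vertex v is read in cell v of array 2. *)
Definition output n (s : config) (v : 'I_n) : nat := arrs s 2 v.

(* Within T steps, i.e. using at most the T given coins, P halts with a good
   estimate for every vertex. *)
Definition success (P : cmd) (w : nat) n (G : sgraph n)
    (es : seq ('I_n * 'I_n)) (k T : nat) (cs : T.-tuple bool) : bool :=
  let s := iter T (step w) (init P es k cs) in
  halted s && [forall v, good_estimate k (SC G v) (output s v)].

Local Open Scope ring_scope.

(* Probability of A when the T coins are independent and fair; T steps consume
   at most T coins. *)
Definition coin_prob (R : realType) (T : nat) (A : pred (T.-tuple bool)) : R :=
  #|[set cs | A cs]|%:R / 2 ^+ T.

(* Main.v *)
(* The algorithm is deterministic and ignores its coins.

   Let alpha = max(1, floor((m^2/n)^(1/k))), and let the volume of a set be the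
   sum of its degrees.  The inner ball of a vertex w is the longest prefix of
   the breadth-first order from w whose volume is less than alpha; if it is not
   the whole component, w is heavy and its ball is this prefix together with the
   next vertex.  A greedy hitting set of O((m/alpha) log n) landmarks meets the
   balls of all heavy vertices.

   A search from x builds a breadth-first tree.  A non-tree edge (a, b) closes,
   for every tree edge on the tree path from a to b, a cycle of length at most
   d(a) + d(b) + 1 through that edge; the minima over all non-tree edges are
   found by binary lifting.  If a cycle of length s passes at distance delta
   from x, every vertex of the cycle gets in this way a value at most
   s + 2 delta.  The whole graph is searched from each landmark, and for each v
   only the set U(v) of vertices reached from v by k - 1 steps from a vertex to
   its inner ball; the volume of U(v) is at most alpha^(k-1).

   Let C be a shortest cycle through v, s its length and
   delta = ceil(s / (2 (k - 1))).  If the ball of some heavy vertex of C lies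
   within distance delta, its landmark yields a value at most s + 2 delta.
   Otherwise the inner ball of every vertex of C contains its
   delta-neighbourhood, so C is contained in U(v), and the search in U(v) yields
   s.  The landmarks cost m^2/alpha and the local searches n alpha^(k-1), up to
   logarithmic factors, and both are O(m^(2-2/k) n^(1/k)). *)

(* Alpha balances the two costs: [n * alpha^k = m^2] makes [m^2 / alpha] and [n * alpha^(k-1)]
   equal. Balls are cut off by volume, not by radius or cardinality, because a search pays for the
   edges it scans; accordingly the greedy choice is analysed with degrees as weights.

   A local search may cost only about the volume of U(v). It can neither clear an array of size n
   nor walk along the tree path of each non-tree edge. Queue membership certified by two arrays and
   marks that grow with time avoid the former, binary lifting the latter.

   An estimate must come from a simple cycle through the vertex itself, and a closed walk through
   the root need not contain one. Values are therefore attached to tree edges: a non-tree edge whose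
   ends are separated by removing a tree edge closes a cycle through that edge.

   Machine arithmetic sees only integer inequalities about alpha. They become the stated bound at
   the end, through the k-th roots P of m and Q of n: up to the maximum with 1, alpha is determined
   by [Q * alpha <= P^2 < Q * (alpha + 1)]. *)
Require Import Defs.
From HB Require Import structures.
From mathcomp Require Import all_boot all_order all_algebra.
From mathcomp Require Import reals sequences exp boolp zify ring lra.

Set Implicit Arguments.
Unset Strict Implicit.
Unset Printing Implicit Defensive.

(* [lia] on the arithmetic hypotheses only: the boolean membership facts of the
   context make it very slow. *)
Ltac slia :=
  repeat match goal with
  | H : ?T |- _ =>
    lazymatch T with
    | context [expn] => clear H
    | is_true (leq _ _) => fail
    | is_true (andb (leq _ _) (leq _ _)) => fail
    | is_true (negb (leq _ _)) => fail
    | @eq nat _ _ => fail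
    | ~ (@eq nat _ _) => fail
    | or _ _ => fail
    | nat => fail
    | _ => clear H
    end
  end; lia.

(** * Executions of loop programs *)

Local Notation rfile := (nat -> nat).
Local Notation afile := (nat -> nat -> nat).

(** The numeric index counts loop iterations only. No rule covers [Flip]: a derivable execution
    never consults the coins, so one derivation serves all coin sequences. *)
Inductive exec (w : nat) : cmd -> rfile -> afile -> nat -> rfile -> afile -> Prop :=
  | ExSkip r a : exec w Skip r a 0 r a
  | ExAssign x e r a : exec w (Assign x e) r a 0 (upd r x (eval w r a e)) a
  | ExStore t i e r a :
      exec w (Store t i e) r a 0 r
        (upd a t (upd (a t) (eval w r a i) (eval w r a e)))
  | ExSeq c1 c2 r a t1 r1 a1 t2 r2 a2 :
      exec w c1 r a t1 r1 a1 -> exec w c2 r1 a1 t2 r2 a2 ->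
      exec w (Seq c1 c2) r a (t1 + t2) r2 a2
  | ExIf e c1 c2 r a t r' a' :
      exec w (if eval w r a e != 0 then c1 else c2) r a t r' a' ->
      exec w (If e c1 c2) r a t r' a'
  | ExWhileF e c r a : eval w r a e = 0 -> exec w (While e c) r a 0 r a
  | ExWhileT e c r a t1 r1 a1 t2 r2 a2 :
      eval w r a e != 0 -> exec w c r a t1 r1 a1 ->
      exec w (While e c) r1 a1 t2 r2 a2 ->
      exec w (While e c) r a (t1 + t2).+1 r2 a2.

Fixpoint csize (c : cmd) : nat :=
  match c with
  | Seq c1 c2 => (csize c1 + csize c2).+1
  | If _ c1 c2 => (csize c1 + csize c2).+1
  | While _ c => (csize c).+2
  | _ => 1
  end.

Lemma csize_gt0 c : 0 < csize c. Proof. by case: c. Qed.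

(* Between two loop iterations only loop-free code runs, so counting loop
   iterations determines the running time up to the size of the program. *)
Lemma exec_steps w c r a t r' a' : exec w c r a t r' a' ->
  exists2 T, T <= csize c * t.+1 &
  forall q cs, iter T (step w) (Config (c :: q) r a cs) = Config q r' a' cs.
Proof.
elim=> {c r a t r' a'} [r a|x e r a|t i e r a|c1 c2 r a t1 r1 a1 t2 r2 a2 _ [T1 l1 H1] _ [T2 l2 H2]
  |e c1 c2 r a t r' a' _ [T l H]|e c r a e0|e c r a t1 r1 a1 t2 r2 a2 e0 _ [T1 l1 H1] _ [T2 l2 H2]].
- by exists 1.
- by exists 1.
- by exists 1.
- exists (T2 + (T1 + 1)) => [|q cs]; last by rewrite !iterD /= H1 H2.
  by move: l1 l2 => /=; nia.
- exists (T + 1) => [|q cs]; last by rewrite iterD /= H.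
  by move: l => /=; case: ifP => _; nia.
- by exists 1 => [|q cs] //=; rewrite e0.
- exists (T2 + (T1 + 1)) => [|q cs].
    have := csize_gt0 c; move: l1 l2 => /=; nia.
  by rewrite !iterD /= e0 H1 H2.
Qed.

(** Total correctness with an absolute clock: [tau] is the count on entry and [Q] receives the count
    on exit, so invariants of nested loops can speak of the time elapsed since a common origin. *)
Definition wp w c (Q : rfile -> afile -> nat -> Prop) r a tau :=
  exists t r' a', exec w c r a t r' a' /\ Q r' a' (tau + t).

Section WP.
Variable w : nat.
Implicit Types (Q : rfile -> afile -> nat -> Prop) (r : rfile) (a : afile).

Lemma wp_conseq c Q Q' r a tau :
  wp w c Q r a tau -> (forall r a t, Q r a t -> Q' r a t) -> wp w c Q' r a tau.
Proof. by move=> [t [r' [a' [E q]]]] H; exists t, r', a'; split=> //; apply: H. Qed.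

Lemma wp_skip Q r a tau : Q r a tau -> wp w Skip Q r a tau.
Proof. by exists 0, r, a; rewrite addn0; split=> //; constructor. Qed.

Lemma wp_seq c1 c2 Q r a tau :
  wp w c1 (wp w c2 Q) r a tau -> wp w (Seq c1 c2) Q r a tau.
Proof.
move=> [t1 [r1 [a1 [E1 [t2 [r2 [a2 [E2 q]]]]]]]].
exists (t1 + t2), r2, a2; rewrite addnA; split=> //; apply: ExSeq E1 E2.
Qed.

(** Symbolic execution may split a sequence before a triple for a longer block is applied; this
    inverse of [wp_seq] reassembles the block. *)
Lemma wp_seqI c1 c2 Q r a tau :
  wp w (Seq c1 c2) Q r a tau -> wp w c1 (wp w c2 Q) r a tau.
Proof.
move=> [t [r' [a' [E q]]]].
move Ec : (Seq c1 c2) E => c E; case: E Ec q => // {c t r' a' r a}.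
move=> d1 d2 r a t1 r1 a1 t2 r2 a2 E1 E2 [-> ->] q.
by exists t1, r1, a1; split=> //; exists t2, r2, a2; rewrite -addnA.
Qed.

Lemma wp_assign x e v Q r a tau :
  eval w r a e = v -> Q (upd r x v) a tau -> wp w (Assign x e) Q r a tau.
Proof. by move=> <- q; exists 0, (upd r x (eval w r a e)), a; rewrite addn0; split=> //; constructor. Qed.

Lemma wp_store t i e iv v Q r a tau :
  eval w r a i = iv -> eval w r a e = v ->
  Q r (upd a t (upd (a t) iv v)) tau -> wp w (Store t i e) Q r a tau.
Proof.
move=> <- <- q; exists 0, r, (upd a t (upd (a t) (eval w r a i) (eval w r a e))).
by rewrite addn0; split=> //; constructor.
Qed.

Lemma wp_if e c1 c2 v Q r a tau : eval w r a e = v ->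
  (v != 0 -> wp w c1 Q r a tau) -> (v = 0 -> wp w c2 Q r a tau) ->
  wp w (If e c1 c2) Q r a tau.
Proof.
move=> ev H1 H2; have: wp w (if eval w r a e != 0 then c1 else c2) Q r a tau.
  by rewrite ev; case: eqP => [/H2|/eqP /H1].
by case=> t [r' [a' [E q]]]; exists t, r', a'; split=> //; constructor.
Qed.

Lemma wp_ifb e c1 c2 (b : bool) Q r a tau : eval w r a e = b ->
  (b -> wp w c1 Q r a tau) -> (~~ b -> wp w c2 Q r a tau) ->
  wp w (If e c1 c2) Q r a tau.
Proof. by move=> ev H1 H2; apply: (wp_if ev); case: (b) H1 H2 => // H1 H2 _; auto. Qed.

(* A bound on the accumulated iteration count also proves termination. *)
Lemma wp_while (I : rfile -> afile -> nat -> Prop) B e c Q r a tau :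
  I r a tau ->
  (forall r a t, I r a t -> t <= B) ->
  (forall r a t, I r a t -> eval w r a e != 0 -> wp w c I r a t.+1) ->
  (forall r a t, I r a t -> eval w r a e = 0 -> Q r a t) ->
  wp w (While e c) Q r a tau.
Proof.
move=> Ii IB Ib IQ; have [k] := ubnP (B - tau).
elim: k => // k IH in r a tau Ii * => lek.
have [e0|e0] := eqVneq (eval w r a e) 0.
  by exists 0, r, a; rewrite addn0; split; [apply: ExWhileF | apply: IQ].
have [t [r' [a' [E Ii']]]] := Ib _ _ _ Ii e0.
have := IB _ _ _ Ii'; have := IB _ _ _ Ii => b1 b2.
have [|t2 [r2 [a2 [E2 q]]]] := IH _ _ _ Ii'; first by lia.
exists (t + t2).+1, r2, a2; split; first exact: ExWhileT e0 E E2.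
by rewrite addnS -addSn addnA in q *.
Qed.

Fixpoint wregs (c : cmd) : seq nat :=
  match c with
  | Assign x _ => [:: x] | Flip x => [:: x]
  | Seq c1 c2 => wregs c1 ++ wregs c2 | If _ c1 c2 => wregs c1 ++ wregs c2
  | While _ c => wregs c | _ => [::]
  end.

Fixpoint warrs (c : cmd) : seq nat :=
  match c with
  | Store t _ _ => [:: t]
  | Seq c1 c2 => warrs c1 ++ warrs c2 | If _ c1 c2 => warrs c1 ++ warrs c2
  | While _ c => warrs c | _ => [::]
  end.

Definition frame c r a r' a' :=
  (forall x, x \notin wregs c -> r' x = r x) /\
  (forall t, t \notin warrs c -> a' t = a t).

Lemma exec_frame c r a t r' a' : exec w c r a t r' a' -> frame c r a r' a'.
Proof.
elim=> {c r a t r' a'}; rewrite /frame /upd //=.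
- by move=> x e r a; split=> // y; rewrite inE => /negPf ->.
- by move=> t i e r a; split=> // y; rewrite inE => /negPf ->.
- move=> c1 c2 r a t1 r1 a1 t2 r2 a2 _ [H1 H2] _ [H3 H4].
  by split=> x; rewrite mem_cat negb_or => /andP[? ?]; rewrite ?H3 ?H4 // ?H1 ?H2.
- move=> e c1 c2 r a t r' a' _ [H1 H2].
  by split=> x; rewrite mem_cat negb_or => /andP[? ?]; rewrite ?H1 ?H2 //; case: ifP.
- move=> e c r a t1 r1 a1 t2 r2 a2 _ _ [H1 H2] _ [H3 H4].
  by split=> x xn; rewrite ?H3 ?H4 ?H1 ?H2.
Qed.

Lemma wp_frame c Q r a tau : wp w c Q r a tau ->
  wp w c (fun r' a' t => Q r' a' t /\ frame c r a r' a') r a tau.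
Proof.
by move=> [t [r' [a' [E q]]]]; exists t, r', a'; split=> //; split=> //; apply: exec_frame E.
Qed.

(* The frame makes every untouched register and array available to the loop
   invariant for free. *)
Lemma wp_whilef (I : rfile -> afile -> nat -> Prop) B e c Q r a tau :
  I r a tau ->
  (forall r a t, I r a t -> t <= B) ->
  (forall r' a' t, I r' a' t -> frame c r a r' a' -> eval w r' a' e != 0 ->
     wp w c I r' a' t.+1) ->
  (forall r' a' t, I r' a' t -> frame c r a r' a' -> eval w r' a' e = 0 -> Q r' a' t) ->
  wp w (While e c) Q r a tau.
Proof.
move=> Ii IB Ib IQ.
apply: (@wp_while (fun r' a' t => I r' a' t /\ frame c r a r' a') B) => //.
- by move=> r' a' t [/IB].
- move=> r' a' t [J F] e0; apply: wp_conseq (wp_frame (Ib _ _ _ J F e0)) _.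
  move=> r2 a2 t2 [J2 [F1 F2]]; split=> //; case: F => F3 F4.
  by split=> x xn; rewrite ?F1 ?F2 ?F3 ?F4.
- by move=> r' a' t [J F]; apply: IQ.
Qed.

Lemma eval_reg r a x v : r x = v -> eval w r a (Reg x) = v.
Proof. by []. Qed.

Lemma eval_const r a c : c < 2 ^ w -> eval w r a (Const c) = c.
Proof. by move=> ?; rewrite /= modn_small. Qed.

Lemma eval_get r a t i iv v : eval w r a i = iv -> a t iv = v ->
  eval w r a (Get t i) = v.
Proof. by move=> /= ->. Qed.

Lemma eval_add r a e1 e2 x y : eval w r a e1 = x -> eval w r a e2 = y ->
  x + y < 2 ^ w -> eval w r a (Bin Add e1 e2) = x + y.
Proof. by move=> /= -> -> ?; rewrite modn_small. Qed.

Lemma eval_mul r a e1 e2 x y : eval w r a e1 = x -> eval w r a e2 = y ->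
  x * y < 2 ^ w -> eval w r a (Bin Mul e1 e2) = x * y.
Proof. by move=> /= -> -> ?; rewrite modn_small. Qed.

Lemma eval_sub r a e1 e2 x y : eval w r a e1 = x -> eval w r a e2 = y ->
  x < 2 ^ w -> eval w r a (Bin Defs.Sub e1 e2) = x - y.
Proof. by move=> /= -> -> ?; rewrite modn_small //; apply: leq_ltn_trans (leq_subr _ _) _. Qed.

Lemma bool_mod (b : bool) : 0 < w -> b %% 2 ^ w = b.
Proof. by move=> w0; rewrite modn_small //; case: b; rewrite ?expn_gt0 // (@leq_pexp2l 2 1). Qed.

Hypothesis w_gt0 : 0 < w.

Lemma eval_lt r a e1 e2 x y : eval w r a e1 = x -> eval w r a e2 = y ->
  eval w r a (Bin Lt e1 e2) = (x < y).
Proof. by move=> /= -> ->; rewrite bool_mod. Qed.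

Lemma eval_eq r a e1 e2 x y : eval w r a e1 = x -> eval w r a e2 = y ->
  eval w r a (Bin Eq e1 e2) = (x == y).
Proof. by move=> /= -> ->; rewrite bool_mod. Qed.

Definition eAnd e1 e2 := Bin Mul e1 e2.
Definition eNot e := Bin Eq e (Const 0).
Definition eOr e1 e2 := eNot (eAnd (eNot e1) (eNot e2)).

(* The second conjunct may read a meaningless cell when the first is false. *)
Lemma eval_and r a e1 e2 (b1 b2 : bool) : eval w r a e1 = b1 ->
  (b1 -> eval w r a e2 = b2) -> eval w r a (eAnd e1 e2) = b1 && b2.
Proof.
rewrite /eAnd /= => ->; case: b1 => [/(_ isT) ->|_]; last by rewrite mul0n mod0n.
by rewrite mul1n bool_mod.
Qed.

Lemma eval_not r a e (b : bool) : eval w r a e = b -> eval w r a (eNot e) = ~~ b.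
Proof. by rewrite /eNot /= => ->; rewrite mod0n bool_mod //; case: b. Qed.

Lemma eval_or r a e1 e2 (b1 b2 : bool) : eval w r a e1 = b1 ->
  eval w r a e2 = b2 -> eval w r a (eOr e1 e2) = b1 || b2.
Proof.
move=> E1 E2; rewrite -[_ || _]negbK negb_or.
by apply: eval_not; apply: eval_and => [|_]; apply: eval_not.
Qed.

End WP.

(** * Cycles and breadth-first trees *)

Section Walks.
Variable T : eqType.
Implicit Types (e : rel T) (u v w z : T).

Definition walk e u v n := exists s, [/\ path e u s, last u s = v & size s = n].

Lemma walk0 e u : walk e u u 0. Proof. by exists [::]. Qed.

Lemma walk1 e u v : e u v -> walk e u v 1.
Proof. by move=> h; exists [:: v]; rewrite /= h. Qed.

Lemma walk_cat e u v w i j : walk e u v i -> walk e v w j -> walk e u w (i + j).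
Proof.
move=> [s [ps <- <-]] [s' [ps' <- <-]]; exists (s ++ s').
by rewrite cat_path last_cat size_cat ps.
Qed.

Lemma walk_sym e u v n : symmetric e -> walk e u v n -> walk e v u n.
Proof.
move=> se [s [ps <- <-]]; exists (rev (belast u s)).
rewrite size_rev size_belast rev_path.
have -> : path (fun z => e^~ z) u s = path e u s by apply: eq_path => a b; rewrite se.
rewrite ps; split=> //; case: s {ps} => //= y s; by rewrite rev_cons last_rcons.
Qed.

Lemma sub_walk e e' u v n : subrel e e' -> walk e u v n -> walk e' u v n.
Proof. by move=> ee [s [ps ? ?]]; exists s; split=> //; apply: sub_path ps. Qed.

Definition cyclen e (z y : T) l := [/\ 2 < l & exists c,
  [/\ size c = l, ucycle e c, z \in c & y \in c]].

(** The walk shortens to a simple path. As the edge itself is forbidden, this path is not a single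
    step, so closing it with the edge gives at least three vertices. *)
Lemma cycle_of_detour e z y n : symmetric e -> e z y -> z != y ->
  walk (fun u v => [&& e u v, ~~ ((u == z) && (v == y)) & ~~ ((u == y) && (v == z))]) z y n ->
  exists2 l, l <= n.+1 & cyclen e z y l.
Proof.
move=> se ezy zy [s [ps lst <-]]; case/shortenP: ps lst => p pp up sub lst.
have szp : size p <= size s by apply: uniq_leq_size => //; case/andP: up.
have pe : path e z p by apply: sub_path pp => a b /andP[].
exists (size p).+1 => //; split.
  case: p pp lst {up sub szp pe} => [|a [|b p]] //=.
    by move=> _ zy'; rewrite zy' eqxx in zy.
  by move=> /andP[/and3P[_ h _] _] ay; rewrite ay !eqxx in h.
exists (z :: p); split; rewrite ?mem_head //; last by rewrite -lst mem_last.
by apply/andP; split=> //; rewrite /= rcons_path pe lst se.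
Qed.

(** A cycle as an index function with [t s] repeating [t 0]: arcs become intervals of indices, and
    reversal becomes [s - i]. *)
Definition cycfun e s (t : nat -> T) :=
  [/\ forall i, i < s -> e (t i) (t i.+1), t s = t 0 &
      forall i j, i < s -> j < s -> t i = t j -> i = j].

Lemma cycfun_of e c v : ucycle e c -> v \in c ->
  exists t, [/\ cycfun e (size c) t, t 0 = v,
    forall i, i <= size c -> t i \in c & forall u, u \in c -> exists2 i, i < size c & t i = u].
Proof.
move=> /andP[cc uc] vc; have [i c' Ec] := rot_to vc.
have sz : size c = (size c').+1 by rewrite -(size_rot i) Ec.
have mc u : (u \in c) = (u \in v :: c') by rewrite -Ec mem_rot.
rewrite -(rot_uniq i) Ec in uc; rewrite -(rot_cycle i) Ec /= in cc.
exists (nth v (v :: c')); split=> //.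
- split.
  + move=> j; rewrite sz ltnS => lj; move/pathP: cc => /(_ v j).
    rewrite size_rcons ltnS => /(_ lj); rewrite -rcons_cons !nth_rcons ltnS lj.
    by rewrite /=; case: ltnP => // ge; rewrite if_same (nth_default v ge).
  + by rewrite sz /= nth_default.
  + by move=> j k; rewrite sz => lj lk /eqP; rewrite nth_uniq // => /eqP.
- move=> j _; rewrite mc; case: (ltnP j (size c').+1) => lj; first exact: mem_nth.
  by rewrite nth_default ?mem_head.
- by move=> u; rewrite mc => uin; exists (index u (v :: c')); rewrite ?nth_index // sz ltnS -ltnS -/(size (v :: c')) index_mem.
Qed.

Lemma walk_cycfun e s t i j : cycfun e s t -> i <= j <= s -> walk e (t i) (t j) (j - i).
Proof.
move=> [H _ _] /andP[]; elim: j => [|j IH].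
  by rewrite leqn0 => /eqP -> _; apply: walk0.
rewrite leq_eqVlt => /predU1P[-> _|]; first by rewrite subnn; apply: walk0.
rewrite ltnS => ij js; rewrite subSn // -[(j - i).+1]addn1.
by apply: walk_cat (IH ij (ltnW js)) (walk1 (H _ js)).
Qed.

Lemma cycfun_rev e s t : symmetric e -> cycfun e s t -> cycfun e s (fun i => t (s - i)).
Proof.
move=> se [H1 H2 H3]; split.
- move=> i li; rewrite se; have -> : s - i = (s - i.+1).+1 by slia.
  by apply: H1; slia.
- by rewrite subnn subn0.
- move=> i j li lj; case: i li => [|i] li; case: j lj => [|j] lj //.
  + rewrite subn0 H2 => h; have := H3 0 (s - j.+1) ltac:(slia) ltac:(slia) h; slia.
  + rewrite subn0 H2 => h; have := H3 (s - i.+1) 0 ltac:(slia) ltac:(slia) h; slia.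
  + by move=> h; have := H3 (s - i.+1) (s - j.+1) ltac:(slia) ltac:(slia) h; slia.
Qed.

End Walks.

Section Tree.
Variable (E : rel nat) (al : pred nat) (x : nat) (q : seq nat) (d p : nat -> nat).
Hypothesis Esym : symmetric E.
Hypothesis Eirr : irreflexive E.
Hypothesis xq : x \in q.
Hypothesis alx : al x.
Hypothesis dx : d x = 0.
Hypothesis px : p x = x.
Hypothesis parent : forall u : nat, u \in q -> u != x ->
  [/\ p u \in q, E (p u) u, al u & d u = (d (p u)).+1].
Hypothesis closed : forall u y : nat, u \in q -> E u y -> al y -> y \in q /\ d y <= (d u).+1.

Lemma q_al (u : nat) : u \in q -> al u.
Proof. by have [->|ux] := eqVneq u x => // uq; case: (parent uq ux). Qed.

Lemma p_q (u : nat) : u \in q -> p u \in q.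
Proof. by have [->|ux] := eqVneq u x; rewrite ?px // => uq; case: (parent uq ux). Qed.

Lemma iterp_q i (u : nat) : u \in q -> iter i p u \in q.
Proof. by elim: i => //= i IH /IH; apply: p_q. Qed.

Lemma d_p (u : nat) : u \in q -> d (p u) = (d u).-1.
Proof. by have [->|ux] := eqVneq u x; rewrite ?px ?dx // => uq; case: (parent uq ux) => _ _ _ ->. Qed.

(** The root is its own parent, so climbing too far stays at depth 0, in agreement with truncated
    subtraction. *)
Lemma d_iterp i (u : nat) : u \in q -> d (iter i p u) = d u - i.
Proof. by move=> uq; elim: i => [|i IH] /=; rewrite ?subn0 // d_p ?iterp_q // IH subnS. Qed.

Lemma d_eq0 (u : nat) : u \in q -> d u = 0 -> u = x.
Proof. by have [->|ux] := eqVneq u x => // uq; case: (parent uq ux) => _ _ _ ->. Qed.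

Lemma iterp_root i (u : nat) : u \in q -> d u <= i -> iter i p u = x.
Proof. by move=> uq le; apply: d_eq0; rewrite ?iterp_q ?d_iterp //; apply/eqP. Qed.

Lemma adj_depth (u y : nat) : u \in q -> y \in q -> E u y -> d y <= (d u).+1 /\ d u <= (d y).+1.
Proof.
move=> uq yq h; split; first by case: (closed uq h (q_al yq)).
by case: (@closed y u); rewrite 1?Esym ?q_al.
Qed.

Lemma walk_depth (u y n : nat) : u \in q -> walk (fun a b : nat => E a b && al b) u y n ->
  y \in q /\ d y <= d u + n.
Proof.
move=> uq [s [ps <- <-]]; elim: s u uq ps => [|a s IH] u uq /=; first by rewrite addn0.
case/andP=> /andP[h1 h2] ps; have [aq da] := closed uq h1 h2.
have [lq dl] := IH a aq ps; split=> //.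
by apply: leq_trans dl _; rewrite addnS -addSn leq_add2r.
Qed.

Lemma walk_climb (e : rel nat) (u i : nat) : u \in q -> i <= d u ->
  (forall j, j < i -> e (iter j p u) (p (iter j p u))) -> walk e u (iter i p u) i.
Proof.
move=> uq; elim: i => [|i IH] le H; first exact: walk0.
rewrite -addn1 /=; apply: walk_cat (IH _ _) _ => [|j lj|]; first by slia.
  by apply: H; slia.
by rewrite addn1 /=; apply: walk1; apply: H.
Qed.

(* From z down the tree to a, across to b, up to the root and down to p z:
   this avoids the edge (z, p z). *)
Lemma tree_detour (z a b i : nat) : a \in q -> b \in q -> E a b -> b != p a -> z = iter i p a ->
  (forall j, iter j p b <> z) -> exists2 l, l <= d a + d b + 1 & cyclen E z (p z) l.
Proof.
move=> aq bq Eab nab zi nb.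
have zq : z \in q by rewrite zi iterp_q.
have zx : z != x.
  by apply/eqP => zx; apply: (nb (d b)); rewrite zx iterp_root.
have [pzq Epz _ dz] := parent zq zx.
have dz' : d z = d a - i by rewrite zi d_iterp.
pose e' := fun u v => [&& E u v, ~~ ((u == z) && (v == p z)) & ~~ ((u == p z) && (v == z))].
have se' : symmetric e' by move=> u v; rewrite /e' Esym; do ! case: eqP => //.
have up (u : nat) : u \in q -> u != x -> u != z -> e' u (p u).
  move=> uq ux uz; have [_ h _ du] := parent uq ux.
  rewrite /e' Esym h (negPf uz) /=; apply/negP => /andP[/eqP h1 /eqP h2].
  by move: du; rewrite h2 h1; slia.
have climb (u k : nat) : u \in q -> k <= d u -> (forall j, j < k -> iter j p u != z) ->
  walk e' u (iter k p u) k.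
  move=> uq kd H; apply: walk_climb => // j jk; apply: up; rewrite ?iterp_q ?H //.
  by apply/eqP => h; have := d_iterp j uq; rewrite h dx; slia.
have w1 : walk e' z a (d a - d z).
  have zi' : iter (d a - d z) p a = z by rewrite [RHS]zi; congr iter; move: dz; slia.
  apply: (walk_sym se'); rewrite -[X in walk _ _ X]zi'.
  apply: climb => [//||j jl]; first by slia.
  by apply/eqP => h; have := d_iterp j aq; rewrite h; slia.
have w2 : e' a b.
  rewrite /e' Eab /=; apply/andP; split; apply/negP => /andP[/eqP h1 /eqP h2].
    by move: nab; rewrite h1 h2 eqxx.
  by apply: (nb 0); rewrite /= h2.
have w3 : walk e' b x (d b).
  by rewrite -(iterp_root bq (leqnn _)); apply: climb => // j _; apply/eqP/nb.
have w4 : walk e' x (p z) (d (p z)).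
  apply: (walk_sym se'); rewrite -[X in walk _ _ X](iterp_root pzq (leqnn _)).
  apply: climb => [//|//|j jl]; apply/eqP => h.
  by have := d_iterp j pzq; rewrite h; slia.
(* The pieces have lengths [d a - d z], 1, [d b] and [d z - 1], in total [d a + d b]; the closing
   edge adds one. *)
have W := walk_cat (walk_cat (walk_cat w1 (walk1 w2)) w3) w4.
have [||l ll cl] := cycle_of_detour Esym _ _ W; [by rewrite Esym| | ].
  by apply/eqP => h; move: dz; rewrite -h; slia.
by exists l => //; slia.
Qed.

(** An ancestor of [b0] is determined by its depth. If [iter i p a] were one, it would equal
    [iter i p b], which has the same depth. Comparing ancestors of equal depth thus tells whether a
    tree edge lies below the lowest common ancestor. *)
Lemma cover_sound (a0 b0 a b ia ib i : nat) : a0 \in q -> b0 \in q -> E a0 b0 ->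
  b0 != p a0 -> a = iter ia p a0 -> b = iter ib p b0 -> d a = d b ->
  iter i p a <> iter i p b ->
  exists2 l, l <= d a0 + d b0 + 1 & cyclen E (iter i p a) (p (iter i p a)) l.
Proof.
move=> aq bq Eab n1 ea eb dab nK.
have aq' : a \in q by rewrite ea iterp_q.
have bq' : b \in q by rewrite eb iterp_q.
apply: (@tree_detour _ a0 b0 (i + ia)) => //; first by rewrite ea iterD.
move=> j h; apply: nK; have dz := d_iterp i aq'; have dz' := d_iterp i bq'.
have [z0|z0] := posnP (d (iter i p a)).
  by rewrite (d_eq0 _ z0) ?iterp_q // (@d_eq0 (iter i p b)) ?iterp_q //; slia.
rewrite -h eb -iterD; congr iter.
have := d_iterp j bq; rewrite h; have := d_iterp ib bq; rewrite -eb.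
by have := d_iterp ia aq; rewrite -ea; slia.
Qed.

Section Crossing.
Variables (s : nat) (t : nat -> nat) (i0 delta : nat).
Hypothesis ct : cycfun E s t.
Hypothesis s2 : 2 < s.
Hypothesis alt : forall i, i <= s -> al (t i).
Hypothesis i0s : i0 <= s.
Hypothesis wq : t i0 \in q.
Hypothesis wd : d (t i0) <= delta.

Let walk_al i j : i <= j <= s -> walk (fun a b : nat => E a b && al b) (t i) (t j) (j - i).
Proof.
move=> ij; apply: (@walk_cycfun _ _ s) => //; case: ct => H1 H2 H3; split=> // k ks.
by rewrite H1 ?alt // ltnW.
Qed.

Let walk_la i j : i <= j <= s -> walk (fun a b : nat => E a b && al b) (t j) (t i) (j - i).
Proof.
move=> ij; have [H1 H2 H3] := cycfun_rev Esym ct.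
have := @walk_cycfun _ (fun a b : nat => E a b && al b) s (fun i => t (s - i)) (s - j) (s - i).
rewrite !subKn; [|slia|slia]; have -> : s - i - (s - j) = j - i by slia.
apply; last slia; split=> // k ks.
by rewrite H1 //=; apply: alt; slia.
Qed.

Let cyc_q i : i <= s -> t i \in q.
Proof.
move=> si; have [ii|ii] := leqP i0 i.
  by case: (walk_depth wq (walk_al (i := i0) (j := i) _)) => //; apply/andP.
by case: (walk_depth wq (walk_la (i := i) (j := i0) _)) => //; slia.
Qed.

(** The two arcs from [t i0] to the ends of the edge consist of the other [s - 1] edges of the
    cycle, so the two depths sum to at most [2 * delta + s - 1]. *)
Let cyc_edge i : i < s -> d (t i) + d (t i.+1) + 1 <= s + 2 * delta.
Proof.
move=> si; have t0s : t s = t 0 by case: ct.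
have wdep j n : walk (fun a b : nat => E a b && al b) (t i0) (t j) n -> d (t j) <= delta + n.
  by move=> wk; have [_ h] := walk_depth wq wk; slia.
have [ii|ii] := leqP i0 i.
  have h1 := wdep _ _ (@walk_al i0 i ltac:(slia)).
  have wk := @walk_la i.+1 s ltac:(slia); rewrite t0s in wk.
  by have h2 := wdep _ _ (walk_cat (@walk_la 0 i0 ltac:(slia)) wk); slia.
have h1 := wdep _ _ (@walk_la i.+1 i0 ltac:(slia)).
have wk := @walk_al i0 s ltac:(slia); rewrite t0s in wk.
by have h2 := wdep _ _ (walk_cat wk (@walk_al 0 i ltac:(slia))); slia.
Qed.

Definition crossing (z a b : nat) := [/\ z \in q, z != x & a \in q] /\ [/\ b \in q, E a b, b != p a,
  a != p b & (exists i, z = iter i p a) /\ (forall j, iter j p b <> z)].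

(** Depths of adjacent vertices differ by at most one, so a non-root [v] could be an ancestor of [y]
    only as [y] or as its parent. The root has no non-tree edges, since all its neighbours are its
    children. *)
Let nontree_crossing (v y : nat) : v \in q -> y \in q -> E v y -> p y != v -> p v != y ->
  crossing v v y.
Proof.
move=> vq yq h n1 n2; have [h1 h2] := adj_depth vq yq h.
have vx : v != x.
  apply/eqP => vx; have yx : y != x by apply/eqP => yx; rewrite yx -vx Eirr in h.
  have [pyq _ _ dy] := parent yq yx; move: n1; rewrite (@d_eq0 (p y)) ?vx ?eqxx //.
  by move: h1; rewrite vx dx; slia.
split; split=> //; rewrite 1?eq_sym //; split=> [|j hj]; first by exists 0.
have dj := d_iterp j yq; rewrite hj in dj.
have : j = 0 \/ j = 1 \/ 2 <= j by slia.
case=> [j0|[j1|j2]].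
- by move: hj h; rewrite j0 /= => ->; rewrite Eirr.
- by move: hj n1; rewrite j1 /= => ->; rewrite eqxx.
- have : d v = 0 by slia.
  by move/(d_eq0 vq)/eqP; rewrite (negPf vx).
Qed.

(** If a cycle neighbour of [t 0] is its child, the tree edge to that child is used. Otherwise one
    of the two distinct neighbours is not the parent either, and the cycle edge to it is a non-tree
    edge. This is why a value must be reported at both ends of a tree edge. *)
Lemma cycle_crossing : exists z a b, [/\ z = t 0 \/ p z = t 0, crossing z a b &
  d a + d b + 1 <= s + 2 * delta].
Proof.
have [H1 H2 H3] := ct; have e1 := H1 0 ltac:(slia).
have e2 := H1 s.-1 ltac:(slia); rewrite prednK ?H2 in e2; last slia.
have q0 := cyc_q (leq0n _); have q1 := cyc_q (i := 1) ltac:(slia).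
have q2 := cyc_q (i := s.-1) ltac:(slia).
have b1 := cyc_edge (i := 0) ltac:(slia).
have := cyc_edge (i := s.-1) ltac:(slia); rewrite prednK ?H2; last slia; move=> b2.
have n12 : t 1 <> t s.-1 by move=> h; have := H3 1 s.-1 ltac:(slia) ltac:(slia) h; slia.
(* If the tree edge from t 0 to its child z lies on the cycle, the rest of the
   cycle leaves the subtree of z. *)
have child (z : nat) (r : nat -> nat) : cycfun E s r -> (forall i, i <= s -> r i \in q) ->
   (forall i, i < s -> d (r i) + d (r i.+1) + 1 <= s + 2 * delta) -> r 0 = t 0 -> r 1 = z ->
   p z = t 0 -> exists a b, crossing z a b /\ d a + d b + 1 <= s + 2 * delta.
  move=> [R1 R2 R3] rq rb r0 r1 pz.
  have zq : z \in q by rewrite -r1 rq //; slia.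
  have zt : z != t 0 by apply/eqP => h; have := R3 0 1 ltac:(slia) ltac:(slia); rewrite r0 r1 h => /(_ erefl).
  have zx : z != x by apply/eqP => h; move: zt; rewrite -pz h px eqxx.
  have [_ _ _ dz] := parent zq zx.
  (* For [u] in the tree, [P u] says that [z] is an ancestor of [u], tested at the only possible
     number of steps. *)
  pose P (u : nat) := iter (d u - d z) p u == z.
  have Pz : P (r 1) by rewrite /P r1 subnn.
  have nPs : ~~ P (r s).
    have d0 : d (t 0) - d z = 0 by rewrite -pz dz; slia.
    by rewrite /P R2 r0 d0 /= eq_sym.
  have PP (u j : nat) : u \in q -> iter j p u = z -> P u.
    move=> uq hj; have dj := d_iterp j uq; rewrite hj in dj; rewrite /P.
    have dz0 : 0 < d z by rewrite dz.
    by rewrite (_ : d u - d z = j) ?hj //; slia.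
  have ex : exists i, (0 < i) && ~~ P (r i) by exists s; rewrite nPs andbT; slia.
  case: (ex_minnP ex) => i /andP[i0' nPi] mini.
  have is_ : i <= s by apply: mini; rewrite nPs andbT; slia.
  have i1 : 1 < i by rewrite ltn_neqAle i0' andbT; apply: contra nPi => /eqP <-.
  have Pi : P (r i.-1).
    by apply/negPn/negP => h; have := mini i.-1; rewrite h andbT; slia.
  have Ei := R1 i.-1 ltac:(slia); have Bi := rb i.-1 ltac:(slia); rewrite prednK // in Ei Bi.
  exists (r i.-1), (r i); split=> //.
  have aq : r i.-1 \in q by apply: rq; slia.
  have bq : r i \in q by apply: rq.
  split; split=> //.
  (* A tree edge leaving the subtree of [z] upwards starts at [z]. Then [i = 2] and
     [r 2 = p z = r 0], which [2 < s] excludes. *)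
  - apply/eqP => h; move: nPi; rewrite h => nPi.
    have az : r i.-1 = z.
      apply/eqP; move: Pi; rewrite /P; case E0: (d (r i.-1) - d z) => [|k] //.
      by rewrite iterSr => /eqP /PP; rewrite p_q // => /(_ isT); rewrite (negPf nPi).
    have ei1 : i.-1 = 1 by apply: R3; rewrite ?r1 //; slia.
    have h0 : 0 = i by apply: R3; [slia|slia|rewrite h az pz r0].
    by slia.
  - apply/eqP => h; move: nPi; rewrite (PP _ (d (r i.-1) - d z).+1) //.
    by rewrite iterSr -h; apply/eqP.
  - split; first by exists (d (r i.-1) - d z); apply/esym/eqP.
    by move=> j hj; move: nPi; rewrite (PP _ j).
have [p1|np1] := eqVneq (p (t 1)) (t 0).
  have [a [b [? ?]]] := child (t 1) t ct cyc_q cyc_edge erefl erefl p1.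
  by exists (t 1), a, b; split=> //; right.
have [p2|np2] := eqVneq (p (t s.-1)) (t 0).
  have rb i : i < s -> d (t (s - i)) + d (t (s - i.+1)) + 1 <= s + 2 * delta.
    move=> si; have := @cyc_edge (s - i.+1) ltac:(slia).
    by rewrite (_ : (s - i.+1).+1 = s - i); slia.
  have [a [b [? ?]]] := child (t s.-1) (fun i => t (s - i)) (cycfun_rev Esym ct)
    (fun i _ => cyc_q (leq_subr i s)) rb
    (etrans (congr1 t (subn0 s)) H2) (congr1 t (subn1 s)) p2.
  by exists (t s.-1), a, b; split=> //; right.
have [p3|np3] := eqVneq (p (t 0)) (t 1).
  exists (t 0), (t 0), (t s.-1); split; [by left| |by slia].
  apply: nontree_crossing => //; first by rewrite Esym.
  by apply/eqP => h; apply: n12; rewrite -p3 -h.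
by exists (t 0), (t 0), (t 1); split; [by left|apply: nontree_crossing|slia].
Qed.

End Crossing.
End Tree.

(** * Breadth-first search *)

Notation "c1 ;; c2" := (Seq c1 c2) (at level 90, right associativity).
Notation "x <~ e" := (Assign x e) (at level 85).
Notation "e1 .+ e2" := (Bin Add e1 e2) (at level 50, left associativity).
Notation "e1 .- e2" := (Bin Defs.Sub e1 e2) (at level 50, left associativity).
Notation "e1 .* e2" := (Bin Mul e1 e2) (at level 40, left associativity).
Notation "e1 .< e2" := (Bin Lt e1 e2) (at level 70).
Notation "e1 .= e2" := (Bin Eq e1 e2) (at level 70).

(* The graph and the scratch data of a search live in arrays addressed by vertices
   or by row * ST + column, with ST = n + 2m.  Rows u < n of AD (of length
   DG[u]) are adjacency lists; row n + u holds the ball of u, whose length is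
   PS[u], and DG[n + u] is the length of its inner part, so that shifting the
   rows by the register OF = n makes the search follow inner balls.  NV lists
   the vertices of positive degree, MK marks the allowed ones, Q is the queue,
   D the depth, UP and M the ancestor and cycle-length tables of binary lifting,
   IN the incidence matrix of the balls, HT marks the balls still to be hit and
   CNT counts those containing a vertex. *)
Notation rN := 0. Notation rM := 1. Notation rK := 2. Notation rST := 3.
Notation rNV := 4. Notation rJ := 5. Notation rAL := 6. Notation rTAG := 7.
Notation rX := 8. Notation rBUD := 9. Notation rKK := 10. Notation rOF := 11.
Notation rH := 12. Notation rC := 13. Notation rVOL := 14. Notation rU := 15.
Notation rDG := 16. Notation rj := 17. Notation rY := 18. Notation rBASE := 19.
Notation ri := 20. Notation rJJ := 21. Notation rA := 22. Notation rB := 23.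
Notation rVAL := 24. Notation rUA := 25. Notation rUB := 26. Notation rO := 27.
Notation rBEST := 28. Notation rBU := 29. Notation rW := 30. Notation rT := 31.
Notation rGO := 32. Notation rPR := 33. Notation rP := 34.

Notation aEST := 2. Notation aDG := 3. Notation aAD := 4. Notation aNV := 5.
Notation aMK := 6. Notation aPOS := 7. Notation aD := 8. Notation aUP := 9.
Notation aM := 10. Notation aQ := 11. Notation aPS := 12. Notation aIN := 13.
Notation aCNT := 14. Notation aHT := 15.

Definition incr x := x <~ Reg x .+ Const 1.

(* Membership in the queue is tested by the position array, which therefore
   never needs to be initialized. *)
Definition visited :=
  eAnd (Get aPOS (Reg rY) .< Reg rC) (Get aQ (Get aPOS (Reg rY)) .= Reg rY).

(** Successive local searches use growing tags, so older marks become invalid without being erased;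
    tag 0 allows every vertex. *)
Definition allowed := eNot (Get aMK (Reg rY) .< Reg rTAG).

Definition bfs_scan :=
  rY <~ Get aAD (Reg rBASE .+ Reg rj) ;;
  If (eAnd (eNot visited) allowed)
    (Store aQ (Reg rC) (Reg rY) ;;
     Store aPOS (Reg rY) (Reg rC) ;;
     Store aD (Reg rY) (Get aD (Reg rU) .+ Const 1) ;;
     Store aUP (Reg rY) (Reg rU) ;;
     incr rC)
    Skip ;;
  incr rj.

(** One routine serves three purposes: the volume budget cuts off inner balls, the depth limit
    bounds the number of steps between inner balls, and a full search sets both out of reach. The
    depth test admits expansion up to [rKK - 2], so the queue reaches depth at most [rKK - 1]. *)
Definition bfs_guard :=
  eAnd (Reg rH .< Reg rC)
    (eAnd (Reg rVOL .+ Get aDG (Reg rOF .+ Get aQ (Reg rH)) .< Reg rBUD)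
          (Get aD (Get aQ (Reg rH)) .+ Const 1 .< Reg rKK)).

Definition bfs :=
  Store aQ (Const 0) (Reg rX) ;;
  Store aPOS (Reg rX) (Const 0) ;;
  Store aD (Reg rX) (Const 0) ;;
  Store aUP (Reg rX) (Reg rX) ;;
  rC <~ Const 1 ;; rH <~ Const 0 ;; rVOL <~ Const 0 ;;
  While bfs_guard
    (rU <~ Get aQ (Reg rH) ;;
     rDG <~ Get aDG (Reg rOF .+ Reg rU) ;;
     rVOL <~ Reg rVOL .+ Reg rDG ;;
     rBASE <~ (Reg rOF .+ Reg rU) .* Reg rST ;;
     rj <~ Const 0 ;;
     While (Reg rj .< Reg rDG) bfs_scan ;;
     incr rH).

Ltac bnd := try solve [assumption |
  match goal with
  | W : forall z, is_true (z <= _) -> is_true (z < 2 ^ _) |- is_true (_ < 2 ^ _) =>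
      apply: W; slia
  | W : forall u j, is_true (u <= _) -> is_true (j <= _) -> is_true (u * ?S + j < 2 ^ _)
      |- is_true (_ * ?S + _ < 2 ^ _) => apply: W; slia
  | W : forall u j, is_true (u <= _) -> is_true (j <= _) -> is_true (u * ?S + j < 2 ^ _)
      |- is_true (_ * ?S < 2 ^ _) => apply: leq_ltn_trans (leq_addr 0 _) (W _ _ _ _); slia
  end].

Lemma updS A (f : nat -> A) x v : upd f x v x = v.
Proof. by rewrite /upd eqxx. Qed.

Lemma updN A (f : nat -> A) x v y : y != x -> upd f x v y = f y.
Proof. by rewrite /upd => /negPf ->. Qed.

Lemma wp_store_at w t i e iv v f Q r a tau :
  eval w r a i = iv -> eval w r a e = v -> a t = f ->
  Q r (upd a t (upd f iv v)) tau -> wp w (Store t i e) Q r a tau.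
Proof. by move=> ? ? <-; apply: wp_store. Qed.

Ltac rd :=
  lazymatch goal with
  | |- @upd (nat -> nat) ?f ?x ?v ?y ?z = _ =>
      let b := eval compute in (eqn y x) in
      lazymatch b with
      | true => rewrite (@updS _ f x v); rd
      | false => rewrite (@updN _ f x v y isT); rd
      | _ => first [eassumption | reflexivity]
      end
  | |- upd ?f ?x ?v ?y = _ =>
      let b := eval compute in (eqn y x) in
      lazymatch b with
      | true => apply: etrans (@updS _ f x v) _; rd
      | false => apply: etrans (@updN _ f x v y isT) _; rd
      | _ => first [eassumption | reflexivity]
      end
  | _ => first [eassumption | reflexivity]
  end.

Ltac su :=
  repeat match goal with
  | |- context [@upd ?A ?f ?x ?v ?y] =>
      let b := eval compute in (eqn y x) in
      lazymatch b with
      | true => rewrite (@updS A f x v)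
      | false => rewrite (@updN A f x v y isT)
      end
  end.

Ltac ev :=
  lazymatch goal with
  | |- eval _ _ _ (Reg _) = _ => apply eval_reg; rd
  | |- eval _ _ _ (Const _) = _ => apply eval_const; bnd
  | |- eval _ _ _ (Get _ _) = _ => eapply eval_get; [ev | rd]
  | |- eval _ _ _ (eAnd _ _) = _ =>
      eapply eval_and; [assumption | ev | let h := fresh "ga" in move=> h; ev]
  | |- eval _ _ _ (eNot _) = _ => eapply eval_not; [assumption | ev]
  | |- eval _ _ _ (eOr _ _) = _ => eapply eval_or; [assumption | ev | ev]
  | |- eval _ _ _ (Bin Add _ _) = _ => eapply eval_add; [ev | ev | bnd]
  | |- eval _ _ _ (Bin Mul _ _) = _ => eapply eval_mul; [ev | ev | bnd]
  | |- eval _ _ _ (Bin Defs.Sub _ _) = _ => eapply eval_sub; [ev | ev | bnd]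
  | |- eval _ _ _ (Bin Lt _ _) = _ => eapply eval_lt; [assumption | ev | ev]
  | |- eval _ _ _ (Bin Eq _ _) = _ => eapply eval_eq; [assumption | ev | ev]
  | |- eval _ _ _ ?e = _ => let e' := eval red in e in change e with e'; ev
  | _ => idtac
  end.

Ltac run :=
  lazymatch goal with
  | |- wp _ (Seq _ _) _ _ _ _ => apply wp_seq; run
  | |- wp _ Skip _ _ _ _ => apply wp_skip; cbv beta; run
  | |- wp _ (Assign _ _) _ _ _ _ => eapply wp_assign; [ev | cbv beta; run]
  | |- wp _ (Store _ _ _) _ _ _ _ => eapply wp_store_at; [ev | ev | rd | cbv beta; run]
  | |- wp _ (incr _) _ _ _ _ => eapply wp_assign; [ev | cbv beta; run]
  | _ => idtac
  end.

(* Facts [r x = v] about registers outside [c] survive the execution of [c]. *)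
Ltac keep F :=
  lazymatch type of F with
  | frame ?c ?r ?a ?r' ?a' =>
    repeat match goal with
    | H : r ?x = ?v |- _ =>
        lazymatch goal with _ : r' x = v |- _ => fail | _ => idtac end;
        assert (r' x = v) by (rewrite (proj1 F x isT); exact H)
    end
  end.

(* Names the current state and transports the known register contents to it. *)
Ltac freeze r0 a0 Er Ea :=
  match goal with |- wp _ _ _ ?R ?A _ =>
    remember R as r0 eqn:Er; remember A as a0 eqn:Ea end;
  repeat match goal with
  | H : ?r ?x = ?v |- _ =>
      lazymatch goal with _ : r0 x = v |- _ => fail | _ => idtac end;
      assert (r0 x = v) by (rewrite Er; su; exact H)
  end.

Lemma ltn_idx ST u u' j j' : j < ST -> j' < ST ->
  (u * ST + j == u' * ST + j') = (u == u') && (j == j').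
Proof.
move=> h h'; apply/eqP/andP => [e|[/eqP -> /eqP ->]] //.
have e1 := congr1 (divn^~ ST) e; have e2 := congr1 (modn^~ ST) e.
rewrite !divnMDl ?divn_small ?addn0 in e1; [|lia|lia..].
by rewrite /= !modnMDl !modn_small // in e2; rewrite e1 e2.
Qed.

Lemma word_idx ST w : (ST + 10) ^ 3 < 2 ^ w ->
  forall u j, u <= 3 * ST -> j <= 3 * ST -> u * ST + j < 2 ^ w.
Proof.
by move=> bigW u j h1 h2; apply: leq_ltn_trans bigW; rewrite !expnS expn0; nia.
Qed.

Lemma word_small ST w : (ST + 10) ^ 3 < 2 ^ w ->
  forall u, u <= 3 * ST + 9 -> u < 2 ^ w.
Proof.
by move=> bigW u h1; apply: leq_ltn_trans bigW; rewrite !expnS expn0; nia.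
Qed.

Section BFS.
Variables (n ST w : nat) (nb : nat -> seq nat) (al : pred nat) (x : nat).

Definition sorted_by (d : nat -> nat) (q : seq nat) :=
  forall i j, i <= j -> j < size q -> d (nth 0 q i) <= d (nth 0 q j).

(** [hp] counts the vertices whose expansion has begun and [L] is the level being expanded: depths
    never exceed [L.+1], so a child can be appended without breaking the order. Bounding depth by
    queue position keeps depths within a word. *)
Definition bfs_core (q : seq nat) hp (d p : nat -> nat) L :=
  [/\ uniq q, nth 0 q 0 = x, 0 < size q & forall u : nat, u \in q -> u < n] /\
  [/\ d x = 0, p x = x, sorted_by d q &
   (forall i, i < size q -> d (nth 0 q i) <= i) /\
   (forall u : nat, u \in q -> d u <= L.+1) /\
   (forall u : nat, u \in q -> u != x ->
     [/\ p u \in take hp q, u \in nb (p u), al u & d u = (d (p u)).+1])].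

Definition scanned (q : seq nat) (d : nat -> nat) u (s : seq nat) :=
  forall y : nat, y \in s -> al y -> y \in q /\ d y <= (d u).+1.

Lemma take_rcons_mem (q : seq nat) h (y u : nat) : u \in take h q -> u \in take h (rcons q y).
Proof.
move=> uq; rewrite -cats1 take_cat; case: ltnP => // le.
by rewrite mem_cat (mem_take uq).
Qed.

Lemma bfs_push q hp d p u (y : nat) : bfs_core q hp d p (d u) -> u \in take hp q ->
  y \notin q -> y < n -> al y -> y \in nb u -> d u < size q ->
  bfs_core (rcons q y) hp (upd d y (d u).+1) (upd p y u) (d u).
Proof.
move=> [[uq q0 s0 qn] [dx px so [di [dL par]]]] uh yq yn aly ynb ds.
have xq : x \in q by rewrite -q0 mem_nth.
have ne (v : nat) : v \in q -> (v == y) = false.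
  by move=> vq; apply: contraNF yq => /eqP <-.
have nthq i : i < size q -> nth 0 (rcons q y) i = nth 0 q i by rewrite nth_rcons => ->.
have nths : nth 0 (rcons q y) (size q) = y by rewrite nth_rcons ltnn eqxx.
have un i : i < size q -> upd d y (d u).+1 (nth 0 q i) = d (nth 0 q i).
  by move=> h; rewrite /upd ne // mem_nth.
have uy : upd d y (d u).+1 y = (d u).+1 by rewrite /upd eqxx.
split; split.
- by rewrite rcons_uniq yq.
- by rewrite nthq.
- by rewrite size_rcons.
- by move=> v; rewrite mem_rcons inE => /predU1P[->|/qn].
- by rewrite /upd ne.
- by rewrite /upd ne.
- move=> i j ij; rewrite size_rcons ltnS leq_eqVlt => /predU1P[ej|jq].
    rewrite ej in ij *; rewrite nths uy; move: ij; rewrite leq_eqVlt => /predU1P[->|iq]; first by rewrite nths uy.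
    by rewrite nthq ?un // dL ?mem_nth.
  by rewrite !nthq ?un //; [apply: so|lia|lia].
- split=> [i|].
    rewrite size_rcons ltnS leq_eqVlt => /predU1P[->|iq]; first by rewrite nths uy.
    by rewrite nthq // un // di.
  split=> v; rewrite mem_rcons inE => /predU1P[->|vq]; rewrite ?uy //.
  + by rewrite /upd ne // dL.
  + move=> yx; rewrite /upd eqxx ne ?(mem_take uh) //; split=> //.
    exact: take_rcons_mem.
  + move=> vx; have [h1 h2 h3 h4] := par v vq vx.
    rewrite /upd !ne ?(mem_take h1) //; split=> //.
    exact: take_rcons_mem.
Qed.

Definition queue (r : nat -> nat) (a : nat -> nat -> nat) q :=
  [/\ r rC = size q, forall i, i < size q -> a aQ i = nth 0 q i &
      forall i, i < size q -> a aPOS (nth 0 q i) = i].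

Lemma queue_mem r a q (y : nat) : queue r a q ->
  (a aPOS y < r rC) && (a aQ (a aPOS y) == y) = (y \in q).
Proof.
move=> [-> qi qp]; apply/andP/idP => [[h /eqP <-]|yq].
  by rewrite qi // mem_nth.
have iq : index y q < size q by rewrite index_mem.
by have := qp _ iq; rewrite nth_index // => ->; rewrite qi // nth_index.
Qed.

Lemma queue_ext r a r' a' q : r' rC = r rC -> a' aQ = a aQ -> a' aPOS = a aPOS ->
  queue r a q -> queue r' a' q.
Proof. by move=> e1 e2 e3 [? ? ?]; split; rewrite ?e1 ?e2 ?e3. Qed.

Lemma queue_push r a q (y : nat) : queue r a q -> y \notin q ->
  queue (upd r rC (size q).+1)
    (upd (upd a aQ (upd (a aQ) (size q) y)) aPOS (upd (a aPOS) y (size q))) (rcons q y).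
Proof.
move=> [rq qi qp] yq; split; rewrite /upd /= ?size_rcons // => i; rewrite ltnS leq_eqVlt.
  by case/predU1P=> [->|iq]; rewrite ?eqxx nth_rcons ?ltnn ?eqxx // iq (ltn_eqF iq) qi.
case/predU1P=> [->|iq]; rewrite nth_rcons ?ltnn ?eqxx // iq.
by case: eqP => [e|_]; [rewrite -e mem_nth in yq | exact: qp].
Qed.

Definition volume (s : seq nat) := \sum_(u <- s) size (nb u).

Definition adjrep (deg row : nat -> nat) off := forall u, u < n ->
  deg (off + u) = size (nb u) /\
  forall j, j < size (nb u) -> row ((off + u) * ST + j) = nth 0 (nb u) j.

(** The alternative [h = 0] covers the start, where the budget may be zero. The condition on [L] at
    the next vertex is what allows its expansion to begin. *)
Definition bfs_inv q h (d p : nat -> nat) vol bud kk :=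
  [/\ exists2 L, bfs_core q h d p L & h < size q -> L <= d (nth 0 q h),
      h <= size q,
      forall u : nat, u \in take h q -> scanned q d u (nb u) /\ (d u).+1 < kk,
      vol = volume (take h q) & h = 0 \/ vol < bud].

Hypothesis w0 : 0 < w.
Hypothesis bigW : (ST + 10) ^ 3 < 2 ^ w.
Hypothesis nST : n < ST.
Hypothesis nb_n : forall u y : nat, u < n -> y \in nb u -> y < n.
Hypothesis nb_ST : forall u, u < n -> size (nb u) < ST.

Lemma sizeq_n (q : seq nat) : uniq q -> (forall u : nat, u \in q -> u < n) -> size q <= n.
Proof.
move=> uq qn; rewrite -[leqRHS](size_iota 0); apply: uniq_leq_size => // u /qn.
by rewrite mem_iota.
Qed.

Let W_idx := word_idx bigW.
Let W_small := word_small bigW.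

Lemma eval_visited r a q (y : nat) : r rY = y -> queue r a q ->
  eval w r a visited = (y \in q).
Proof.
by move=> ry qu; rewrite -(queue_mem y qu) /visited; ev.
Qed.

Lemma bfs_scan_wp (q0 : seq nat) (u : nat) h base tag r a tau :
  r rU = u -> r rDG = size (nb u) -> r rj = 0 ->
  r rBASE = base -> base <= 2 * ST * ST ->
  (forall j, j < size (nb u) -> a aAD (base + j) = nth 0 (nb u) j) ->
  r rTAG = tag -> (forall y, al y = ~~ (a aMK y < tag)) ->
  queue r a q0 -> bfs_core q0 h.+1 (a aD) (a aUP) (a aD u) ->
  u \in take h.+1 q0 -> u < n -> a aD u < size q0 ->
  wp w (While (Reg rj .< Reg rDG) bfs_scan) (fun r' a' t =>
    t = tau + size (nb u) /\ exists q : seq nat,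
    [/\ queue r' a' q, bfs_core q h.+1 (a' aD) (a' aUP) (a aD u),
        scanned q (a' aD) u (nb u), take (size q0) q = q0 &
        forall v : nat, v \in q0 -> a' aD v = a aD v]) r a tau.
Proof.
move=> ru rdg rj0 rb bb row rt alE qu0 core0 uh un du.
apply: (@wp_whilef _ (fun r' a' t => exists j, [/\ r' rj = j, j <= size (nb u), t = tau + j & exists q : seq nat,
    [/\ queue r' a' q, bfs_core q h.+1 (a' aD) (a' aUP) (a aD u),
        scanned q (a' aD) u (take j (nb u)), take (size q0) q = q0 &
        forall v : nat, v \in q0 -> a' aD v = a aD v]]) (tau + size (nb u))).
- by exists 0; split; rewrite ?addn0 //; exists q0; split; rewrite ?take_size ?take0.
- by move=> r' a' t [j [_ ? -> _]]; rewrite leq_add2l.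
- move=> r' a' t [j [rj' jle -> [q [qu core scn tq dq]]]] F; keep F.
  rewrite (eval_lt w0 (x := j) (y := size (nb u))) ?rj' //; case: ltnP => // jlt _.
  have [uqn qn] : uniq q /\ forall v : nat, v \in q -> v < n by case: core => -[].
  have qle := sizeq_n uqn qn; have [rc qi qp] := qu.
  have nbS := nb_ST un.
  have u0 : u \in q0 by apply: mem_take uh.
  have uq : u \in q by rewrite -(cat_take_drop (size q0) q) tq mem_cat u0.
  have dun : a' aD u <= n.
    have [_ [_ _ _ [di _]]] := core; have := di (index u q).
    by rewrite index_mem nth_index // => /(_ uq) /leq_trans; apply; apply: leq_trans qle; rewrite ltnW // index_mem.
  have yE : a' aAD (base + j) = nth 0 (nb u) j by rewrite (proj2 F) // row.
  have mE : a' aMK = a aMK by rewrite (proj2 F).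
  set y := nth 0 (nb u) j in yE; have yn : y \in nb u by rewrite mem_nth.
  have tk : take j.+1 (nb u) = rcons (take j (nb u)) y by rewrite (take_nth 0).
  have Wb : base + j < 2 ^ w by apply: leq_ltn_trans bigW; rewrite !expnS expn0; nia.
  have W3 z : z <= 3 * ST + 9 -> z < 2 ^ w := @W_small z.
  rewrite /bfs_scan; run.
  apply: (@wp_ifb _ _ _ _ ((y \notin q) && al y)).
  + apply: eval_and => // [|_]; first by apply: eval_not => //; apply: eval_visited.
    by rewrite alE -mE; ev.
  + case/andP=> yq aly; run.
    exists j.+1; su; split; rewrite ?addn1 ?addnS //.
    exists (rcons q y); su; rewrite tk.
    have du' : a' aD u = a aD u by apply: dq.
    have uh' : u \in take h.+1 q.
      by rewrite -(cat_take_drop (size q0) q) tq take_cat; case: ifP => // _; rewrite mem_cat u0.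
    have sq : size q0 <= size q by rewrite -tq size_take; case: ltnP => // /ltnW.
    split.
    * by apply: queue_ext (queue_push qu yq); su.
    * rewrite -du'; apply: bfs_push => //; rewrite ?du' //; first exact: (nb_n un yn).
      exact: leq_trans du sq.
    * have yu : (u == y) = false by apply: contraNF yq => /eqP <-.
      move=> v; rewrite mem_rcons inE => /predU1P[-> _|vt av].
        by rewrite mem_rcons mem_head /upd eqxx yu.
      have [vq dv] := scn v vt av; rewrite mem_rcons inE vq orbT; split=> //.
      by rewrite /upd yu; case: eqP => // e; rewrite -e vq in yq.
    * by rewrite -cats1 takel_cat.
    * move=> v vq; rewrite /upd -dq //; case: eqP => // e; case/negP: yq.
      by rewrite -e -(cat_take_drop (size q0) q) tq mem_cat vq.
  + rewrite negb_and negbK => H'; run.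
    exists j.+1; su; split; rewrite ?addn1 ?addnS //.
    exists q; su; rewrite tk; split=> //.
    move=> v; rewrite mem_rcons inE => /predU1P[-> ay|]; last exact: scn.
    have yq : y \in q by case/orP: H'; rewrite ?ay.
    split=> //; have [_ [_ _ _ [_ [dL _]]]] := core.
    by rewrite (dq u u0) dL.
- move=> r' a' t [j [rj' jle -> [q [qu core scn tq dq]]]] F; keep F.
  rewrite (eval_lt w0 (x := j) (y := size (nb u))) ?rj' //; case: ltnP => // jlt _.
  have ej : j = size (nb u) by apply/eqP; rewrite eqn_leq jle.
  by rewrite ej in scn *; split=> //; exists q; split=> //; rewrite take_size in scn.
Qed.

Lemma volume_le q : (forall u : nat, u \in q -> u < n) -> volume q <= size q * ST.
Proof.
move=> qn; rewrite /volume -sum1_size big_distrl /= big_seq [leqRHS]big_seq.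
by apply: leq_sum => u /qn /nb_ST; rewrite mul1n => /ltnW.
Qed.

Lemma bfs_wp bud kk off tag r a tau :
  r rX = x -> r rBUD = bud -> r rKK = kk -> r rOF = off -> r rTAG = tag -> r rST = ST ->
  x < n -> off <= n -> adjrep (a aDG) (a aAD) off ->
  (forall y, al y = ~~ (a aMK y < tag)) ->
  wp w bfs (fun r' a' t => exists (q : seq nat) h vol,
    [/\ [/\ r' rH = h, r' rVOL = vol, queue r' a' q & t = tau + h + vol],
        bfs_inv q h (a' aD) (a' aUP) vol bud kk &
        [\/ h = size q, bud <= vol + size (nb (nth 0 q h)) | kk <= (a' aD (nth 0 q h)).+1]])
    r a tau.
Proof.
move=> rx rbud rkk rof rtag rst xn offn adj alE.
have W3 z : z <= 3 * ST + 9 -> z < 2 ^ w := @W_small z.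
rewrite /bfs; run.
freeze r0 a0 Er Ea.
have [Eq0 Ep0 Ed0 Eu0] : [/\ a0 aQ = upd (a aQ) 0 x, a0 aPOS = upd (a aPOS) x 0,
  a0 aD = upd (a aD) x 0 & a0 aUP = upd (a aUP) x x] by rewrite Ea; su.
have mE0 : a0 aMK = a aMK by rewrite Ea; su.
have dE0 : a0 aDG = a aDG by rewrite Ea; su.
have aE0 : a0 aAD = a aAD by rewrite Ea; su.
have [r13 r12 r14] : [/\ r0 rC = 1, r0 rH = 0 & r0 rVOL = 0] by rewrite Er; su.
clear Er Ea.
have G r1 a1 q h vol : r1 rH = h -> r1 rVOL = vol -> r1 rOF = off -> r1 rBUD = bud ->
    r1 rKK = kk -> a1 aDG = a aDG -> queue r1 a1 q -> bfs_inv q h (a1 aD) (a1 aUP) vol bud kk ->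
    [/\ vol <= n * ST, (h < size q -> nth 0 q h < n), size q <= n &
    eval w r1 a1 bfs_guard = [&& h < size q, vol + size (nb (nth 0 q h)) < bud &
                                (a1 aD (nth 0 q h)).+1 < kk]].
  move=> h1 h2 h3 h4 h5 dE [rc qi qp] [[L core dL] hq scn vE vb].
  have [[uq _ _ qn] [_ _ _ [di _]]] := core.
  have qs := sizeq_n uq qn.
  have nn : h < size q -> nth 0 q h < n by move=> hs; rewrite qn ?mem_nth.
  have vn : vol <= n * ST.
    rewrite vE; apply: leq_trans (volume_le _) _ => [u /mem_take /qn //|].
    by rewrite size_takel // leq_mul2r (leq_trans hq qs) orbT.
  split=> //; rewrite /bfs_guard; apply: eval_and => // [|hs]; first by ev.
  have [dg _] := adj _ (nn hs); have qh := qi _ hs; have dh := di _ hs.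
  have nbs := nb_ST (nn hs); have nn' := nn hs.
  have dg' : a1 aDG (off + nth 0 q h) = size (nb (nth 0 q h)) by rewrite dE.
  have vs : vol + size (nb (nth 0 q h)) < 2 ^ w.
    apply: leq_ltn_trans (@W_idx n (size (nb (nth 0 q h))) _ _); first by rewrite leq_add2r.
      by slia.
    by slia.
  have dS : a1 aD (nth 0 q h) + 1 < 2 ^ w by apply: W3; slia.
  apply: eval_and => // [|_]; first by ev.
  by rewrite -[(a1 aD _).+1]addn1; ev.
apply: (@wp_whilef _ (fun r' a' t => exists (q : seq nat) h vol,
    [/\ r' rH = h, r' rVOL = vol, queue r' a' q & t = tau + h + vol] /\
        bfs_inv q h (a' aD) (a' aUP) vol bud kk) (tau + n + n * ST)).
- exists [:: x], 0, 0; split.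
    split; rewrite ?addn0 //; split=> //; first by rewrite Eq0; case.
    by rewrite Ep0; case=> //= _; rewrite updS.
  split=> //; last 1 first.
  + by left.
  + exists 0 => //; split; split=> //.
    * by move=> u; rewrite inE => /eqP ->.
    * by rewrite Ed0 updS.
    * by rewrite Eu0 updS.
    * by move=> [|i] [|j].
    split=> [[|i] //|]; first by rewrite Ed0 updS.
    by split=> u; rewrite inE => /eqP ->; rewrite ?Ed0 ?updS // eqxx.
  + by rewrite /volume big_nil.
- move=> r' a' t [q [h [vol [[_ _ _ ->] [[L [[uq _ _ qn] _] _] hq _ -> _]]]]].
  have qs := sizeq_n uq qn; have := @volume_le (take h q).
  rewrite size_takel // => /(_ (fun u ut => qn u (mem_take ut))).
  have : h * ST <= n * ST by rewrite leq_mul2r (leq_trans hq qs) orbT.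
  by move: hq qs; slia.
- move=> r1 a1 t [q [h [vol [[r1h r1v qu ->] inv]]]] F; keep F.
  have mE : a1 aMK = a aMK by rewrite (proj2 F) //; su.
  have dE : a1 aDG = a aDG by rewrite (proj2 F) //; su.
  have aE : a1 aAD = a aAD by rewrite (proj2 F) //; su.
  have [||||||||vn nn qs ->] := G r1 a1 q h vol => //.
  case: inv => [[L core dL] hq scn vE vb]; have [rc qi qp] := qu.
  case: and3P => // -[hs vbud dkk] _.
  have qh := qi _ hs; have un := nn hs; have uq : nth 0 q h \in q by rewrite mem_nth.
  set u := nth 0 q h in qh un uq vbud dkk *; have [dg row] := adj _ un.
  rewrite -dE in dg; have nbs := nb_ST un.
  have [[uqn q0 q_gt0 qn] [_ _ _ [di _]]] := core.
  have duh : a1 aD u <= h := di _ hs.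
  have vs : vol + size (nb u) < 2 ^ w.
    by apply: leq_ltn_trans (@W_idx n (size (nb u)) _ _); [rewrite leq_add2r|slia|slia].
  have bs : (off + u) * ST < 2 ^ w by rewrite -[_ * _]addn0; apply: W_idx; slia.
  run.
  freeze r2 a2 Er2 Ea2; subst a2.
  have ut : u \in take h.+1 q by rewrite (take_nth 0) // mem_rcons mem_head.
  have core' : bfs_core q h.+1 (a1 aD) (a1 aUP) (a1 aD u).
    have [c1 [c2 c3 c4 [c5 [c6 c7]]]] := core.
    split=> //; split=> //; split=> //; split=> v vq.
      by apply: leq_trans (c6 v vq) _; rewrite ltnS dL.
    move=> vx; have [e1 e2 e3 e4] := c7 v vq vx; split=> //.
    by rewrite (take_nth 0) // mem_rcons inE e1 orbT.
  have bb : (off + u) * ST <= 2 * ST * ST by rewrite leq_mul2r; apply/orP; right; slia.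
  apply: wp_conseq (wp_frame (@bfs_scan_wp q u h ((off + u) * ST) tag r2 a1 _ _ _ _ _ bb _ _ _ _ core' ut un _)) _.
  + by rewrite Er2; su.
  + by rewrite Er2; su.
  + by rewrite Er2; su.
  + by rewrite Er2; su.
  + by rewrite aE.
  + done.
  + by move=> y; rewrite mE.
  + by apply: queue_ext qu => //; rewrite Er2; su.
  + exact: leq_ltn_trans duh hs.
  move=> r3 a3 t2 [[-> [q' [qu' cor3 scn' tq dq]]] F3]; keep F3.
  have v3 : r3 rVOL = vol + size (nb u) by rewrite (proj1 F3) // Er2; su.
  run.
  have sq : size q <= size q' by rewrite -tq size_take; case: ltnP => // /ltnW.
  have th : take h q' = take h q.
    by rewrite -tq -{1}(cat_take_drop (size q) q') tq takel_cat // ltnW.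
  have th1 : take h.+1 q' = take h.+1 q.
    by rewrite -tq -{1}(cat_take_drop (size q) q') tq takel_cat.
  have nq : nth 0 q' h = u by rewrite -(cat_take_drop (size q) q') tq nth_cat hs.
  have du3 : a3 aD u = a1 aD u by apply: dq.
  exists q', h.+1, (vol + size (nb u)); split.
    split; su; rewrite ?addn1 //; last by rewrite addnS addnA addSn.
  split; last by right.
  + exists (a1 aD u) => // hs'; rewrite -du3 -nq.
    by have [_ [_ _ so _]] := cor3; apply: so.
  + exact: leq_trans hs sq.
  + move=> v; rewrite th1 (take_nth 0) // mem_rcons inE => /predU1P[->|vt].
      by rewrite -/u; split; rewrite ?du3 //; move=> y yn ay; rewrite du3; case: (scn' y yn ay).
    have [s1 s2] := scn v vt; rewrite dq ?(mem_take vt) //; split=> // y yn ay.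
    have [yq dy] := s1 y yn ay; rewrite !dq ?(mem_take vt) //; split=> //.
    by rewrite -(cat_take_drop (size q) q') tq mem_cat yq.
  + by rewrite th1 (take_nth 0) // /volume -cats1 big_cat big_seq1 vE.
move=> r1 a1 t [q [h [vol [[r1h r1v qu ->] inv]]]] F; keep F.
have dE : a1 aDG = a aDG by rewrite (proj2 F) //; su.
have [||||||||vn nn qs ->] := G r1 a1 q h vol => //.
move=> g; exists q, h, vol; split=> //.
have hq : h <= size q by case: inv.
case: ltnP g => [hs|hs _]; last by apply: Or31; apply/eqP; rewrite eqn_leq hq.
case: leqP => [? _|_]; first by apply: Or32.
by case: leqP => // ? _; apply: Or33.
Qed.

End BFS.

Section Reach.
Variables (n : nat) (nb : nat -> seq nat) (al : pred nat) (x : nat).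
Variables (q : seq nat) (h : nat) (d p : nat -> nat) (vol bud kk : nat).
Hypothesis inv : bfs_inv n nb al x q h d p vol bud kk.

Definition arc (u y : nat) := (y \in nb u) && al y.

Lemma bfs_x : x \in q.
Proof. by case: inv => [[L [[_ q0 s0 _] _] _] _ _ _ _]; rewrite -q0 mem_nth. Qed.

(** Depths do not decrease along the queue, so a vertex shallower than the first unexpanded one has
    already been expanded. *)
Lemma bfs_closed dlim (u : nat) : (h < size q -> dlim <= d (nth 0 q h)) ->
  u \in q -> d u < dlim -> u \in take h q.
Proof.
case: inv => [[L [_ [_ _ so _]] _] hq _ _ _] H uq du.
have iq : index u q < size q by rewrite index_mem.
case: (ltnP (index u q) h) => ih.
  rewrite -(nth_index 0 uq) -(nth_take 0 ih) mem_nth // size_take.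
  by case: ifP.
have := so _ _ ih iq; rewrite nth_index // => le.
have := H (leq_ltn_trans ih iq); lia.
Qed.

(** Used also for searches stopped early: completeness holds up to the depth of the first unexpanded
    vertex. *)
Lemma bfs_reach dlim (y : nat) l : (h < size q -> dlim <= d (nth 0 q h)) ->
  walk arc x y l -> l <= dlim -> y \in q /\ d y <= l.
Proof.
move=> H [s [ps <- <-]].
elim/last_ind: s ps => [|s a IH] /=.
  by move=> _ _; rewrite bfs_x; case: inv => [[L [_ [-> _ _ _]] _] _ _ _ _].
rewrite rcons_path last_rcons size_rcons => /andP[ps /andP[anb aa]] sl.
have [lq dl] := IH ps (ltnW sl).
have lt : last x s \in take h q by apply: bfs_closed H lq _; apply: leq_ltn_trans dl sl.
case: inv => _ _ /(_ _ lt)[sc _] _ _; have [aq da] := sc a anb aa.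
by split=> //; apply: leq_trans da _; rewrite ltnS.
Qed.

Lemma bfs_walk (u : nat) : u \in q -> walk arc x u (d u).
Proof.
move: {2}(d u) (erefl (d u)) => k; elim: k u => [|k IH] u du uq;
  case: inv => [[L [_ [dx _ _ [_ [_ par]]]] _] _ _ _ _].
  have [->|ux] := eqVneq u x; first by rewrite dx; apply: walk0.
  by have [_ _ _] := par u uq ux; rewrite du.
have [ux|ux] := eqVneq u x; first by rewrite ux dx in du.
have [pq unb au dp] := par u uq ux.
rewrite dp -addn1; apply: walk_cat (IH _ _ (mem_take pq)) _; first by rewrite dp in du; case: du.
by apply: walk1; rewrite /arc unb.
Qed.

End Reach.

(** * Shortest cycles through the edges of a tree *)

(* The value 0 of a cell stands for infinity. *)
Definition minz x y := if (x == 0) || (y < x) then y else x.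
Definition le0 x y := 0 < x <= y.

Lemma le0_minzl x y b : 0 < y -> le0 x b -> le0 (minz x y) b.
Proof. by rewrite /le0 /minz; case: ifP; lia. Qed.

Lemma le0_minzr x y : 0 < y -> le0 (minz x y) y.
Proof. by rewrite /le0 /minz; case: ifP; lia. Qed.

Lemma minz_cases x y : minz x y = x \/ minz x y = y.
Proof. by rewrite /minz; case: ifP; auto. Qed.

Definition chmin t i e :=
  If (eOr (Get t i .= Const 0) (e .< Get t i)) (Store t i e) Skip.

Lemma wp_chmin w t i e iv v f Q r a tau : 0 < w ->
  eval w r a i = iv -> eval w r a e = v -> a t = f ->
  Q r (upd a t (upd f iv (minz (f iv) v))) tau -> wp w (chmin t i e) Q r a tau.
Proof.
move=> w0 ei ee <- H; rewrite /chmin.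
have gE : eval w r a (Get t i) = a t iv by rewrite /= ei.
apply: (@wp_ifb _ _ _ _ ((a t iv == 0) || (v < a t iv))).
- apply: eval_or => //; last exact: eval_lt.
  by apply: eval_eq => //; apply: eval_const; rewrite expn_gt0.
- by move=> c; apply: wp_store_at ei ee erefl _; rewrite /minz c in H.
- move=> /negPf c; apply: wp_skip; rewrite /minz c in H.
  (* Without a store the old value is the minimum; rewriting the cell by itself gives both branches
     the same final state. *)
  suff <- : upd a t (upd (a t) iv (a t iv)) = a by [].
  apply/funext => t'; rewrite /upd; case: eqP => // ->.
  by apply/funext => i'; case: eqP => // ->.
Qed.

Ltac run ::=
  lazymatch goal with
  | |- wp _ (Seq _ _) _ _ _ _ => apply wp_seq; run
  | |- wp _ Skip _ _ _ _ => apply wp_skip; cbv beta; run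
  | |- wp _ (Assign _ _) _ _ _ _ => eapply wp_assign; [ev | cbv beta; run]
  | |- wp _ (Store _ _ _) _ _ _ _ => eapply wp_store_at; [ev | ev | rd | cbv beta; run]
  | |- wp _ (incr _) _ _ _ _ => eapply wp_assign; [ev | cbv beta; run]
  | |- wp _ (chmin _ _ _) _ _ _ _ => eapply wp_chmin; [assumption | ev | ev | rd | cbv beta; run]
  | _ => idtac
  end.

Definition cell i j := i .* Reg rST .+ j.

Definition for_ x lim body := x <~ Const 0 ;; While (Reg x .< Reg lim) (body ;; incr x).

Lemma wp_for w (x lim N : nat) body (I : nat -> (nat -> nat) -> (nat -> nat -> nat) -> nat -> Prop) B
    Q r a tau :
  0 < w -> N < 2 ^ w -> r lim = N -> lim != x -> x \notin wregs body -> lim \notin wregs body ->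
  I 0 (upd r x 0) a tau ->
  (forall i r' a' t, i <= N -> I i r' a' t -> t <= B) ->
  (forall i r' a' t, i < N -> I i r' a' t -> r' x = i -> frame (body ;; incr x) r a r' a' ->
     wp w body (fun r2 a2 t2 => I i.+1 (upd r2 x i.+1) a2 t2) r' a' t.+1) ->
  (forall r' a' t, I N r' a' t -> frame (body ;; incr x) r a r' a' -> Q r' a' t) ->
  wp w (for_ x lim body) Q r a tau.
Proof.
move=> w0 NW rl lx xb lb I0 IB Ib IQ; apply: wp_seq; apply: wp_assign.
  by apply: eval_const; rewrite expn_gt0.
have fr r1 a1 : frame (body ;; incr x) (upd r x 0) a r1 a1 -> frame (body ;; incr x) r a r1 a1.
  case=> f1 f2; split=> // y yn; rewrite f1 // updN //.
  by apply: contraNneq yn => ->; rewrite /= mem_cat inE eqxx orbT.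
have lim' r1 a1 : frame (body ;; incr x) r a r1 a1 -> r1 lim = N.
  by case=> f1 _; rewrite f1 //= mem_cat inE negb_or lb lx.
apply: (@wp_whilef _ (fun r1 a1 t => exists i, [/\ i <= N, r1 x = i & I i r1 a1 t]) B).
- by exists 0; rewrite updS.
- by move=> r1 a1 t [i [iN _ Ii]]; apply: IB Ii.
- move=> r1 a1 t [i [iN ri Ii]] /fr F.
  rewrite (@eval_lt w w0 r1 a1 (Reg x) (Reg lim) i N ri (lim' _ _ F)); case: ltnP => // lt _.
  apply: wp_seq; apply: wp_conseq (wp_frame (Ib i _ _ _ lt Ii ri F)) _.
  move=> r2 a2 t2 [I2 [f1 _]]; apply: (wp_assign (v := i.+1)).
    rewrite -[i.+1]addn1; apply: eval_add; first by apply: eval_reg; rewrite f1.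
      by apply: eval_const; apply: leq_ltn_trans NW; apply: leq_ltn_trans lt.
    by rewrite addn1; apply: leq_ltn_trans NW.
  by exists i.+1; rewrite updS.
- move=> r1 a1 t [i [iN ri Ii]] /fr F.
  rewrite (@eval_lt w w0 r1 a1 (Reg x) (Reg lim) i N ri (lim' _ _ F)); case: ltnP => // le _.
  by apply: IQ => //; have -> : N = i by apply/eqP; rewrite eqn_leq le.
Qed.

(** Row 0 of [aUP] is the parent array left by the search. Only cells of queued vertices are filled
    or cleared, which keeps the cost proportional to the search. *)
Definition lift_table :=
  for_ rJJ rJ
    (for_ ri rC
       (rU <~ Get aQ (Reg ri) ;;
        If (Reg rJJ)
          (rT <~ Reg rJJ .- Const 1 ;;
           Store aUP (cell (Reg rJJ) (Reg rU))
             (Get aUP (cell (Reg rT) (Get aUP (cell (Reg rT) (Reg rU))))))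
          Skip ;;
        Store aM (cell (Reg rJJ) (Reg rU)) (Const 0))).

(** If the ancestors [2 ^ jj] steps up still differ, the blocks of [2 ^ jj] edges above both
    vertices lie on the tree path and take the value as a whole; then both vertices jump. *)
Definition climb :=
  rJJ <~ Reg rJJ .- Const 1 ;;
  rUA <~ Get aUP (cell (Reg rJJ) (Reg rA)) ;;
  rUB <~ Get aUP (cell (Reg rJJ) (Reg rB)) ;;
  If (eNot (Reg rUA .= Reg rUB))
    (chmin aM (cell (Reg rJJ) (Reg rA)) (Reg rVAL) ;;
     chmin aM (cell (Reg rJJ) (Reg rB)) (Reg rVAL) ;;
     rA <~ Reg rUA ;; rB <~ Reg rUB)
    Skip.

(** Depths across an edge differ by at most one, so one step up from a strictly deeper [rU] levels
    the ends, and [rA = rY] then reveals a tree edge. Edges seen from their shallower end are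
    skipped. Cell [rU] is the entry of row 0 for the edge above it. *)
Definition cover_edge :=
  rA <~ Reg rU ;;
  If (Get aD (Reg rY) .< Get aD (Reg rU)) (rA <~ Get aUP (Reg rU)) Skip ;;
  If (eAnd (eNot (Reg rA .= Reg rY)) (eNot (Get aD (Reg rU) .< Get aD (Reg rY))))
    (rB <~ Reg rY ;;
     rVAL <~ Get aD (Reg rU) .+ Get aD (Reg rY) .+ Const 1 ;;
     chmin aM (Reg rU) (Reg rVAL) ;;
     rJJ <~ Reg rJ ;;
     While (Reg rJJ) climb ;;
     chmin aM (Reg rA) (Reg rVAL) ;;
     chmin aM (Reg rB) (Reg rVAL))
    Skip.

Definition cover_edges :=
  for_ ri rC
    (rU <~ Get aQ (Reg ri) ;;
     rDG <~ Get aDG (Reg rU) ;;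
     for_ rj rDG
       (rY <~ Get aAD (cell (Reg rU) (Reg rj)) ;;
        If allowed cover_edge Skip)).

(** A block of [2 ^ jj] edges is the union of two blocks of the next lower row; passing values from
    the top row down leaves in row 0 the value of each single edge. *)
Definition push_down :=
  rJJ <~ Reg rJ .- Const 1 ;;
  While (Reg rJJ)
    (rT <~ Reg rJJ .- Const 1 ;;
     for_ ri rC
       (rU <~ Get aQ (Reg ri) ;;
        rVAL <~ Get aM (cell (Reg rJJ) (Reg rU)) ;;
        If (Reg rVAL)
          (chmin aM (cell (Reg rT) (Reg rU)) (Reg rVAL) ;;
           chmin aM (cell (Reg rT) (Get aUP (cell (Reg rT) (Reg rU)))) (Reg rVAL))
          Skip) ;;
     rJJ <~ Reg rJJ .- Const 1).

Definition report :=
  for_ ri rC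
    (rU <~ Get aQ (Reg ri) ;;
     rVAL <~ Get aM (Reg rU) ;;
     If (Reg rVAL)
       (chmin aEST (Reg rU) (Reg rVAL) ;;
        chmin aEST (Get aUP (Reg rU)) (Reg rVAL))
       Skip).

Section Lift.
Variables (n ST w J x : nat) (q : seq nat) (p : nat -> nat).
Hypothesis w0 : 0 < w.
Hypothesis bigW : (ST + 10) ^ 3 < 2 ^ w.
Hypothesis nST : n < ST.
Hypothesis JST : J <= ST.
Hypothesis uq : uniq q.
Hypothesis qn : forall u : nat, u \in q -> u < n.
Hypothesis pq : forall u : nat, u \in q -> p u \in q.

Definition qok (r : nat -> nat) (a : nat -> nat -> nat) :=
  [/\ r rST = ST, r rC = size q, r rJ = J & forall i, i < size q -> a aQ i = nth 0 q i].

Definition uptab K (up : nat -> nat) :=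
  forall k (u : nat), k < K -> u \in q -> up (k * ST + u) = iter (2 ^ k) p u.

Let W_idx := word_idx bigW.

Let qs : size q <= n. Proof. exact: sizeq_n. Qed.

Lemma iter_q i u : u \in q -> iter i p u \in q.
Proof. by elim: i => //= i IH /IH; apply: pq. Qed.

Lemma key_eq k k' (u u' : nat) : u \in q -> u' \in q ->
  (k * ST + u == k' * ST + u') = (k == k') && (u == u').
Proof. by move=> /qn h /qn h'; apply: ltn_idx; apply: ltn_trans nST. Qed.

Lemma lift_table_wp r a tau : qok r a -> uptab 1 (a aUP) ->
  wp w lift_table (fun r' a' t => [/\ t = tau + J * (size q).+1, uptab J (a' aUP) &
    forall k (u : nat), k < J -> u \in q -> a' aM (k * ST + u) = 0]) r a tau.
Proof.
move=> [rst rc rJ' aq] up1.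
have W3 := word_small bigW.
rewrite /lift_table.
apply: (@wp_for _ _ _ J _ (fun K r' a' t => [/\ t = tau + K * (size q).+1,
   uptab 1 (a' aUP), uptab K (a' aUP) & forall k (u : nat), k < K -> u \in q -> a' aM (k * ST + u) = 0])
  (tau + J * (size q).+1)) => //.
- by bnd.
- by split; rewrite ?addn0.
- by move=> i r' a' t iJ [-> _ _ _]; rewrite leq_add2l leq_mul2r iJ orbT.
- move=> K r1 a1 t KJ [-> u1 uK mK] rK F; keep F.
  have aq1 i : i < size q -> a1 aQ i = nth 0 q i by move=> h; rewrite (proj2 F) // aq.
  apply: (@wp_for _ _ _ (size q) _ (fun i r' a' t => [/\ t = (tau + K * (size q).+1).+1 + i,
     uptab 1 (a' aUP), uptab K (a' aUP) /\ (forall k (u : nat), k < K -> u \in q -> a' aM (k * ST + u) = 0) &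
     forall u, u \in take i q -> a' aUP (K * ST + u) = iter (2 ^ K) p u /\ a' aM (K * ST + u) = 0])
     ((tau + K * (size q).+1).+1 + size q)) => //.
  + by bnd.
  + by split; rewrite ?addn0 ?take0.
  + by move=> i r' a' t2 iJ [-> _ _ _]; rewrite leq_add2l.
  + move=> i r2 a2 t2 iq [-> v1 [vK nK] vi] ri' F2; keep F2.
    have aq2 : a2 aQ i = nth 0 q i by rewrite (proj2 F2) // aq1.
    have WI := W_idx.
    have uq' : nth 0 q i \in q by rewrite mem_nth.
    set u := nth 0 q i in aq2 uq'; have un := qn uq'.
    have tk : take i.+1 q = rcons (take i q) u by rewrite (take_nth 0).
    have ut : u \notin take i q.
      by have := take_uniq i.+1 uq; rewrite tk rcons_uniq => /andP[].
    have tq (v : nat) : v \in take i q -> v \in q := @mem_take _ _ _ v.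
    have keyE k (v : nat) : v \in q -> (k * ST + v == K * ST + u) = (k == K) && (v == u).
      by move=> vq; apply: key_eq.
    run; apply: (@wp_if _ _ _ _ K); first by ev.
    * move=> K0; have up2 v : v \in q -> a2 aUP ((K - 1) * ST + v) = iter (2 ^ (K - 1)) p v.
        by apply: vK; move: K0 KJ; slia.
      have vq := iter_q (2 ^ (K - 1)) uq'; have vn := qn vq.
      have e2 := up2 _ uq'; have := up2 _ vq; rewrite -iterD addnn -mul2n -expnS => e3.
      have K1 : (K - 1).+1 = K by move: K0; slia.
      rewrite K1 in e3.
      set z := iter _ p u in vq vn e2 e3.
      have key1 k (v : nat) : k < K -> v \in q -> (k * ST + v == K * ST + u) = false.
        by move=> kK vq'; rewrite keyE // ltn_eqF.
      run; su; split.
      - by rewrite addnS.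
      - move=> k v k1 vq'; rewrite /upd key1 ?(v1 k v) //; move: K0 k1; slia.
      - by split=> k v kK vq'; rewrite /upd key1 // ?vK ?nK.
      - move=> v; rewrite tk mem_rcons inE => /predU1P[->|vt].
          by rewrite !updS.
        by rewrite /upd keyE ?tq // eqxx; case: eqP => [vu|_]; [rewrite -vu vt in ut|apply: vi].
    * move=> K0; run; su; split; rewrite ?addnS //.
      - by split=> //; rewrite K0.
      - move=> v; rewrite tk mem_rcons inE => /predU1P[->|vt].
          by rewrite updS K0 (v1 0 u).
        by rewrite /upd keyE ?tq // eqxx; case: eqP => [vu|_]; [rewrite -vu vt in ut|apply: vi].
  + move=> r2 a2 t2 [-> v1 [vK nK]]; rewrite take_size => vi _; split=> //.
    * by rewrite mulSn; slia.
    * by move=> k u; rewrite ltnS leq_eqVlt => /predU1P[->|/vK]; [case/vi|apply].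
    * by move=> k u; rewrite ltnS leq_eqVlt => /predU1P[->|/nK]; [case/vi|apply].
- by move=> r1 a1 t [].
Qed.
End Lift.

Section Cover.
Variables (n ST w J x : nat) (q : seq nat) (d p : nat -> nat) (nb : nat -> seq nat) (al : pred nat).
Let E (u y : nat) := y \in nb u.
Hypothesis w0 : 0 < w.
Hypothesis bigW : (ST + 10) ^ 3 < 2 ^ w.
Hypothesis nST : n < ST.
Hypothesis JST : J <= ST.
Hypothesis J0 : 0 < J.
Hypothesis nJ : n <= 2 ^ J.
Hypothesis uq : uniq q.
Hypothesis qn : forall u : nat, u \in q -> u < n.
Hypothesis Esym : symmetric E.
Hypothesis Eirr : irreflexive E.
Hypothesis nb_ST : forall u, u < n -> size (nb u) < ST.
Hypothesis xq : x \in q.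
Hypothesis alx : al x.
Hypothesis dx : d x = 0.
Hypothesis px : p x = x.
Hypothesis parent : forall u : nat, u \in q -> u != x ->
  [/\ p u \in q, E (p u) u, al u & d u = (d (p u)).+1].
Hypothesis closed : forall u y : nat, u \in q -> E u y -> al y -> y \in q /\ d y <= (d u).+1.
Hypothesis dn : forall u : nat, u \in q -> d u <= n.

Let W_idx := word_idx bigW.
Let W_small := word_small bigW.
Let pq (u : nat) : u \in q -> p u \in q.
Proof. by move=> ?; apply: p_q parent _ _. Qed.
Let ipq i (u : nat) : u \in q -> iter i p u \in q.
Proof. by move=> ?; apply: iterp_q parent _ _ _. Qed.

Definition bypass z v := exists2 l, l <= v & cyclen E z (p z) l.

Definition msound (M : nat -> nat) := forall k (u : nat) i, k < J -> u \in q -> i < 2 ^ k ->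
  M (k * ST + u) != 0 -> bypass (iter i p u) (M (k * ST + u)).

(* Entry (k, u) of the table M stands for the 2^k tree edges above u. *)
Definition mcov (M : nat -> nat) z v := exists k u i,
  [/\ k < J, u \in q, i < 2 ^ k, z = iter i p u & le0 (M (k * ST + u)) v].

Let keyE k k' (u u' : nat) : u \in q -> u' \in q ->
  (k * ST + u == k' * ST + u') = (k == k') && (u == u').
Proof. exact: (key_eq nST qn). Qed.

Lemma mchmin M k (a : nat) v : msound M -> k < J -> a \in q -> 0 < v ->
  (forall i, i < 2 ^ k -> bypass (iter i p a) v) ->
  let M' := upd M (k * ST + a) (minz (M (k * ST + a)) v) in
  [/\ msound M', forall z v', mcov M z v' -> mcov M' z v' &
      forall i, i < 2 ^ k -> mcov M' (iter i p a) v].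
Proof.
move=> sM kJ aq v0 bp M'; split.
- move=> k' u i k'J uq' ik; rewrite /M' /upd keyE //; case: andP => [[/eqP ek /eqP eu]|_].
    by rewrite ek eu in ik *; case: (minz_cases (M (k * ST + a)) v) => -> //; [apply: sM|move=> _; apply: bp].
  exact: sM.
- move=> z v' [k' [u [i [k'J uq' ik ez le]]]]; exists k', u, i; split=> //.
  rewrite /M' /upd keyE //; case: andP => [[/eqP ek /eqP eu]|_] //.
  by rewrite ek eu in le; apply: le0_minzl.
- by move=> i ik; exists k, a, i; split=> //; rewrite /M' updS; apply: le0_minzr.
Qed.

Definition anc z u := exists i, z = iter i p u.
(** Here [z] stands for the edge to its parent; that edge lies on the tree path when [z] is an
    ancestor of exactly one end. *)
Definition onpath z a b := (anc z a /\ ~ anc z b) \/ (anc z b /\ ~ anc z a).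
Definition settled M a b := forall z, onpath z a b -> mcov M z (d a + d b + 1).

Let D_iter := d_iterp dx px parent.

Lemma climb_wp M0 (u y : nat) (val ia ib : nat) r a tau :
  r rST = ST -> r rJ = J -> r rJJ = J -> r rVAL = val -> u \in q -> y \in q -> E u y ->
  p u != y -> p y != u -> val = d u + d y + 1 ->
  r rA = iter ia p u -> r rB = iter ib p y -> d (iter ia p u) = d (iter ib p y) ->
  iter ia p u <> iter ib p y -> uptab ST q p J (a aUP) -> msound (a aM) ->
  (forall z v, mcov M0 z v -> mcov (a aM) z v) ->
  (forall i, i < ia -> mcov (a aM) (iter i p u) val) ->
  (forall i, i < ib -> mcov (a aM) (iter i p y) val) ->
  wp w (While (Reg rJJ) climb ;;
        chmin aM (Reg rA) (Reg rVAL) ;; chmin aM (Reg rB) (Reg rVAL))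
   (fun r' a' t => [/\ t = tau + J, msound (a' aM),
      forall z v, mcov M0 z v -> mcov (a' aM) z v & settled (a' aM) u y]) r a tau.
Proof.
move=> rst rj rjj rval uq' yq h n1 n2 valE ra rb dab ab up sM mM ca cb.
have W3 := W_small; have WI := W_idx.
have v0 : 0 < val by rewrite valE addn1.
have S1 ia' ib' i : d (iter ia' p u) = d (iter ib' p y) ->
    iter i p (iter ia' p u) <> iter i p (iter ib' p y) -> bypass (iter i p (iter ia' p u)) val.
  move=> e1 e2; rewrite valE.
  by apply: (cover_sound Esym dx px parent uq' yq h _ erefl erefl e1 e2); rewrite eq_sym.
have S2 ia' ib' i : d (iter ia' p u) = d (iter ib' p y) ->
    iter i p (iter ia' p u) <> iter i p (iter ib' p y) -> bypass (iter i p (iter ib' p y)) val.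
  move=> e1 e2; rewrite valE [d u + d y]addnC.
  apply: (cover_sound Esym dx px parent yq uq' _ _ erefl erefl (esym e1) (nesym e2)).
    by rewrite Esym.
  by rewrite eq_sym.
have val_W : val < 2 ^ w by apply: W_small; have := dn uq'; have := dn yq; rewrite valE; slia.
apply: wp_seq.
(* The two registers hold distinct ancestors of equal depth that meet within [2 ^ jj] steps; the
   edges passed so far are covered. At the start the jump of [2 ^ J >= n] steps takes both to the
   root. *)
apply: (@wp_whilef _ (fun r' a' t => exists jj ia ib,
   [/\ r' rJJ = jj, t + jj = tau + J, jj <= J & r' rA = iter ia p u /\ r' rB = iter ib p y] /\
   [/\ d (iter ia p u) = d (iter ib p y), iter ia p u <> iter ib p y,
       iter (2 ^ jj) p (iter ia p u) = iter (2 ^ jj) p (iter ib p y) & msound (a' aM)] /\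
   [/\ forall z v, mcov M0 z v -> mcov (a' aM) z v,
       forall i, i < ia -> mcov (a' aM) (iter i p u) val &
       forall i, i < ib -> mcov (a' aM) (iter i p y) val]) (tau + J)).
- exists J, ia, ib; do 2!split=> //.
  have rt (v : nat) : v \in q -> iter (2 ^ J) p v = x.
    by move=> vq; apply: (iterp_root dx px parent) vq (leq_trans (dn vq) nJ).
  by split=> //; rewrite !rt ?ipq.
- by move=> r' a' t [jj [_ [_ [[_ <- _ _] _]]]]; apply: leq_addr.
- move=> r1 a1 t [jj [ka [kb [[rjj1 tE jjJ [ra1 rb1]] [[dab1 ab1 it1 sM1] [mM1 ca1 cb1]]]]]] F; keep F.
  rewrite (@eval_reg _ _ _ _ jj) // => jj0.
  have up1 : a1 aUP = a aUP by rewrite (proj2 F).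
  set A := iter ka p u in ra1 dab1 ab1 it1; set B := iter kb p y in rb1 dab1 ab1 it1.
  have Aq : A \in q := ipq ka uq'; have Bq : B \in q := ipq kb yq.
  have An := qn Aq; have Bn := qn Bq.
  have j1 : jj - 1 < J by move: jj0 jjJ; slia.
  have eA := up _ _ j1 Aq; have eB := up _ _ j1 Bq; rewrite -up1 in eA eB.
  have pw : 2 ^ jj = 2 ^ (jj - 1) + 2 ^ (jj - 1).
    by rewrite addnn -mul2n -expnS; congr (2 ^ _); move: jj0; slia.
  rewrite /climb; run.
  apply: (@wp_ifb _ _ _ _ (iter (2 ^ (jj - 1)) p A != iter (2 ^ (jj - 1)) p B)); first by ev.
  + move=> /eqP nK.
    (* Climbs that have met stay together. Being apart after [2 ^ (jj - 1)] steps, they are apart at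
       every earlier step, as soundness of the whole block requires. *)
    have mono i : iter i p A = iter i p B -> i < 2 ^ (jj - 1) -> False.
      by move=> e li; apply: nK; rewrite -(subnK (ltnW li)) !iterD e.
    have [T1 T2 T3] := mchmin sM1 j1 Aq v0 (fun i li => S1 ka kb i dab1 (fun e => mono i e li)).
    have [T1' T2' T3'] := mchmin T1 j1 Bq v0 (fun i li => S2 ka kb i dab1 (fun e => mono i e li)).
    run.
    exists (jj - 1), (2 ^ (jj - 1) + ka), (2 ^ (jj - 1) + kb); su.
    rewrite !iterD -/A -/B; split; [split=> //|split; split=> //].
    * by move: tE jj0; slia.
    * by move: jjJ; slia.
    * by rewrite (D_iter _ Aq) (D_iter _ Bq) dab1.
    * by rewrite pw !iterD in it1.
    * by move=> z v /mM1 /T2 /T2'.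
    * move=> i; have [lt _|le li] := ltnP i ka; first by apply/T2'/T2/ca1.
      by rewrite -(subnK le) iterD; apply/T2'/T3; move: le li; slia.
    * move=> i; have [lt _|le li] := ltnP i kb; first by apply/T2'/T2/cb1.
      by rewrite -(subnK le) iterD; apply/T3'; move: le li; slia.
  + rewrite negbK => /eqP eK; run.
    exists (jj - 1), ka, kb; su; split; [split=> //|split; split=> //].
    * by move: tE jj0; slia.
    * by move: jjJ; slia.
move=> r1 a1 t [jj [ka [kb [[rjj1 tE jjJ [ra1 rb1]] [[dab1 ab1 it1 sM1] [mM1 ca1 cb1]]]]]] F; keep F.
rewrite (@eval_reg _ _ _ _ jj) // => jj0; rewrite {}jj0 in tE it1 *.
(* With [jj = 0] the parents of [A] and [B] coincide: the edges above them are the last on the path,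
   and the two final updates cover them. *)
set A := iter ka p u in ra1 dab1 ab1 it1; set B := iter kb p y in rb1 dab1 ab1 it1.
have Aq : A \in q := ipq ka uq'; have Bq : B \in q := ipq kb yq.
have bA i : i < 2 ^ 0 -> bypass (iter i p A) val.
  by case: i => // _; apply: (S1 ka kb 0).
have bB i : i < 2 ^ 0 -> bypass (iter i p B) val.
  by case: i => // _; apply: (S2 ka kb 0).
have [T1 T2 T3] := mchmin sM1 J0 Aq v0 bA.
have [T1' T2' T3'] := mchmin T1 J0 Bq v0 bB.
run; su; split=> //.
- by move: tE; slia.
- by move=> z v /mM1 /T2 /T2'.
move=> z; rewrite -valE => -[] [[i zi] nz].
- have [lt|] := ltnP i ka; first by rewrite zi; apply/T2'/T2/ca1.
  rewrite leq_eqVlt => /predU1P[ik|lt]; first by rewrite zi -ik; apply/T2'; apply: (T3 0).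
  case: nz; exists (i - ka.+1 + kb.+1); rewrite zi -{1}(subnK lt) !iterD.
  by congr iter.
- have [lt|] := ltnP i kb; first by rewrite zi; apply/T2'/T2/cb1.
  rewrite leq_eqVlt => /predU1P[ik|lt]; first by rewrite zi -ik; apply: (T3' 0).
  case: nz; exists (i - kb.+1 + ka.+1); rewrite zi -{1}(subnK lt) !iterD.
  by congr iter.
Qed.

Lemma cover_edge_wp (u y : nat) r a tau :
  r rST = ST -> r rJ = J -> r rU = u -> r rY = y -> u \in q -> y \in q -> E u y ->
  a aD = d -> uptab ST q p J (a aUP) -> msound (a aM) ->
  wp w cover_edge (fun r' a' t => [/\ t <= tau + J, msound (a' aM),
      forall z v, mcov (a aM) z v -> mcov (a' aM) z v &
      d y <= d u -> p u != y -> settled (a' aM) u y]) r a tau.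
Proof.
move=> rst rj ru ry uq' yq h dE up sM.
have W3 := W_small; have WI := W_idx.
have un := qn uq'; have yn := qn yq; have du := dn uq'; have dy := dn yq.
have upu : a aUP u = p u by apply: (up 0).
have adu : a aD u = d u by rewrite dE.
have ady : a aD y = d y by rewrite dE.
pose A := if d y < d u then p u else u.
rewrite /cover_edge; run.
(* The levelling conditional amounts to setting [rA] to [A], so the remaining code needs to be
   executed only once. *)
suff M : wp w (If (eAnd (eNot (Reg rA .= Reg rY)) (eNot (Get aD (Reg rU) .< Get aD (Reg rY))))
    (rB <~ Reg rY ;;
     rVAL <~ Get aD (Reg rU) .+ Get aD (Reg rY) .+ Const 1 ;;
     chmin aM (Reg rU) (Reg rVAL) ;;
     rJJ <~ Reg rJ ;;
     While (Reg rJJ) climb ;;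
     chmin aM (Reg rA) (Reg rVAL) ;;
     chmin aM (Reg rB) (Reg rVAL))
    Skip) (fun r' a' t => [/\ t <= tau + J, msound (a' aM),
      forall z v, mcov (a aM) z v -> mcov (a' aM) z v &
      d y <= d u -> p u != y -> settled (a' aM) u y]) (upd (upd r rA u) rA A) a tau.
  apply: (@wp_ifb _ _ _ _ (d y < d u)); first by ev.
    move=> lt; have EA : A = p u by rewrite /A lt.
    by rewrite EA in M; run.
  move=> /negPf lt; run; have Er : upd (upd r rA u) rA A = upd r rA u.
    by apply/funext => i; rewrite /A lt /upd; case: eqP.
  by rewrite Er in M.
apply: (@wp_ifb _ _ _ _ ((A != y) && ~~ (d u < d y))).
- by apply: eval_and => // [|_]; [ev | ev].
- move=> /andP[Ay]; rewrite -leqNgt => dyu.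
  have uy : u != y by apply/eqP => e; move: h; rewrite e Eirr.
  have n1 : p u != y.
    apply/eqP => e; have ux : u != x by apply/eqP => ux; rewrite -e ux px eqxx in uy.
    have [_ _ _ du'] := parent uq' ux; move: Ay.
    by rewrite /A du' e ltnS leqnn eqxx.
  have n2 : p y != u.
    apply/eqP => e; have yx : y != x by apply/eqP => yx; rewrite -e yx px eqxx in uy.
    by have [_ _ _ dy'] := parent yq yx; move: dyu; rewrite dy' e ltnn.
  pose val := d u + d y + 1.
  have v0 : 0 < val by rewrite /val addn1.
  have nanc j : iter j p y <> u.
    move=> e; have dj := D_iter j yq; rewrite e in dj.
    have [j0|j0] := posnP j; first by move: uy; rewrite -e j0 eqxx.
    have d0 : d u = 0 by move: dj dyu j0; slia.
    by move: uy; rewrite (d_eq0 parent uq' d0) (d_eq0 parent yq) ?eqxx //; move: dyu d0; slia.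
  have b0 i : i < 2 ^ 0 -> bypass (iter i p u) val.
    case: i => // _; apply: (tree_detour Esym dx px parent uq' yq h _ (erefl : u = iter 0 p u)) => //.
    by rewrite eq_sym.
  have [T1 T2 T3] := mchmin sM J0 uq' v0 b0.
  have val_W : d u + d y + 1 < 2 ^ w by apply: W_small; slia.
  have s_W : d u + d y < 2 ^ w by apply: W_small; slia.
  run.
  freeze r1 a1 Er Ea.
  have aM1 : a1 aM = upd (a aM) u (minz (a aM u) val) by rewrite Ea; su.
  have aU1 : a1 aUP = a aUP by rewrite Ea; su.
  apply: wp_seqI; apply: wp_conseq (@climb_wp (a aM) u y val (d y < d u) 0 r1 a1 tau _ _ _ _ uq' yq h n1 n2 erefl _ _ _ _ _ _ _ _ _) _ => //.
  + by rewrite Er; su.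
  + by rewrite Er; su.
  + by rewrite Er; su; rewrite /A; case: ifP.
  + by rewrite Er; su.
  + rewrite /=; case: ltnP => [lt|le] /=; last by apply/eqP; rewrite eqn_leq dyu le.
    have := D_iter 1 uq'; rewrite /= => ->; have [_ h2] := adj_depth Esym alx parent closed uq' yq h.
    by move: h2 lt; slia.
  + by rewrite -[iter 0 p y]/y; move: Ay; rewrite /A; case: ifP => _ /eqP.
  + by rewrite aU1.
  + by rewrite aM1.
  + by move=> z v cv; rewrite aM1; apply: T2.
  + by move=> i; case: (d y < d u) => //; case: i => // _; rewrite aM1; apply: (T3 0).
  by move=> r2 a2 t [-> ? ? ?]; split.
- rewrite negb_and !negbK => H; run; split => //; first exact: leq_addr.
  move=> dyu n1; case/orP: H; last by rewrite ltnNge dyu.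
  rewrite /A; case: ifP => [_ /eqP e|_ /eqP e]; first by rewrite e eqxx in n1.
  by move: h; rewrite e Eirr.
Qed.

Lemma settled_mono M M' a b : (forall z v, mcov M z v -> mcov M' z v) ->
  settled M a b -> settled M' a b.
Proof. by move=> H s z /s /H. Qed.

Lemma cover_edges_wp tag r a tau :
  qok ST J q r a -> r rTAG = tag -> adjrep n ST nb (a aDG) (a aAD) 0 ->
  (forall y, al y = ~~ (a aMK y < tag)) ->
  a aD = d -> uptab ST q p J (a aUP) -> (forall k (u : nat), k < J -> u \in q -> a aM (k * ST + u) = 0) ->
  wp w cover_edges (fun r' a' t => [/\ t <= tau + size q + volume nb q * J.+1, msound (a' aM) &
      forall u y : nat, u \in q -> E u y -> al y -> d y <= d u -> p u != y ->
        settled (a' aM) u y]) r a tau.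
Proof.
move=> [rst rc rJ' aq] rtag adj alE dE up m0.
have W3 := W_small; have WI := W_idx; have qs := sizeq_n uq qn.
have sM0 : msound (a aM) by move=> k u i kJ uq' _; rewrite m0.
pose ok M (S : seq nat) := forall u y : nat, u \in S -> E u y -> al y -> d y <= d u -> p u != y -> settled M u y.
rewrite /cover_edges; apply: (@wp_for _ _ _ (size q) _ (fun i r' a' t => [/\ t <= tau + i + volume nb (take i q) * J.+1,
  msound (a' aM) & ok (a' aM) (take i q)]) (tau + size q + volume nb q * J.+1)) => //.
- by bnd.
- by split=> //; rewrite take0 // /volume big_nil mul0n !addn0.
- move=> i r' a' t iq [le _ _]; apply: leq_trans le _.
  apply: leq_add; first by rewrite leq_add2l.
  by rewrite leq_mul2r; apply/orP; right; rewrite -[in leqRHS](cat_take_drop i q) /volume big_cat leq_addr.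
- move=> i r1 a1 t iq [le sM1 ok1] ri' F; keep F.
  have aq1 : a1 aQ i = nth 0 q i by rewrite (proj2 F) // aq.
  have uq' : nth 0 q i \in q by rewrite mem_nth.
  set u := nth 0 q i in aq1 uq'; have un := qn uq'; have [dg row] := adj u un; rewrite add0n in dg row.
  have dg1 : a1 aDG u = size (nb u) by rewrite (proj2 F).
  have nbs := nb_ST un.
  have tk : take i.+1 q = rcons (take i q) u by rewrite (take_nth 0).
  have F2 := proj2 F; have [[D1 U1] [A1 K1]] : (a1 aD = a aD /\ a1 aUP = a aUP) /\ (a1 aAD = a aAD /\ a1 aMK = a aMK).
    by rewrite !F2.
  run; freeze r2 a2 Er Ea; subst a2.
  have r2u : r2 rU = u by rewrite Er; su.
  have r2d : r2 rDG = size (nb u) by rewrite Er; su.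
  apply: (@wp_for _ _ _ (size (nb u)) _ (fun j r' a' t' => [/\ t' <= t.+1 + j * J.+1,
     msound (a' aM), ok (a' aM) (take i q) &
     forall y : nat, y \in take j (nb u) -> al y -> d y <= d u -> p u != y -> settled (a' aM) u y])
     (t.+1 + size (nb u) * J.+1)) => //.
  + by apply: W_small; move: nbs; slia.
  + by split=> //; rewrite ?take0 ?addn0.
  + move=> j r' a' t' js [le' _ _ _]; apply: leq_trans le' _.
    by rewrite leq_add2l leq_mul2r js orbT.
  + move=> j r3 a3 t3 js [le3 sM3 ok3 st3] rj' F3; keep F3.
    have [[D3 U3] [A3 K3]] : (a3 aD = a1 aD /\ a3 aUP = a1 aUP) /\ (a3 aAD = a1 aAD /\ a3 aMK = a1 aMK).
      by rewrite !(proj2 F3).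
    have yE : a3 aAD (u * ST + j) = nth 0 (nb u) j by rewrite A3 A1 row.
    have yn : nth 0 (nb u) j \in nb u by rewrite mem_nth.
    set y := nth 0 (nb u) j in yE yn.
    have tkj : take j.+1 (nb u) = rcons (take j (nb u)) y by rewrite (take_nth 0).
    run.
    apply: (@wp_ifb _ _ _ _ (al y)); first by rewrite alE -K1 -K3; ev.
    * move=> ay; have [yq _] := closed uq' yn ay.
      apply: wp_conseq (@cover_edge_wp u y _ _ _ _ _ _ _ uq' yq yn _ _ sM3) _; su => //.
      - by rewrite D3 D1.
      - by rewrite U3 U1.
      move=> r4 a4 t4 [le4 sM4 mo4 st4]; split=> //.
      - by move: le4 le3; rewrite mulSn; slia.
      - move=> v z vt ez az dz nz; apply: settled_mono mo4 _; exact: ok3.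
      - move=> z; rewrite tkj mem_rcons inE => /predU1P[->|zt] az dz nz; first exact: st4.
        by apply: settled_mono mo4 _; apply: st3.
    * move=> nay; run; split=> //.
      - by move: le3; rewrite mulSn; slia.
      - move=> z; rewrite tkj mem_rcons inE => /predU1P[->|zt] az dz nz; last exact: st3.
        by rewrite az in nay.
  + move=> r3 a3 t3 [le3 sM3 ok3]; rewrite take_size => st3 _; split=> //.
    * rewrite tk /volume -cats1 big_cat big_seq1 -/(volume nb (take i q)) mulnDl.
      by move: le3 le; slia.
    * by move=> v y; rewrite tk mem_rcons inE => /predU1P[->|vt] ez; [apply: st3|apply: ok3].
- by move=> r1 a1 t [le sM1]; rewrite take_size in le * => ok1 _; split.
Qed.

Lemma le0_upd M k0 k v0 v : 0 < v0 -> le0 (M k) v -> le0 (upd M k0 (minz (M k0) v0) k) v.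
Proof. by move=> v00 h; rewrite /upd; case: eqP => [e|//]; rewrite e in h; apply: le0_minzl. Qed.

Lemma le0_trans a b v : le0 a b -> le0 b v -> le0 a v.
Proof. by rewrite /le0 => /andP[-> h] /andP[_ /(leq_trans h)]. Qed.

(** Progress of [push_down]: no entry above row [L] is needed any more, and in row [L] only those of
    the vertices in [S]. *)
Definition pcov L (S : seq nat) M z v := exists k u i,
  [/\ k < L \/ k = L /\ u \in S, u \in q, i < 2 ^ k, z = iter i p u & le0 (M (k * ST + u)) v].

Lemma push_down_wp r a tau : qok ST J q r a -> uptab ST q p J (a aUP) -> msound (a aM) ->
  wp w push_down (fun r' a' t => [/\ t <= tau + J * (size q).+1, msound (a' aM) &
    forall z v, mcov (a aM) z v -> z \in q /\ le0 (a' aM z) v]) r a tau.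
Proof.
move=> [rst rc rJ' aq] up sM.
have W3 := W_small; have WI := W_idx; have qs := sizeq_n uq qn.
rewrite /push_down; run.
freeze r0 a0 Er Ea; subst a0.
have r0J : r0 rJJ = J - 1 by rewrite Er; su.
apply: (@wp_whilef _ (fun r' a' t => exists jj, [/\ r' rJJ = jj, jj < J,
  t + jj * (size q).+1 <= tau + (J - 1) * (size q).+1, msound (a' aM) &
  forall z v, mcov (a aM) z v -> pcov jj q (a' aM) z v]) (tau + (J - 1) * (size q).+1)).
- exists (J - 1); split=> //; first by move: J0; slia.
  move=> z v [k [u [i [kJ uq' ik ez le]]]]; exists k, u, i; split=> //.
  by move: kJ J0; have [] := ltngtP k (J - 1); move=> *; [left|exfalso; slia|right].
- by move=> r' a' t [jj [_ _ le _ _]]; apply: leq_trans le; apply: leq_addr.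
- move=> r1 a1 t [jj [rjj jjJ le sM1 cv]] F; keep F; rewrite (@eval_reg _ _ _ _ jj) // => jj0.
  have a1Q : a1 aQ = a aQ by rewrite (proj2 F).
  have a1U : a1 aUP = a aUP by rewrite (proj2 F).
  have pw : 2 ^ jj = 2 ^ (jj - 1) + 2 ^ (jj - 1).
    by rewrite addnn -mul2n -expnS; congr (2 ^ _); move: jj0; slia.
  run; freeze r2 a2 Er2 Ea2; subst a2.
  have r2T : r2 rT = jj - 1 by rewrite Er2; su.
  have r2J : r2 rJJ = jj by rewrite Er2; su.
  apply: (@wp_for _ _ _ (size q) _ (fun i r' a' t' => [/\ t' = t.+1 + i, msound (a' aM) &
    forall z v, mcov (a aM) z v -> pcov jj (drop i q) (a' aM) z v]) (t.+1 + size q)) => //.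
  + by bnd.
  + by rewrite addn0 drop0.
  + by move=> i r' a' t' iq [-> _ _]; rewrite leq_add2l.
  + move=> i r3 a3 t3 iq [-> sM3 cv3] ri' F3; keep F3.
    have aq3 : a3 aQ i = nth 0 q i by rewrite (proj2 F3) // a1Q aq.
    have uq' : nth 0 q i \in q by rewrite mem_nth.
    set u := nth 0 q i in aq3 uq'; have un := qn uq'.
    have dr : drop i q = u :: drop i.+1 q by rewrite (drop_nth 0).
    have j1 : jj - 1 < J by move: jjJ; slia.
    have := up (jj - 1) u j1 uq'; rewrite -a1U -[a1 aUP](proj2 F3) // => eU.
    have zq : iter (2 ^ (jj - 1)) p u \in q by apply: ipq.
    set z1 := iter _ p u in eU zq; have zn := qn zq.
    run; apply: (@wp_if _ _ _ _ (a3 aM (jj * ST + u))); first by rd; ev.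
    * move=> v0; rewrite -lt0n in v0.
      have bp i' : i' < 2 ^ jj -> bypass (iter i' p u) (a3 aM (jj * ST + u)).
        by move=> li; apply: sM3; rewrite // -lt0n.
      have b1 i' : i' < 2 ^ (jj - 1) -> bypass (iter i' p u) (a3 aM (jj * ST + u)).
        by move=> li; apply: bp; rewrite pw ltn_addr.
      have [T1 T2 T3] := mchmin sM3 j1 uq' v0 b1.
      have b2 i' : i' < 2 ^ (jj - 1) -> bypass (iter i' p z1) (a3 aM (jj * ST + u)).
        by move=> li; rewrite -iterD; apply: bp; rewrite pw ltn_add2r.
      have [T1' T2' T3'] := mchmin T1 j1 zq v0 b2.
      run; su; split=> //; first by rewrite addnS.
      move=> z v /cv3 [k [u' [i' [hk uq2 ik ez le']]]].
      have [[eu ek]|keep_] := pselect (u' = u /\ k = jj); last first.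
        exists k, u', i'; split=> //; last by do 2!apply: le0_upd => //.
        case: hk => [|[ek]]; first by left.
        rewrite dr inE => /predU1P[eu|uin]; last by right.
        by case: keep_.
      subst u' k; rewrite ez in ik *.
      (* The nearer half of the block passes to [(jj - 1, u)], the farther half to
         [(jj - 1, z1)]. *)
      have [lt|ge] := ltnP i' (2 ^ (jj - 1)).
        exists (jj - 1), u, i'; split=> //; first by left; move: jj0; slia.
        apply: le0_upd => //; rewrite updS; apply: le0_trans le'.
        exact: le0_minzr.
      exists (jj - 1), z1, (i' - 2 ^ (jj - 1)); split=> //; first by left; move: jj0; slia.
      - by move: ik ge; rewrite pw; move: (2 ^ (jj - 1)) => K; slia.
      - by rewrite -iterD subnK.
      - by rewrite updS; apply: le0_trans le'; apply: le0_minzr.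
    * move=> v0; run; split=> //; first by rewrite addnS.
      move=> z v /cv3 [k [u' [i' [hk uq2 ik ez le']]]].
      exists k, u', i'; split=> //; case: hk => [|[ek]]; first by left.
      rewrite dr inE => /predU1P[eu|uin]; last by right.
      by rewrite ek eu v0 in le'.
  + move=> r3 a3 t3 [-> sM3]; rewrite drop_size => cv3 F3; keep F3.
    run; exists (jj - 1); su; split=> //.
    * by move: jjJ; slia.
    * have e : jj * (size q).+1 = (size q).+1 + (jj - 1) * (size q).+1.
        by rewrite -mulSn; congr (_ * _); move: jj0; slia.
      by move: le; rewrite e; slia.
    * move=> z v /cv3 [k [u' [i' [hk uq2 ik ez le']]]]; exists k, u', i'; split=> //.
      case: hk => [kj|[_]]; last by rewrite in_nil.
      have [] := ltngtP k (jj - 1) => kj'; [by left|exfalso; move: kj' kj; slia|by right].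
- move=> r1 a1 t [jj [rjj jjJ le sM1 cv]] F; rewrite (@eval_reg _ _ _ _ jj) // => jj0.
  rewrite {}jj0 in le cv rjj; split=> //.
    by move: le J0; rewrite mul0n addn0; case: (J) => // j; rewrite subSS subn0 mulSn; slia.
  move=> z v /cv [k [u [i [hk uq' ik ez le']]]].
  have k0 : k = 0 by case: hk => [|[]].
  by subst k; case: i ik ez => // _ ->.
Qed.

Definition hascyc v l := cyclen E v v l.

Definition esound (est : nat -> nat) := forall v, est v != 0 ->
  exists2 l, l <= est v & hascyc v l.

Lemma bypass_cyc z v : bypass z v ->
  (exists2 l, l <= v & hascyc z l) /\ (exists2 l, l <= v & hascyc (p z) l).
Proof.
move=> [l lv [l2 [c [sc cc zc pc]]]].
by split; exists l => //; split=> //; exists c.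
Qed.

Lemma esound_upd est v k : esound est -> 0 < v -> (exists2 l, l <= v & hascyc k l) ->
  esound (upd est k (minz (est k) v)).
Proof.
move=> es v0 h u; rewrite /upd; case: (u =P k) => [->|_]; last exact: es.
by case: (minz_cases (est k) v) => ->; [exact: es | move=> _].
Qed.

Lemma report_wp r a tau : qok ST J q r a -> (forall u : nat, u \in q -> a aUP u = p u) ->
  msound (a aM) -> esound (a aEST) ->
  wp w report (fun r' a' t => [/\ t = tau + size q, esound (a' aEST),
    forall z v, le0 (a aEST z) v -> le0 (a' aEST z) v &
    forall (z : nat) v, z \in q -> le0 (a aM z) v ->
       le0 (a' aEST z) v /\ le0 (a' aEST (p z)) v]) r a tau.
Proof.
move=> [rst rc rJ' aq] up sM es.
have W3 := W_small; have WI := W_idx; have qs := sizeq_n uq qn.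
rewrite /report; apply: (@wp_for _ _ _ (size q) _ (fun i r' a' t => [/\ t = tau + i, esound (a' aEST),
    forall z v, le0 (a aEST z) v -> le0 (a' aEST z) v &
    forall (z : nat) v, z \in take i q -> le0 (a aM z) v ->
       le0 (a' aEST z) v /\ le0 (a' aEST (p z)) v]) (tau + size q)) => //.
- by bnd.
- by rewrite addn0 take0.
- by move=> i r' a' t' iq [-> _ _]; rewrite leq_add2l.
- move=> i r3 a3 t3 iq [-> es3 mo3 cv3] ri' F3; keep F3.
  have aq3 : a3 aQ i = nth 0 q i by rewrite (proj2 F3) // aq.
  have uq' : nth 0 q i \in q by rewrite mem_nth.
  set u := nth 0 q i in aq3 uq'; have un := qn uq'.
  have tk : take i.+1 q = rcons (take i q) u by rewrite (take_nth 0).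
  have aM3 : a3 aM = a aM by rewrite (proj2 F3).
  have upu : a3 aUP u = p u by rewrite (proj2 F3) // up.
  have mu : a3 aM u = a aM u by rewrite aM3.
  run; apply: (@wp_if _ _ _ _ (a aM u)); first by ev.
  + move=> v0; rewrite -lt0n in v0.
    have [b1 b2] : (exists2 l, l <= a aM u & hascyc u l) /\ (exists2 l, l <= a aM u & hascyc (p u) l).
      by apply: bypass_cyc; apply: (sM 0 u 0) => //; rewrite -lt0n.
    have e1 := esound_upd es3 v0 b1; have e2 := esound_upd e1 v0 b2.
    run; su; split=> //.
    * by rewrite addnS.
    * by move=> z v /mo3 h; do 2!apply: le0_upd => //.
    * move=> z v; rewrite tk mem_rcons inE => /predU1P[->|zt] le.
        split; last by rewrite updS; apply: le0_trans le; apply: le0_minzr.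
        by apply: le0_upd => //; rewrite updS; apply: le0_trans le; apply: le0_minzr.
      by have [? ?] := cv3 z v zt le; split; do 2!apply: le0_upd => //.
  + move=> v0; run; split=> //; first by rewrite addnS.
    move=> z v; rewrite tk mem_rcons inE => /predU1P[->|zt]; last exact: cv3.
    by rewrite v0.
- by move=> r1 a1 t [-> ? ?]; rewrite take_size.
Qed.

End Cover.

Definition search :=
  rBUD <~ Reg rST .* Reg rST ;; rKK <~ Reg rST ;; rOF <~ Const 0 ;;
  bfs ;; lift_table ;; cover_edges ;; push_down ;; report.

Section Search.
Variables (n ST w J : nat) (nb : nat -> seq nat).
Definition edge (u y : nat) := y \in nb u.
Hypothesis w0 : 0 < w.
Hypothesis bigW : (ST + 10) ^ 3 < 2 ^ w.
Hypothesis nST : n < ST.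
Hypothesis JST : J <= ST.
Hypothesis J0 : 0 < J.
Hypothesis nJ : n <= 2 ^ J.
Hypothesis Esym : symmetric edge.
Hypothesis Eirr : irreflexive edge.
Hypothesis nb_n : forall u y : nat, u < n -> y \in nb u -> y < n.
Hypothesis nb_ST : forall u, u < n -> size (nb u) < ST.

(** The vertex [t i0] near [x] and the vertex [t 0] that receives the estimate are unrelated, so one
    nearby vertex serves the whole cycle. *)
Definition complete_for (al : pred nat) x (est : nat -> nat) :=
  forall s t i0 delta, cycfun edge s t -> 2 < s -> (forall i, i <= s -> al (t i)) ->
    i0 <= s -> walk (arc nb al) x (t i0) delta -> le0 (est (t 0)) (s + 2 * delta).

Lemma search_wp (al : pred nat) tag x r a tau :
  r rX = x -> r rTAG = tag -> r rST = ST -> r rJ = J -> x < n -> al x ->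
  adjrep n ST nb (a aDG) (a aAD) 0 -> (forall y, al y = ~~ (a aMK y < tag)) ->
  esound nb (a aEST) ->
  wp w search (fun r' a' t => exists q : seq nat,
    [/\ uniq q, forall u : nat, u \in q -> [/\ u < n, al u & u = x \/ 0 < size (nb u)] &
        t <= tau + (size q + volume nb q) * (4 * J + 3)] /\
    [/\ esound nb (a' aEST), forall z v, le0 (a aEST z) v -> le0 (a' aEST z) v &
        complete_for al x (a' aEST)]) r a tau.
Proof.
move=> rx rtag rst rj xn alx adj alE es.
have W3 := word_small bigW; have WI := word_idx bigW.
have WS : ST * ST < 2 ^ w by apply: leq_ltn_trans (leq_addr 0 _) (WI ST 0 _ _); slia.
rewrite /search; run; freeze r0 a0 Er Ea; subst a0.
apply: wp_conseq (wp_frame (@bfs_wp n ST w nb al x w0 bigW nST nb_n nb_ST (ST * ST) ST 0 tag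
  r0 a tau _ _ _ _ _ _ xn (leq0n n) adj alE)) _ => //; try by rewrite Er; su.
move=> r1 a1 t1 [[q [h [vol [[r1h r1v qu ->] inv ex]]]] F1]; keep F1.
have inv' := inv; case: inv' => [[L core dL] hq scn vE vb].
have [[uqq q0 q_gt0 qn] [dx px so [di [dLq par]]]] := core.
have qs := sizeq_n uqq qn; have [rc qi qp] := qu.
(* Neither limit stops a full search: volumes are at most [n * ST < ST * ST], and depths, bounded by
   queue positions, are below [n < ST]. *)
have hE : h = size q.
  apply/eqP; rewrite eqn_leq hq leqNgt; apply/negP => hs.
  case: ex => [he|he|he].
  - by rewrite he ltnn in hs.
  - have := @volume_le n ST nb nb_ST (take h.+1 q) (fun u ut => qn u (mem_take ut)).
    rewrite size_takel // (take_nth 0) // /volume -cats1 big_cat big_seq1 -/(volume nb (take h q)) -vE.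
    move=> le; have : ST * ST <= n * ST.
      by apply: leq_trans he (leq_trans le _); rewrite leq_mul2r (leq_trans hs qs) orbT.
    by rewrite leq_mul2r; move: nST qs hs; slia.
  - by have := di _ hs; move: he nST qs hs; slia.
have xq : x \in q by rewrite -q0 mem_nth.
have parent (u : nat) : u \in q -> u != x ->
    [/\ a1 aUP u \in q, edge (a1 aUP u) u, al u & a1 aD u = (a1 aD (a1 aUP u)).+1].
  by move=> uq ux; have [h1 h2 h3 h4] := par u uq ux; split=> //; apply: mem_take h1.
have closed (u y : nat) : u \in q -> edge u y -> al y -> y \in q /\ a1 aD y <= (a1 aD u).+1.
  by move=> uq; have [|sc _] := scn u; [rewrite hE take_size|apply: sc].
have dn (u : nat) : u \in q -> a1 aD u <= n.
  move=> uq; have iq : index u q < size q by rewrite index_mem.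
  by have := di _ iq; rewrite nth_index //; move: iq qs; slia.
have pq (u : nat) : u \in q -> a1 aUP u \in q.
  by have [->|ux] := eqVneq u x; rewrite ?px // => uq; case: (parent u uq ux).
have a1E : [/\ a1 aDG = a aDG, a1 aAD = a aAD, a1 aMK = a aMK & a1 aEST = a aEST].
  by split; rewrite (proj2 F1).
have [dg1 ad1 mk1 est1] := a1E.
set d := a1 aD in dx px so di dLq par parent closed dn core inv dL scn.
set p := a1 aUP in dx px par parent closed core inv pq scn.
have up1 : uptab ST q p 1 (a1 aUP) by case=> // u _ uq.
have qk1 : qok ST J q r1 a1 by split.
apply: wp_seq; apply: wp_conseq (wp_frame (@lift_table_wp n ST w J q p w0 bigW nST JST uqq qn pq r1 a1 _ qk1 up1)) _.
move=> r2 a2 t2 [[-> up2 m2] F2]; keep F2.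
have aq2 : a2 aQ = a1 aQ by rewrite (proj2 F2).
have qk2 : qok ST J q r2 a2 by split=> //; rewrite aq2.
have d2 : a2 aD = d by rewrite (proj2 F2).
have est2 : a2 aEST = a aEST by rewrite (proj2 F2).
apply: wp_seq; apply: wp_conseq (wp_frame (@cover_edges_wp n ST w J x q d p nb al w0 bigW nST JST J0 nJ uqq qn
  Esym Eirr nb_ST alx dx px parent closed dn tag r2 a2 _ qk2 _ _ _ d2 up2 m2)) _ => //.
- by rewrite !(proj2 F2) // dg1 ad1.
- by move=> y; rewrite (proj2 F2) // mk1.
move=> r3 a3 t3 [[le3 sM3 st3] F3]; keep F3.
have aq3 : a3 aQ = a1 aQ by rewrite (proj2 F3).
have qk3 : qok ST J q r3 a3 by split=> //; rewrite aq3.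
have up3 : uptab ST q p J (a3 aUP) by rewrite (proj2 F3).
apply: wp_seq; apply: wp_conseq (wp_frame (@push_down_wp n ST w J x q d p nb al w0 bigW nST JST J0 uqq qn
  dx px parent r3 a3 _ qk3 up3 sM3)) _.
move=> r4 a4 t4 [[le4 sM4 cv4] F4]; keep F4.
have aq4 : a4 aQ = a1 aQ by rewrite (proj2 F4).
have qk4 : qok ST J q r4 a4 by split=> //; rewrite aq4.
have up4 (u : nat) : u \in q -> a4 aUP u = p u by move=> uq; rewrite (proj2 F4) // (up3 0 u).
have est4 : a4 aEST = a aEST by rewrite (proj2 F4) // (proj2 F3).
apply: wp_conseq (@report_wp n ST w J x q d p nb w0 bigW nST JST J0 uqq qn dx px r4 a4 _ qk4 up4 sM4 _) _.
  by rewrite est4.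
move=> r5 a5 t5 [-> es5 mo5 cv5]; exists q; split; split=> //.
- move=> u uq; have [->|ux] := eqVneq u x; first by split=> //; left.
  have [h1 h2 h3 h4] := parent u uq ux; split=> //; [exact: qn|right].
  by move: h2; rewrite -[edge _ _]/(edge _ u) Esym /edge; case: (nb u).
- have v1 : vol = volume nb q by rewrite vE hE take_size.
  move: le3 le4 q_gt0; rewrite hE v1; move: (size q) (volume nb q) (J) => s v j.
  by nia.
- by move=> z v le; apply: mo5; rewrite est4.
- move=> s t i0 delta ct s2 alt i0s wk.
  have hl : h < size q -> delta <= d (nth 0 q h) by rewrite hE ltnn.
  have [tq td] := bfs_reach inv hl wk (leqnn _).
  have [z [a' [b' [zt cr le]]]] := cycle_crossing Esym Eirr alx dx px parent closed ct s2 alt i0s tq td.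
  have [[zq zx aq] [bq Eab n1 n2 [ancz nancz]]] := cr.
  have nz : ~ anc p z b' by case=> j /esym; apply: nancz.
  (* An edge is settled from an end at least as deep as the other; [onpath] is symmetric, so the
     crossing can be read from either end. *)
  have mc : mcov ST J q p (a3 aM) z (d a' + d b' + 1).
    have [leab|] := leqP (d b') (d a').
      by apply: (st3 a' b' aq Eab _ leab _ z) => //; [exact: (q_al alx parent bq)|rewrite eq_sym|left].
    move/ltnW => leba; rewrite [d a' + _]addnC; apply: (st3 b' a' bq _ _ leba _ z) => //.
    + by rewrite -[_ \in _]/(edge b' a') Esym.
    + exact: (q_al alx parent aq).
    + by rewrite eq_sym.
    + by right.
  have [zq' lez] := cv4 _ _ mc.
  have lez' : le0 (a4 aM z) (s + 2 * delta) by move: lez; rewrite /le0; move: le; slia.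
  have [e1 e2] := cv5 z _ zq' lez'.
  by case: zt => [<-|<-].
Qed.
End Search.

(** * Adjacency lists and parameters *)

Definition add_half t1 t2 :=
  rX <~ Get t1 (Reg rO) ;; rY <~ Get t2 (Reg rO) ;;
  If (Get aDG (Reg rX) .= Const 0) (Store aNV (Reg rNV) (Reg rX) ;; incr rNV) Skip ;;
  Store aAD (cell (Reg rX) (Get aDG (Reg rX))) (Reg rY) ;;
  Store aDG (Reg rX) (Get aDG (Reg rX) .+ Const 1).

Definition build_graph := for_ rO rM (add_half 0 1 ;; add_half 1 0).

Definition halves (es : seq (nat * nat)) :=
  flatten [seq [:: e; (e.2, e.1)] | e <- es].

(** Filtering keeps the order of the listing, which is the order in which a row of [aAD] is
    filled. *)
Definition nbs (l : seq (nat * nat)) (u : nat) := [seq h.2 | h <- l & h.1 == u].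

Lemma nbs_rcons l h u : nbs (rcons l h) u = if h.1 == u then rcons (nbs l u) h.2 else nbs l u.
Proof. by rewrite /nbs filter_rcons; case: ifP => // _; rewrite map_rcons. Qed.

Lemma size_nbs l u : size (nbs l u) <= size l.
Proof. by rewrite size_map size_filter count_size. Qed.

Lemma mem_nbs l (u y : nat) : (y \in nbs l u) = ((u, y) \in l).
Proof.
apply/mapP/idP => [[[a b]]|h]; first by rewrite mem_filter /= => /andP[/eqP <- h] ->.
by exists (u, y); rewrite // mem_filter eqxx.
Qed.

Lemma mem_halves es (u y : nat) : ((u, y) \in halves es) = ((u, y) \in es) || ((y, u) \in es).
Proof.
apply/flatten_mapP/orP => [[[a b] h]|[h|h]].
- by rewrite !inE => /orP[/eqP ->|/eqP[-> ->]]; [left|right].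
- by exists (u, y); rewrite // mem_head.
- by exists (y, u); rewrite // !inE eqxx orbT.
Qed.

Lemma halves_rcons es e : halves (rcons es e) = rcons (rcons (halves es) e) (e.2, e.1).
Proof. by rewrite /halves map_rcons flatten_rcons -!cats1 -catA. Qed.

Lemma size_halves es : size (halves es) = 2 * size es.
Proof. by elim: es => //= e es IH; rewrite IH mulnS. Qed.

Section Build.
Variables (n ST w : nat).
Hypothesis w0 : 0 < w.
Hypothesis bigW : (ST + 10) ^ 3 < 2 ^ w.
Hypothesis nST : n < ST.

Definition graph_repr l (nvl : seq nat) (r : nat -> nat) (a : nat -> nat -> nat) :=
  [/\ forall u, u < n -> a aDG u = size (nbs l u) /\
        (forall j, j < size (nbs l u) -> a aAD (u * ST + j) = nth 0 (nbs l u) j),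
      forall u, n <= u -> a aDG u = 0,
      r rNV = size nvl, uniq nvl &
      [/\ forall i, i < size nvl -> a aNV i = nth 0 nvl i &
          forall u : nat, (u \in nvl) = (0 < size (nbs l u))]].

Lemma add_half_wp t1 t2 l nvl (u y : nat) i r a tau :
  graph_repr l nvl r a -> r rST = ST -> r rO = i -> a t1 i = u -> a t2 i = y -> u < n -> y < n ->
  size l < ST -> (forall h, h \in l -> h.1 < n) -> 
  wp w (add_half t1 t2) (fun r' a' t => [/\ t = tau & exists nvl' : seq nat,
    graph_repr (rcons l (u, y)) nvl' r' a']) r a tau.
Proof.
move=> [gu g0 rnv uv [nv mv]] rst ro au ay un yn sl ln.
have W3 := word_small bigW; have WI := word_idx bigW.
have [du row] := gu u un; have sz := size_nbs l u.
have nvn (v : nat) : v \in nvl -> v < n.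
  rewrite mv; case E: (nbs l v) => [//|z s] _.
  have : z \in nbs l v by rewrite E mem_head.
  by rewrite mem_nbs => /ln.
have snv : size nvl <= n by apply: sizeq_n.
set nvl' := if u \in nvl then nvl else rcons nvl u.
rewrite /add_half; run.
apply: (@wp_conseq _ _ (fun r' a' t => [/\ t = tau, r' rST = ST, r' rX = u, r' rY = y &
   [/\ a' aDG = a aDG, a' aAD = a aAD, r' rNV = size nvl' &
    forall i, i < size nvl' -> a' aNV i = nth 0 nvl' i]])).
  apply: (@wp_ifb _ _ _ _ (a aDG u == 0)); first by ev.
  - rewrite du => d0; have nu : u \notin nvl by rewrite mv -leqNgt leqn0.
    rewrite /nvl' (negPf nu); run; su; split=> //; rewrite size_rcons; split=> //; first by rewrite addn1.
    move=> j; rewrite ltnS leq_eqVlt /upd => /predU1P[->|js]; rewrite nth_rcons.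
      by rewrite eqxx ltnn.
    by rewrite (ltn_eqF js) js nv.
  - rewrite du -lt0n => d0; have nu : u \in nvl by rewrite mv.
    by rewrite /nvl' nu; run; su; split.
move=> r1 a1 t1' [-> r1s r1x r1y [d1 ad1 nv1 nva1]].
have du1 : a1 aDG u = size (nbs l u) by rewrite d1.
run; su; split=> //; exists nvl'; split=> //; su.
- move=> v vn; have [dv rowv] := gu v vn; rewrite nbs_rcons /= eq_sym {1}/upd.
  have svl := leq_ltn_trans (size_nbs l v) sl; have sul := leq_ltn_trans (size_nbs l u) sl.
  case: eqP => [->|vu].
    rewrite size_rcons addn1; split=> // j; rewrite ltnS leq_eqVlt nth_rcons => /predU1P[->|js].
      by rewrite updS ltnn eqxx.
    by rewrite js updN ?row // ltn_idx ?eqxx ?(ltn_eqF js) //; apply: ltn_trans sul.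
  split=> // j js; rewrite updN ?rowv // ltn_idx ?(negPf (introN eqP vu)) //.
  exact: ltn_trans svl.
- by move=> v nv'; rewrite updN ?g0 //; apply/eqP => vu; move: nv'; rewrite vu leqNgt un.
- by rewrite /nvl'; case: ifP => // nu; rewrite rcons_uniq nu.
- split=> // v; rewrite nbs_rcons /= /nvl'; case: eqP => [<-|vu].
    by rewrite size_rcons ltnS leq0n; case h: (u \in nvl); rewrite ?h // mem_rcons mem_head.
  case h: (u \in nvl); first exact: mv.
  by rewrite mem_rcons inE mv eq_sym (negPf (introN eqP vu)).
Qed.

Lemma build_graph_wp (es : seq (nat * nat)) r a tau :
  r rST = ST -> r rM = size es -> r rNV = 0 -> 2 * size es < ST ->
  (forall e, e \in es -> e.1 < n /\ e.2 < n) ->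
  (forall i, i < size es -> a 0 i = (nth (0, 0) es i).1 /\ a 1 i = (nth (0, 0) es i).2) ->
  (forall i, a aDG i = 0) ->
  wp w build_graph (fun r' a' t => t = tau + size es /\ exists nvl : seq nat,
    graph_repr (halves es) nvl r' a') r a tau.
Proof.
move=> rst rm rnv sST esn aes adg.
have W3 := word_small bigW; have WI := word_idx bigW.
rewrite /build_graph; apply: (@wp_for _ _ _ (size es) _ (fun i r' a' t => t = tau + i /\
   exists nvl : seq nat, graph_repr (halves (take i es)) nvl r' a') (tau + size es)) => //.
- by apply: W3; move: sST; slia.
- by rewrite addn0 take0; split=> //; exists [::]; split.
- by move=> i r' a' t iN [-> _]; rewrite leq_add2l.
- move=> i r1 a1 t iN [-> [nvl g]] ri F; keep F.
  have e_es : nth (0, 0) es i \in es by rewrite mem_nth.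
  have [e1n e2n] := esn _ e_es; have [a0i a1i] := aes i iN.
  set e := nth _ es i in e_es e1n e2n a0i a1i.
  have hl h : h \in halves (take i es) -> h.1 < n.
    case: h => u y; rewrite mem_halves => /orP[] /mem_take /esn [] //.
  have sh : size (halves (take i es)) = 2 * i by rewrite size_halves size_takel // ltnW.
  have A0 : a1 0 i = e.1 by rewrite (proj2 F).
  have A1 : a1 1 i = e.2 by rewrite (proj2 F).
  apply: wp_seq; apply: wp_conseq (wp_frame (@add_half_wp 0 1 _ _ e.1 e.2 i r1 a1 _ g _ ri A0 A1 e1n e2n _ hl)) _ => //.
    by rewrite sh; move: sST iN; slia.
  move=> r2 a2 t2 [[-> [nvl2 g2]] F2]; keep F2.
  have B0 : a2 0 i = e.1 by rewrite (proj2 F2).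
  have B1 : a2 1 i = e.2 by rewrite (proj2 F2).
  apply: wp_conseq (@add_half_wp 1 0 _ _ e.2 e.1 i r2 a2 _ g2 _ _ B1 B0 e2n e1n _ _) _ => //.
  + by rewrite size_rcons sh; move: sST iN; slia.
  + by move=> h; rewrite mem_rcons inE => /predU1P[->|/hl].
  move=> r3 a3 t3 [-> [nvl3 g3]]; rewrite addnS; split=> //; exists nvl3.
  by rewrite (take_nth (0, 0)) // -/e halves_rcons; move: g3; rewrite -surjective_pairing.
- by move=> r1 a1 t [-> [nvl g]] _; rewrite take_size in g; split=> //; exists nvl.
Qed.
End Build.

Definition log_setup :=
  rT <~ Const 2 ;; rJ <~ Const 1 ;; While (Reg rT .< Reg rN) (rT <~ Reg rT .+ Reg rT ;; incr rJ).

(** Multiplication stops at the first product above [m ^ 2]: products fit in a word however large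
    [k] is, and logarithmically many suffice because the factor is at least 2. *)
Definition alpha_setup :=
  rW <~ Reg rM .* Reg rM ;; rAL <~ Const 1 ;; rGO <~ Const 1 ;;
  While (Reg rGO)
    (rT <~ Reg rAL .+ Const 1 ;; rPR <~ Reg rN ;; ri <~ Const 0 ;;
     While (eAnd (Reg ri .< Reg rK) (eNot (Reg rW .< Reg rPR)))
       (rPR <~ Reg rPR .* Reg rT ;; incr ri) ;;
     If (Reg rW .< Reg rPR) (rGO <~ Const 0) (rAL <~ Reg rT)).

Section Scalars.
Variables (n m k ST w D : nat).
Hypothesis w0 : 0 < w.
Hypothesis bigW : (ST + 10) ^ 3 < 2 ^ w.
Hypothesis nST : n < ST.
Hypothesis mST : m <= ST.

Lemma log_setup_wp r a tau : r rN = n -> 1 < n ->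
  wp w log_setup (fun r' a' t => exists J,
    [/\ r' rJ = J, 0 < J, n <= 2 ^ J, 2 ^ J.-1 < n & t <= tau + J]) r a tau.
Proof.
move=> rn n1; have W3 := word_small bigW.
rewrite /log_setup; run; freeze r0 a0 Er Ea; subst a0.
apply: (@wp_whilef _ (fun r' a' t => exists j,
  [/\ r' rJ = j.+1, r' rT = 2 ^ j.+1, 2 ^ j < n & t = tau + j]) (tau + n)).
- by exists 0; rewrite Er; su; rewrite addn0.
- move=> r' a' t [j [_ _ lt ->]]; rewrite leq_add2l; apply: ltnW.
  by apply: ltn_trans lt; apply: ltn_expl.
- move=> r1 a1 t [j [rj rt lt ->]] F; keep F.
  rewrite (@eval_lt w w0 r1 a1 (Reg rT) (Reg rN) (2 ^ j.+1) n) //; case: ltnP => // lt2 _.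
  have e2 : 2 ^ j.+1 + 2 ^ j.+1 = 2 ^ j.+2 by rewrite addnn -mul2n -expnS.
  have W1 : 2 ^ j.+1 + 2 ^ j.+1 < 2 ^ w.
    by apply: W3; move: (2 ^ j.+1) lt2 => X; slia.
  have jn : j.+2 < n by apply: leq_ltn_trans lt2; apply: ltn_expl.
  run; exists j.+1; su; rewrite e2 addn1 addnS; split=> //.
- move=> r1 a1 t [j [rj rt lt ->]] F; keep F.
  rewrite (@eval_lt w w0 r1 a1 (Reg rT) (Reg rN) (2 ^ j.+1) n) //; case: ltnP => // le _.
  by exists j.+1; split=> //; rewrite leq_add2l.
Qed.

Lemma alpha_setup_wp r a tau : r rN = n -> r rM = m -> r rK = k ->
  0 < n -> 0 < m -> 1 < k -> k < 2 ^ w -> m ^ 2 < 2 ^ D ->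
  wp w alpha_setup (fun r' a' t => exists al,
    [/\ r' rAL = al, 0 < al <= m, al = 1 \/ n * al ^ k <= m ^ 2, m ^ 2 < n * al.+1 ^ k &
        t <= tau + al * D.+1]) r a tau.
Proof.
move=> rn rm rk n0 m0 k1 kW mD; have W3 := word_small bigW; have WI := word_idx bigW.
have WM : m * m < 2 ^ w by apply: leq_ltn_trans bigW; move: mST; rewrite !expnS expn0; nia.
rewrite /alpha_setup; run; freeze r0 a0 Er Ea; subst a0.
have r0w : r0 rW = m ^ 2 by rewrite Er; su.
apply: (@wp_whilef _ (fun r' a' t => exists al (go : bool),
  [/\ r' rAL = al, 0 < al <= m, al = 1 \/ n * al ^ k <= m ^ 2, r' rGO = go &
      t <= tau + (al - go) * D.+1 /\ (~~ go -> m ^ 2 < n * al.+1 ^ k)]) (tau + m * D.+1)).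
- exists 1, true; rewrite Er; su; split=> //; first by left.
  by rewrite subnn mul0n addn0.
- move=> r' a' t [al [go [_ /andP[_ am] _ _ [le _]]]]; apply: leq_trans le _.
  by rewrite leq_add2l leq_mul2r; apply/orP; right; apply: leq_trans (leq_subr _ _) am.
- move=> r1 a1 t [al [go [ral /andP[a0' am] ain rgo [le _]]]] F; keep F.
  rewrite (@eval_reg _ _ _ _ go) //; case: go rgo le => // rgo le _.
  run; freeze r2 a2 Er2 Ea2; subst a2.
  have [r2t r2p r2i] : [/\ r2 rT = al.+1, r2 rPR = n & r2 ri = 0] by rewrite Er2 -[al.+1]addn1; su.
  have G r3 (a3 : nat -> nat -> nat) i X : r3 ri = i -> r3 rK = k -> r3 rW = m ^ 2 -> r3 rPR = X ->
     eval w r3 a3 (eAnd (Reg ri .< Reg rK) (eNot (Reg rW .< Reg rPR))) = (i < k) && (X <= m ^ 2).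
    by move=> h1 h2 h3 h4; rewrite [X <= _]leqNgt; ev.
  apply: (@wp_whilef _ (fun r' a' t' => exists i,
    [/\ r' ri = i, r' rPR = n * al.+1 ^ i, t' = t.+1 + i, i <= k &
        i = 0 \/ n * al.+1 ^ i.-1 <= m ^ 2]) (t.+1 + k)).
  + by exists 0; rewrite expn0 muln1 addn0; split=> //; left.
  + by move=> r' a' t' [i [_ _ -> ik _]]; rewrite leq_add2l.
  + move=> r3 a3 t3 [i [ri' rp -> ik im]] F3; keep F3.
    rewrite (G r3 a3 i _ _ _ _ rp) //; case: andP => // -[ik' pm] _.
    have WX : n * al.+1 ^ i * al.+1 < 2 ^ w.
      apply: leq_ltn_trans bigW; apply: (@leq_trans (m ^ 2 * m.+1)).
        by apply: leq_mul.
      by rewrite [leqRHS]expnSr leq_mul ?leq_exp2r //; move: mST; slia.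
    have Wi : i + 1 < 2 ^ w by rewrite addn1; apply: leq_ltn_trans kW.
    run; exists i.+1; su; rewrite expnSr mulnA addn1 addnS; split=> //.
    by right.
  + move=> r3 a3 t3 [i [ri' rp -> ik im]] F3; keep F3.
    rewrite (G r3 a3 i _ _ _ _ rp) // => g.
    (* The last product not above [m ^ 2 < 2 ^ D] contains [i - 1] factors, each at least 2. *)
    have iD : i <= D.
      case: im => [->//|im]; case: i {ri' rp ik g} im => // i /= im.
      have : 2 ^ i < 2 ^ D.
        apply: leq_ltn_trans mD; apply: leq_trans im; rewrite -[leqLHS]mul1n.
        by apply: leq_mul => //; case: (i) => // j; rewrite leq_exp2r.
      by rewrite ltn_exp2l.
    have al1 : al * D.+1 = (al - 1) * D.+1 + D.+1.
      by rewrite -[in LHS](subnK a0') mulnDl mul1n.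
    apply: (@wp_ifb _ _ _ _ (m ^ 2 < n * al.+1 ^ i)); first by ev.
    * move=> lt; run; exists al, false; su; rewrite subn0; split; rewrite ?a0' //; split.
        by rewrite al1; move: iD le; move: ((al - 1) * D.+1) => Y; slia.
      by move=> _; apply: leq_trans lt _; rewrite leq_mul2l leq_pexp2l ?orbT.
    * rewrite -leqNgt => pm; have ek : i = k.
        by apply/eqP; move: g; rewrite pm andbT eqn_leq ik; case: ltnP.
      (* Since [2 <= k], [al.+1 ^ 2 <= al.+1 ^ k <= m ^ 2]. *)
      have alm : al.+1 <= m.
        rewrite -leq_sqr; apply: leq_trans pm; rewrite ek -[leqLHS]mul1n.
        by apply: leq_mul => //; rewrite leq_pexp2l.
      run; exists al.+1, true; su; split=> //.
      - by right; rewrite -ek.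
      - by rewrite subn1 /= al1; split=> //; move: iD le; move: ((al - 1) * D.+1) => Y; slia.
- move=> r1 a1 t [al [go [ral alm ain rgo [le gp]]]] F.
  rewrite (@eval_reg _ _ _ _ go) //; case: go rgo le gp => // rgo le gp _.
  by exists al; rewrite subn0 in le; split=> //; apply: gp.
Qed.
End Scalars.

(** * Balls and landmarks *)

Definition save_ball :=
  rT <~ (Reg rH .< Reg rC) ;; rP <~ Reg rH .+ Reg rT ;;
  for_ ri rP
    (rU <~ Get aQ (Reg ri) ;;
     Store aAD (cell (Reg rN .+ Reg rX) (Reg ri)) (Reg rU) ;;
     Store aIN (cell (Reg rX) (Reg rU)) (Const 1) ;;
     Store aCNT (Reg rU) (Get aCNT (Reg rU) .+ Reg rT)) ;;
  Store aPS (Reg rX) (Reg rP) ;;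
  Store aDG (Reg rN .+ Reg rX) (Reg rH) ;;
  Store aHT (Reg rX) (Reg rT).

Definition balls :=
  for_ rO rNV
    (rX <~ Get aNV (Reg rO) ;; rTAG <~ Const 0 ;; rOF <~ Const 0 ;;
     rBUD <~ Reg rAL ;; rKK <~ Reg rST ;; bfs ;; save_ball).

Section Balls.
Variables (n ST w alp : nat) (nb : nat -> seq nat).
Hypothesis w0 : 0 < w.
Hypothesis bigW : (ST + 10) ^ 3 < 2 ^ w.
Hypothesis nST : n < ST.
Hypothesis Esym : symmetric (edge nb).
Hypothesis nb_n : forall u y : nat, u < n -> y \in nb u -> y < n.
Hypothesis nb_ST : forall u, u < n -> size (nb u) < ST.
Hypothesis alp0 : 0 < alp.

(* P is the ball of v and b the size of its inner part; v is heavy when b < size P. *)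
Definition ball_ok (v : nat) (P : seq nat) b :=
  [/\ b <= size P, uniq P & forall u : nat, u \in P -> u < n /\ 0 < size (nb u)] /\
  [/\ volume nb (take b P) < alp, b < size P -> alp <= volume nb P, size P <= alp,
      0 < b -> v \in take b P &
      forall delta, (b < size P /\ forall z : nat, z \in P -> exists2 l, l <= delta & walk (edge nb) v z l) \/
        (forall (y : nat) l, l <= delta -> walk (edge nb) v y l -> y \in take b P)].

Lemma size_le_volume (s : seq nat) : (forall u : nat, u \in s -> 0 < size (nb u)) ->
  size s <= volume nb s.
Proof.
move=> H; rewrite -sum1_size /volume big_seq [leqRHS]big_seq.
by apply: leq_sum => u /H.
Qed.

(** For the dichotomy, compare [delta] with the depth of the first unexpanded vertex. If that vertex
    exists and its depth is at most [delta], the whole ball is within [delta]; otherwise everything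
    within [delta] has been expanded. Positive degrees bound the number of expanded vertices by
    their volume, hence the ball by [alp] vertices. *)
Lemma ball_of_bfs (x : nat) q h d p vol kk : bfs_inv n nb predT x q h d p vol alp kk ->
  [\/ h = size q, alp <= vol + size (nb (nth 0 q h)) | kk <= (d (nth 0 q h)).+1] ->
  n < kk -> 0 < size (nb x) -> ball_ok x (take (h + (h < size q)) q) h.
Proof.
move=> inv ex nk nbx; have inv' := inv.
case: inv' => [[L core dL] hq scn vE vb].
have [[uqq q0 q_gt0 qn] [dx px so [di [dLq par]]]] := core.
have qs := sizeq_n uqq qn.
have qnb (u : nat) : u \in q -> u < n /\ 0 < size (nb u).
  move=> uq; split; first exact: qn.
  have [->//|ux] := eqVneq u x; have [_ h2 _ _] := par u uq ux.
  by move: h2; rewrite -[_ \in _]/(edge nb _ _) Esym /edge; case: (nb u).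
have th : take h (take (h + (h < size q)) q) = take h q by rewrite take_takel // leq_addr.
have sP : size (take (h + (h < size q)) q) = h + (h < size q).
  by rewrite size_takel //; case: ltnP => hs; rewrite ?addn1 ?addn0.
have va : volume nb (take h q) < alp by case: vb => [->|]; rewrite ?take0 ?vE // /volume big_nil.
split; split.
- by rewrite sP leq_addr.
- exact: take_uniq.
- by move=> u /mem_take; apply: qnb.
- by rewrite th.
- rewrite sP; case: (ltnP h (size q)) => hs; last by rewrite addn0 ltnn.
  rewrite addn1 (take_nth 0) // /volume -cats1 big_cat big_seq1 -/(volume _ _) -vE => _.
  case: ex => // [he|he]; first by rewrite he ltnn in hs.
  by have := di _ hs; move: he nk hs qs; slia.
- rewrite sP; have : h <= volume nb (take h q).
    rewrite -{1}(size_takel hq); apply: size_le_volume => u /mem_take uq.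
    by case: (qnb u uq).
  by case: (h < size q) => /= le; move: va le; slia.
- move=> h0; rewrite th -q0 -[X in X \in _](nth_take 0 h0).
  by apply: mem_nth; rewrite size_takel.
- move=> delta; rewrite th sP.
  have aE : arc nb predT =2 edge nb by move=> u y; rewrite /arc andbT.
  have [[hs dd]|right_] := pselect (h < size q /\ d (nth 0 q h) <= delta).
    left; rewrite hs addn1; split=> // z zq; exists (d z); last first.
      by apply: sub_walk (bfs_walk inv (mem_take zq)) => u y; rewrite aE.
    apply: leq_trans dd; have zi : index z q <= h.
      rewrite leqNgt; apply/negP => hz; have := mem_take zq.
      move=> zq'; have := zq; rewrite -(cat_take_drop h.+1 q) in uqq.
      move=> zt; have := index_cat z (take h.+1 q) (drop h.+1 q).
      rewrite cat_take_drop zt => e; have : index z (take h.+1 q) < size (take h.+1 q) by rewrite index_mem.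
      by rewrite -e size_takel // ltnS leqNgt hz.
    by rewrite -{1}(nth_index 0 (mem_take zq)); apply: so.
  right=> y l ld wk.
  have hd : h < size q -> delta.+1 <= d (nth 0 q h).
    by move=> hs; rewrite ltnNge; apply/negP => dd; apply: right_.
  have wk' : walk (arc nb predT) x y l by apply: sub_walk wk => u z; rewrite aE.
  have [yq yd] := bfs_reach inv (fun hs => leq_trans ld (ltnW (hd hs))) wk' (leqnn l).
  by apply: (bfs_closed inv hd yq); rewrite ltnS (leq_trans yd).
Qed.

Definition Pl (a : nat -> nat -> nat) v := mkseq (fun j => a aAD ((n + v) * ST + j)) (a aPS v).

Lemma save_ball_wp (x : nat) (q : seq nat) h r a tau :
  r rX = x -> r rN = n -> r rST = ST -> r rH = h -> queue r a q -> x < n ->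
  uniq q -> (forall u : nat, u \in q -> u < n) -> h <= size q ->
  (forall u, u < n -> a aIN (x * ST + u) = 0) -> (forall u, a aCNT u <= n) ->
  wp w save_ball (fun r' a' t => let f := h < size q in let P := take (h + f) q in
    [/\ t = tau + size P,
        forall u j : nat, u != n + x -> j < ST -> a' aAD (u * ST + j) = a aAD (u * ST + j),
        Pl a' x = P &
        forall v u : nat, v != x -> u < n -> a' aIN (v * ST + u) = a aIN (v * ST + u)] /\
    [/\ forall u, u < n -> a' aIN (x * ST + u) = (u \in P),
        forall u, a' aCNT u = a aCNT u + f && (u \in P),
        a' aPS = upd (a aPS) x (size P), a' aDG = upd (a aDG) (n + x) h &
        a' aHT = upd (a aHT) x f]) r a tau.
Proof.
move=> rx rn rst rh qu xn uqq qn hq in0 cn; have [rc qi qp] := qu.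
have W3 := word_small bigW; have WI := word_idx bigW; have qs := sizeq_n uqq qn.
set f := h < size q; set P := take (h + f) q.
have hf : h + f <= size q by rewrite /f; case: ltnP => hs; rewrite ?addn1 ?addn0.
have sP : size P = h + f by rewrite size_takel.
have uP : uniq P by apply: take_uniq.
rewrite /save_ball; run.
freeze r0 a0 Er Ea; subst a0.
have [r0p r0t] : r0 rP = size P /\ r0 rT = f by rewrite Er sP; su.
apply: wp_seqI; apply: wp_seq.
apply: (@wp_for _ _ _ (size P) _ (fun i r' a' t => 
    [/\ t = tau + i,
        forall u j : nat, u != n + x -> j < ST -> a' aAD (u * ST + j) = a aAD (u * ST + j),
        forall j, j < i -> a' aAD ((n + x) * ST + j) = nth 0 P j &
        forall v u : nat, v != x -> u < n -> a' aIN (v * ST + u) = a aIN (v * ST + u)] /\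
    [/\ forall u, u < n -> a' aIN (x * ST + u) = (u \in take i P) &
        forall u, a' aCNT u = a aCNT u + f && (u \in take i P)]) (tau + size P)) => //.
- by apply: W3; rewrite sP; move: hf qs; slia.
- split; split; rewrite ?addn0 ?take0 // => u.
  by rewrite andbF addn0.
- by move=> i r' a' t iN [[-> _ _ _] _]; rewrite leq_add2l.
- move=> i r1 a1 t iP [[-> ad1 ad2 in1] [in2 cn1]] ri' F; keep F.
  have iq : i < size q by move: iP hf; rewrite sP; slia.
  have aq1 : a1 aQ i = nth 0 q i by rewrite (proj2 F) // qi.
  have uq' : nth 0 q i \in q by rewrite mem_nth.
  have Pi : nth 0 P i = nth 0 q i by rewrite nth_take // -sP.
  set u := nth 0 q i in aq1 uq' Pi; have un := qn _ uq'.
  have tk : take i.+1 P = rcons (take i P) u by rewrite (take_nth 0) // Pi.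
  have ut : u \notin take i P.
    by have := take_uniq i.+1 uP; rewrite tk rcons_uniq => /andP[].
  have cu := cn1 u; rewrite (negPf ut) andbF addn0 in cu; have cun := cn u.
  have fb := leq_b1 f; have fW : f < 2 ^ w by apply: W3; apply: leq_trans fb _; rewrite addnS.
  have cW : a aCNT u + f < 2 ^ w by apply: W3; apply: leq_trans (leq_add cun fb) _; slia.
  have i3 : i <= 3 * ST by move: iq qs; slia.
  run; su; split; split.
  + by rewrite addnS.
  + by move=> v j vx jS; rewrite updN ?ad1 // ltn_idx ?(negPf vx) //; move: iq qs; slia.
  + move=> j; rewrite ltnS leq_eqVlt => /predU1P[->|ji]; first by rewrite updS.
    by rewrite updN ?ad2 // ltn_idx ?(ltn_eqF ji) ?andbF //; move: ji iq qs; slia.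
  + move=> v y vx yn; rewrite updN ?in1 // ltn_idx ?(negPf vx) //; move: yn un; slia.
  + move=> y yn; rewrite tk mem_rcons inE; have [->|yu] := eqVneq y u; first by rewrite updS.
    by rewrite updN ?in2 // ltn_idx ?(negPf yu) ?andbF //; move: yn un; slia.
  + move=> y; rewrite tk mem_rcons inE; have [->|yu] := eqVneq y u; first by rewrite updS andbT.
    by rewrite updN.
- move=> r1 a1 t [[-> ad1 ad2 in1] [in2 cn1]] F; keep F.
  rewrite take_size in in2 cn1; run; su.
  have F2 := proj2 F; split; split=> //.
  + rewrite /Pl; su; rewrite updS -/P.
    apply: (@eq_from_nth _ 0); rewrite size_mkseq // => j js.
    by rewrite nth_mkseq // ad2.
  + by rewrite F2.
  + by rewrite F2.
  + by rewrite F2.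
Qed.

Definition stored (a : nat -> nat -> nat) v :=
  ball_ok v (Pl a v) (a aDG (n + v)) /\ forall u, u < n -> a aIN (v * ST + u) = (u \in Pl a v).

Definition hits (a : nat -> nat -> nat) (u v : nat) := (a aHT v != 0) && (u \in Pl a v).

Definition balls_inv (S : seq nat) (a : nat -> nat -> nat) :=
  [/\ adjrep n ST nb (a aDG) (a aAD) 0,
      forall v : nat, v \in S -> stored a v /\ a aHT v = (a aDG (n + v) < size (Pl a v)),
      forall v : nat, v < n -> v \notin S -> [/\ a aDG (n + v) = 0 & forall u, u < n -> a aIN (v * ST + u) = 0] &
      forall u, a aCNT u = count (hits a u) S].

Lemma balls_wp nvl r a tau : r rNV = size nvl -> r rAL = alp -> r rST = ST -> r rN = n ->
  uniq nvl -> (forall i, i < size nvl -> a aNV i = nth 0 nvl i) ->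
  (forall u : nat, u \in nvl -> u < n /\ 0 < size (nb u)) ->
  (forall y, a aMK y = 0) -> balls_inv [::] a ->
  wp w balls (fun r' a' t => t <= tau + size nvl * (3 * alp + 1) /\ balls_inv nvl a') r a tau.
Proof.
move=> rnv ral rst rn unv nv nvP mk0 inv0.
have W3 := word_small bigW; have WI := word_idx bigW.
have snv : size nvl <= n by apply: sizeq_n => // u /nvP[].
rewrite /balls; apply: (@wp_for _ _ _ (size nvl) _ (fun i r' a' t =>
   t <= tau + i * (3 * alp + 1) /\ balls_inv (take i nvl) a') (tau + size nvl * (3 * alp + 1))) => //.
- by apply: W3; move: snv; slia.
- by rewrite addn0 take0.
- move=> i r' a' t iN [le _]; apply: leq_trans le _.
  by rewrite leq_add2l leq_mul2r iN orbT.
- move=> i r1 a1 t iN [le inv] ri' F; keep F.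
  have nv1 : a1 aNV i = nth 0 nvl i by rewrite (proj2 F) // nv.
  have x_nv : nth 0 nvl i \in nvl by rewrite mem_nth.
  set x := nth 0 nvl i in nv1 x_nv; have [xn nbx] := nvP _ x_nv.
  have tk : take i.+1 nvl = rcons (take i nvl) x by rewrite (take_nth 0).
  have xt : x \notin take i nvl.
    by have := take_uniq i.+1 unv; rewrite tk rcons_uniq => /andP[].
  have [adj st fresh cn] := inv.
  run; freeze r2 a2 Er Ea; subst a2.
  have mk1 : forall y, predT y = ~~ (a1 aMK y < 0) by [].
  apply: wp_conseq (wp_frame (@bfs_wp n ST w nb predT x w0 bigW nST nb_n nb_ST alp ST 0 0
    r2 a1 t.+1 _ _ _ _ _ _ xn (leq0n n) adj mk1)) _ => //; try by rewrite Er; su.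
  move=> r3 a3 t3 [[q [h [vol [[r3h r3v qu ->] bi ex]]]] F3]; keep F3.
  have bok := ball_of_bfs bi ex nST nbx.
  have bi' := bi; case: bi' => [[L [[uqq _ _ qn] _] _] hq _ vE _].
  have F32 := proj2 F3.
  have r3x : r3 rX = x by rewrite (proj1 F3) // Er; su.
  have [fx1 fx2] := fresh x xn xt.
  apply: wp_conseq (wp_frame (@save_ball_wp x q h r3 a3 _ _ _ _ _ qu xn uqq qn hq _ _)) _ => //.
  + by move=> u un; rewrite F32 // fx2.
  + move=> u; rewrite F32 // cn; apply: leq_trans (count_size _ _) _.
    by rewrite size_takel ?(ltnW iN) // (leq_trans (ltnW iN)).
  move=> r4 a4 t4 [[[-> ad4 P4 in4] [in4' cn4 ps4 dg4 ht4]] F4].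
  set f := h < size q in bok P4 in4' cn4 ps4 ht4 *.
  set P := take (h + f) q in bok P4 in4' cn4 ps4 *.
  have PlE v : v \in take i nvl -> Pl a4 v = Pl a1 v.
    move=> vt; have [[[[_ uv vn] _] _] _] := st v vt.
    have vx : v != x by apply: contraNneq xt => <-.
    have psv : a4 aPS v = a1 aPS v by rewrite ps4 updN // F32.
    apply: (@eq_from_nth _ 0); rewrite !size_mkseq // psv => j js.
    rewrite !nth_mkseq ?psv // ad4 ?F32 //; first by rewrite eqn_add2l.
    apply: leq_trans js _; have := sizeq_n uv (fun u h => proj1 (vn u h)).
    by rewrite size_mkseq; move: nST; slia.
  have htE v : v \in take i nvl -> a4 aHT v = a1 aHT v.
    by move=> vt; rewrite ht4 updN ?F32 //; apply: contraNneq xt => <-.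
  have dgE v : v != x -> a4 aDG (n + v) = a1 aDG (n + v).
    by move=> vx; rewrite dg4 updN ?F32 // eqn_add2l.
  split; last split.
  + have sPa : size P <= alp by case: bok => _ [].
    (* The search costs at most [alp - 1] for expanded vertices and as much for scanned edges;
       saving the ball costs at most [alp] more. *)
    have va : h + vol <= (alp - 1) + (alp - 1).
      have va : volume nb (take h q) < alp.
        by case: bok => _ [+ _ _ _ _]; rewrite /P take_takel ?leq_addr.
      have hv : h <= volume nb (take h q).
        rewrite -{1}(size_takel hq); apply: size_le_volume => u ut; case: bok => [[_ _ +] _] => /(_ u).
        case=> //; rewrite /P.
        have: u \in take h P by rewrite /P take_takel ?leq_addr.
        by apply: mem_take.
      by rewrite vE; move: va hv; slia.
    by rewrite mulSn; move: le va sPa; slia.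
  + move=> v vn; have [dv rowv] := adj v vn; rewrite add0n in dv rowv *; rewrite dg4 updN; last first.
      by apply/eqP => e; move: vn; rewrite e; slia.
    rewrite F32 //; split=> // j js; rewrite ad4 ?F32 ?rowv //.
      by apply/eqP => e; move: vn; rewrite e; slia.
    exact: ltn_trans js (nb_ST vn).
  + move=> v; rewrite tk mem_rcons inE => /predU1P[->|vt].
      split; last by rewrite ht4 dg4 P4 !updS /P size_takel /f; case: (ltnP h (size q)) => hs; rewrite ?addn1 ?addn0 ?ltnSn ?ltnn.
      by split; rewrite P4 // dg4 updS.
    have vx : v != x by apply: contraNneq xt => <-.
    have [[b1 b2] b3] := st v vt; split; last by rewrite htE // dgE // PlE.
    by split; rewrite ?PlE ?dgE // => u un; rewrite in4 // F32 // b2.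
  + move=> v vn; rewrite tk mem_rcons inE negb_or => /andP[vx vt].
    have [f1 f2] := fresh v vn vt; rewrite dgE //; split=> // u un.
    by rewrite in4 // F32 // f2.
  + move=> u; rewrite cn4 F32 // cn tk -cats1 count_cat /= addn0; congr (_ + _).
      by apply: eq_in_count => v vt; rewrite /hits htE // PlE.
    by rewrite /hits ht4 updS P4; case: (f).
- by move=> r1 a1 t [le inv] _; rewrite take_size in inv.
Qed.
End Balls.

(** * Greedy choice of the landmarks *)

Definition scan_best :=
  rBEST <~ Const 0 ;;
  for_ ri rNV
    (rU <~ Get aNV (Reg ri) ;;
     If (Reg rBEST .< Get aCNT (Reg rU)) (rBEST <~ Get aCNT (Reg rU) ;; rBU <~ Reg rU) Skip).

(** A ball is crossed off at most once, so the inner loops of all rounds together traverse each ball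
    at most once. *)
Definition hit_all :=
  for_ rO rNV
    (rW <~ Get aNV (Reg rO) ;;
     If (eAnd (Get aHT (Reg rW)) (Get aIN (cell (Reg rW) (Reg rX))))
       (Store aHT (Reg rW) (Const 0) ;;
        rP <~ Get aPS (Reg rW) ;;
        for_ ri rP
          (rU <~ Get aAD (cell (Reg rN .+ Reg rW) (Reg ri)) ;;
           Store aCNT (Reg rU) (Get aCNT (Reg rU) .- Const 1)))
       Skip).

Definition greedy :=
  scan_best ;;
  While (Reg rBEST) (rX <~ Reg rBU ;; rTAG <~ Const 0 ;; search ;; hit_all ;; scan_best).

Lemma uniq_sum_le (s t : seq nat) (om : nat -> nat) : uniq s -> {subset s <= t} ->
  \sum_(u <- s) om u <= \sum_(u <- t) om u.
Proof.
elim: s t => [|x s IH] t /=; first by rewrite big_nil.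
move=> /andP[xs us] st; have xt : x \in t by apply: st; rewrite mem_head.
rewrite (perm_big _ (perm_to_rem xt)) /= !big_cons leq_add2l; apply: IH => // y ys.
have := st y; rewrite inE ys orbT => /(_ isT); rewrite (perm_mem (perm_to_rem xt)) inE.
by case/predU1P => // e; rewrite -e ys in xs.
Qed.

Lemma count_drop (s : seq nat) w (f g : pred nat) : uniq s -> w \in s ->
  (forall v, v != w -> f v = g v) -> g w = false -> count f s = count g s + f w.
Proof.
move=> us ws fg gw; rewrite !(permP (perm_to_rem ws)) /= gw add0n addnC; congr (_ + _).
apply: eq_in_count => v; rewrite mem_rem_uniq // inE => /andP[vw _]; exact: fg.
Qed.

Section Greedy.
Variables (n ST w alp J : nat) (nb : nat -> seq nat) (nvl : seq nat).
Hypothesis w0 : 0 < w.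
Hypothesis bigW : (ST + 10) ^ 3 < 2 ^ w.
Hypothesis nST : n < ST.
Hypothesis JST : J <= ST.
Hypothesis J0 : 0 < J.
Hypothesis nJ : n <= 2 ^ J.
Hypothesis Esym : symmetric (edge nb).
Hypothesis Eirr : irreflexive (edge nb).
Hypothesis nb_n : forall u y : nat, u < n -> y \in nb u -> y < n.
Hypothesis nb_ST : forall u, u < n -> size (nb u) < ST.
Hypothesis alp0 : 0 < alp.
Hypothesis unv : uniq nvl.
Hypothesis nvn : forall u : nat, u \in nvl -> u < n.
Hypothesis nvP : forall u : nat, (u \in nvl) = (0 < size (nb u)).

Let snv : size nvl <= n. Proof. exact: sizeq_n. Qed.

Lemma scan_best_wp r a tau : r rNV = size nvl ->
  (forall i, i < size nvl -> a aNV i = nth 0 nvl i) ->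
  wp w scan_best (fun r' a' t => t = tau + size nvl /\ exists best, [/\ r' rBEST = best,
    forall u : nat, u \in nvl -> a aCNT u <= best &
    best = 0 \/ (r' rBU \in nvl /\ a aCNT (r' rBU) = best)]) r a tau.
Proof.
move=> rnv nv; have W3 := word_small bigW.
rewrite /scan_best; run; freeze r0 a0 Er Ea; subst a0.
apply: (@wp_for _ _ _ (size nvl) _ (fun i r' a' t => t = tau + i /\ exists best, [/\ r' rBEST = best,
    forall u : nat, u \in take i nvl -> a aCNT u <= best &
    best = 0 \/ (r' rBU \in nvl /\ a aCNT (r' rBU) = best)]) (tau + size nvl)) => //.
- by apply: W3; move: snv; slia.
- by rewrite addn0 take0; split=> //; exists 0; rewrite Er; su; split=> //; left.
- by move=> i r' a' t iN [-> _]; rewrite leq_add2l.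
- move=> i r1 a1 t iN [-> [best [rb le mx]]] ri' F; keep F.
  have nv1 : a1 aNV i = nth 0 nvl i by rewrite (proj2 F) // nv.
  have x_nv : nth 0 nvl i \in nvl by rewrite mem_nth.
  set x := nth 0 nvl i in nv1 x_nv.
  have tk : take i.+1 nvl = rcons (take i nvl) x by rewrite (take_nth 0).
  have cx : a1 aCNT x = a aCNT x by rewrite (proj2 F).
  run; apply: (@wp_ifb _ _ _ _ (best < a aCNT x)); first by ev.
  + move=> lt; run; rewrite addnS; split=> //; exists (a aCNT x); su; split=> //; last by right.
    move=> u; rewrite tk mem_rcons inE => /predU1P[->//|/le le']; apply: leq_trans le' _.
    exact: ltnW.
  + rewrite -leqNgt => ge; run; rewrite addnS; split=> //; exists best; su; split=> //.
    by move=> u; rewrite tk mem_rcons inE => /predU1P[->//|/le].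
- by move=> r1 a1 t [-> [best []]]; rewrite take_size => *; split=> //; exists best.
Qed.

Definition ball_inv (a : nat -> nat -> nat) :=
  [/\ adjrep n ST nb (a aDG) (a aAD) 0,
      forall v : nat, v \in nvl -> [/\ stored n ST alp nb a v, a aHT v <= 1 &
         a aHT v != 0 -> a aDG (n + v) < size (Pl n ST a v)],
      forall v : nat, v < n -> v \notin nvl -> a aDG (n + v) = 0,
      forall u, a aCNT u = count (hits n ST a u) nvl & forall y, a aMK y = 0].

Lemma eq_ball_inv a a' : (forall t : nat, t \in [:: aDG; aAD; aPS; aIN; aCNT; aHT; aMK] -> a' t = a t) ->
  ball_inv a -> ball_inv a'.
Proof.
move=> e; have PE v : Pl n ST a' v = Pl n ST a v by rewrite /Pl !e.
have hE u v : hits n ST a' u v = hits n ST a u v by rewrite /hits PE e.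
case=> h1 h2 h3 h4 h5; split; rewrite ?e //.
- by move=> v /h2; rewrite /stored PE !e.
- by move=> u; rewrite h4; apply: eq_count => v; rewrite hE.
Qed.

Lemma hit_all_wp (x : nat) r a tau : r rX = x -> r rNV = size nvl -> r rN = n -> r rST = ST ->
  x < n -> (forall i, i < size nvl -> a aNV i = nth 0 nvl i) -> ball_inv a ->
  wp w hit_all (fun r' a' t => [/\ t <= tau + size nvl + count (hits n ST a x) nvl * alp, ball_inv a' &
    forall v : nat, v \in nvl -> a' aHT v = if x \in Pl n ST a v then 0 else a aHT v]) r a tau.
Proof.
move=> rx rnv rn rst xn nv inv; have W3 := word_small bigW; have WI := word_idx bigW.
rewrite /hit_all.
apply: (@wp_for _ _ _ (size nvl) _ (fun i r' a' t =>
  [/\ t <= tau + i + count (hits n ST a x) (take i nvl) * alp, ball_inv a' &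
    forall v : nat, v \in nvl -> a' aHT v = if (v \in take i nvl) && (x \in Pl n ST a v) then 0 else a aHT v])
  (tau + size nvl + size nvl * alp)) => //.
- by apply: W3; move: snv; slia.
- by rewrite take0 /= mul0n !addn0.
- move=> i r' a' t iN [le _ _]; apply: leq_trans le _; apply: leq_add.
    by rewrite leq_add2l.
  rewrite leq_mul2r; apply/orP; right; apply: leq_trans (count_size _ _) _.
  by rewrite size_takel.
- move=> i r1 a1 t iN [le inv1 ht1] ri' F; keep F.
  have nv1 : a1 aNV i = nth 0 nvl i by rewrite (proj2 F) // nv.
  have x_nv : nth 0 nvl i \in nvl by rewrite mem_nth.
  set v := nth 0 nvl i in nv1 x_nv; have vn := nvn x_nv.
  have tk : take i.+1 nvl = rcons (take i nvl) v by rewrite (take_nth 0).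
  have vt : v \notin take i nvl.
    by have := take_uniq i.+1 unv; rewrite tk rcons_uniq => /andP[].
  have PlE u : Pl n ST a1 u = Pl n ST a u by rewrite /Pl !(proj2 F).
  have htv := ht1 v x_nv; rewrite (negPf vt) /= in htv.
  have [adj1 st1 fr1 cn1 mk1] := inv1.
  have [[bok1 in1] h01 h1] := st1 v x_nv.
  set P := Pl n ST a1 v in bok1 in1 h1.
  have hb : a1 aHT v = (a1 aHT v != 0) by move: h01; case: (a1 aHT v) => [|[]].
  have inx : a1 aIN (v * ST + x) = (x \in P) by rewrite in1.
  have cntE : count (hits n ST a x) (take i.+1 nvl) = count (hits n ST a x) (take i nvl) + hits n ST a x v.
    by rewrite tk -cats1 count_cat /= addn0.
  have hE : hits n ST a x v = (a1 aHT v != 0) && (x \in P) by rewrite /hits -PlE -htv.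
  have htS u : u != v -> (u \in take i.+1 nvl) = (u \in take i nvl).
    by move=> uv; rewrite tk mem_rcons inE (negPf uv).
  run; apply: (@wp_ifb _ _ _ _ ((a1 aHT v != 0) && (x \in P))).
    by apply: eval_and => // _; ev.
  + move=> /andP[hv xP].
    have [[_ uP Pn] [_ _ sP _ _]] := bok1.
    have sPn : size P <= n by apply: sizeq_n => // u /Pn[].
    have sPE : size P = a1 aPS v by rewrite size_mkseq.
    run; freeze r2 a2 Er Ea.
    have F2 : forall t, t != aHT -> a2 t = a1 t by move=> t' ht'; rewrite Ea updN.
    have htE2 : a2 aHT = upd (a1 aHT) v 0 by rewrite Ea; su.
    have r2v : r2 rW = v by rewrite Er; su.
    have r2p : r2 rP = size P by rewrite Er sPE; su.
    apply: (@wp_for _ _ _ (size P) _ (fun j r' a' t' => [/\ t' = t.+1 + j,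
      forall t, t != aCNT -> a' t = a2 t &
      forall u, a' aCNT u = a1 aCNT u - (u \in take j P)]) (t.+1 + size P)) => //.
    * by apply: W3; move: sPn; slia.
    * by split; rewrite ?addn0 // take0 => u; rewrite subn0 F2.
    * by move=> j r' a' t' jP [-> _ _]; rewrite leq_add2l.
    * move=> j r3 a3 t3 jP [-> e3 c3] rj' F3; keep F3.
      have yE : a3 aAD ((n + v) * ST + j) = nth 0 P j.
        by rewrite e3 // F2 // nth_mkseq // -sPE.
      have yP : nth 0 P j \in P by rewrite mem_nth.
      set y := nth 0 P j in yE yP; have [yn _] := Pn _ yP.
      have tkj : take j.+1 P = rcons (take j P) y by rewrite (take_nth 0).
      have yt : y \notin take j P.
        by have := take_uniq j.+1 uP; rewrite tkj rcons_uniq => /andP[].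
      have cy : a3 aCNT y < 2 ^ w.
        apply: W3; rewrite c3; apply: leq_trans (leq_subr _ _) _; rewrite cn1.
        by apply: leq_trans (count_size _ _) _; move: snv; slia.
      have j3 : j <= 3 * ST by move: jP sPn; slia.
      run; su; split; first by rewrite addnS.
        by move=> t' nt; rewrite updN // e3.
      move=> u; rewrite tkj mem_rcons inE /upd.
      by have [->|yu] := eqVneq u y; rewrite c3 // (negPf yt) subn0.
    * move=> r3 a3 t3 [-> e3 c3] F3; rewrite take_size in c3.
      have htE3 : a3 aHT = upd (a1 aHT) v 0 by rewrite e3.
      have E3 t' : t' != aHT -> t' != aCNT -> a3 t' = a1 t' by move=> ? ?; rewrite e3 // F2.
      have P3 u : Pl n ST a3 u = Pl n ST a1 u by rewrite /Pl !E3.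
      split.
      - rewrite cntE hE hv xP mulnDl mul1n; move: le sP; slia.
      - split; rewrite ?(E3 aDG) ?(E3 aAD) ?(E3 aMK) //.
        + move=> u unv'; have [s1 s2 s3] := st1 u unv'; split.
          * by rewrite /stored P3 (E3 aDG) // (E3 aIN).
          * by rewrite htE3 /upd; case: eqP.
          * by rewrite htE3 P3 /upd; case: (u =P v).
        + move=> u; rewrite c3 cn1.
          rewrite (@count_drop nvl v _ (hits n ST a3 u)) //.
          * by rewrite /hits hv -/P /= addnK.
          * by move=> z zv; rewrite /hits htE3 updN // P3.
          * by rewrite /hits htE3 updS.
      - move=> u unv'; rewrite htE3; have [->|uv] := eqVneq u v.
          by rewrite updS tk mem_rcons mem_head -PlE xP.
        by rewrite updN // htS // ht1.
  + rewrite -hE => nh; run; split=> //.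
    * by rewrite cntE (negPf nh) addn0; move: le; slia.
    * move=> u unv'; have [->|uv] := eqVneq u v; last by rewrite htS // ht1.
      rewrite htv tk mem_rcons mem_head /=; case: ifP => // xPu.
      by move: nh; rewrite hE /P PlE xPu andbT htv negbK => /eqP.
- move=> r1 a1 t [le inv1 ht1] _; rewrite take_size in le ht1; split=> //.
  by move=> v vnv; rewrite ht1 // vnv.
Qed.
End Greedy.

Lemma sum_nat_count (s : seq nat) (P : pred nat) : \sum_(v <- s) (P v : nat) = count P s.
Proof. by elim: s => [|v s IH]; rewrite ?big_nil // big_cons /= IH. Qed.

Section Greedy.
Variables (n ST w alp J R : nat) (nb : nat -> seq nat) (nvl : seq nat).
Hypothesis w0 : 0 < w.
Hypothesis bigW : (ST + 10) ^ 3 < 2 ^ w.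
Hypothesis nST : n < ST.
Hypothesis JST : J <= ST.
Hypothesis J0 : 0 < J.
Hypothesis nJ : n <= 2 ^ J.
Hypothesis Esym : symmetric (edge nb).
Hypothesis Eirr : irreflexive (edge nb).
Hypothesis nb_n : forall u y : nat, u < n -> y \in nb u -> y < n.
Hypothesis nb_ST : forall u, u < n -> size (nb u) < ST.
Hypothesis alp0 : 0 < alp.
Hypothesis unv : uniq nvl.
Hypothesis nvn : forall u : nat, u \in nvl -> u < n.
Hypothesis nvP : forall u : nat, (u \in nvl) = (0 < size (nb u)).
Let M := volume nb nvl.
Hypothesis roundR : forall t, M ^ t <= size nvl * (M - alp) ^ t -> t <= R.

Let snv : size nvl <= n. Proof. exact: sizeq_n. Qed.

Let unhit (a : nat -> nat -> nat) v := a aHT v != 0.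

(** Count pairs of an unhit ball and a vertex in it, weighted by the degree of the vertex. Each ball
    contributes at least [alp], and each vertex at most [best] times its degree. *)
Lemma greedy_gain a best : ball_inv n ST alp nb nvl a ->
  (forall u : nat, u \in nvl -> a aCNT u <= best) ->
  alp * count (unhit a) nvl <= best * M.
Proof.
move=> [adj st fr cn mk] le.
apply: (@leq_trans (\sum_(v <- nvl) \sum_(u <- nvl) hits n ST a u v * size (nb u))); last first.
  rewrite exchange_big /= /M /volume big_distrr /= big_seq [leqRHS]big_seq.
  apply: leq_sum => u /le; rewrite cn -sum_nat_count => h.
  by rewrite -big_distrl /= leq_mul2r h orbT.
rewrite -sum_nat_count big_distrr /= big_seq [leqRHS]big_seq; apply: leq_sum => v vnv.
have [[[[bs uP Pn] [_ vol _ _ _]] _] _ hb] := st v vnv.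
rewrite /hits /unhit; have [hv|_] := boolP (a aHT v != 0); last by rewrite muln0.
rewrite muln1; apply: leq_trans (vol (hb hv)) _.
apply: (@leq_trans (\sum_(u <- [seq u <- nvl | u \in Pl n ST a v]) size (nb u))).
  by apply: uniq_sum_le => // u uP'; rewrite mem_filter uP' nvP; case: (Pn u uP').
rewrite big_filter [leqRHS](bigID (fun u => u \in Pl n ST a v)) /= -[leqLHS]addn0 leq_add //.
by apply: leq_sum => u ->; rewrite mul1n.
Qed.

(** A zero flag means crossed off only for heavy balls; the other balls have it from the start. *)
Definition explored (a : nat -> nat -> nat) := forall v : nat, v \in nvl ->
  a aDG (n + v) < size (Pl n ST a v) -> a aHT v = 0 ->
  exists2 z : nat, z \in Pl n ST a v & complete_for nb predT z (a aEST).

Lemma complete_mono al x est est' : (forall z v, le0 (est z) v -> le0 (est' z) v) ->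
  complete_for nb al x est -> complete_for nb al x est'.
Proof. by move=> H h s t i0 dl h1 h2 h3 h4 h5; apply: H; apply: (h s t i0 dl). Qed.

Lemma greedy_wp r a tau : r rNV = size nvl -> r rN = n -> r rST = ST -> r rJ = J ->
  (forall i, i < size nvl -> a aNV i = nth 0 nvl i) -> ball_inv n ST alp nb nvl a ->
  explored a -> esound nb (a aEST) ->
  wp w greedy (fun r' a' t =>
    [/\ t <= tau + size nvl + R.+1 * (2 * size nvl + 2 * M * (4 * J + 3) + 1) + size nvl * alp,
        ball_inv n ST alp nb nvl a', esound nb (a' aEST) &
        forall v : nat, v \in nvl -> a' aDG (n + v) < size (Pl n ST a' v) ->
          exists2 z : nat, z \in Pl n ST a' v & complete_for nb predT z (a' aEST)]) r a tau.
Proof.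
move=> rnv rn rst rj nv inv0 ex0 es0.
have W3 := word_small bigW.
rewrite /greedy; apply: wp_seq.
apply: wp_conseq (wp_frame (@scan_best_wp n ST w alp J nvl w0 bigW nST JST J0 alp0 unv nvn r a tau rnv nv)) _.
move=> r0 a0 t0 [[-> [best [rb le mx]]] F0]; keep F0.
set cost := 2 * size nvl + 2 * M * (4 * J + 3) + 1.
have F0' := proj2 F0.
(* After [k] rounds at most [size nvl * (1 - alp / M) ^ k] balls are unhit, stated without division.
   The term [count * alp] is a credit: crossing off a ball costs at most [alp], prepaid by
   [size nvl * alp]. *)
apply: (@wp_whilef _ (fun r' a' t => exists k best, [/\ r' rBEST = best,
    forall u : nat, u \in nvl -> a' aCNT u <= best &
    best = 0 \/ (r' rBU \in nvl /\ a' aCNT (r' rBU) = best)] /\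
  [/\ count (unhit a') nvl * M ^ k <= size nvl * (M - alp) ^ k, k <= R.+1,
      t + count (unhit a') nvl * alp <= tau + size nvl + k * cost + size nvl * alp &
      [/\ ball_inv n ST alp nb nvl a', explored a' & esound nb (a' aEST)]])
   (tau + size nvl + R.+1 * cost + size nvl * alp)).
- exists 0, best; split; first by split=> //; rewrite ?F0'.
  have PE u : Pl n ST a0 u = Pl n ST a u by rewrite /Pl !F0'.
  split=> //.
  + by rewrite !expn0 !muln1 count_size.
  + by rewrite mul0n addn0 leq_add2l leq_mul2r count_size orbT.
  + split; [|by move=> v; rewrite PE !F0' //; apply: ex0|by rewrite F0'].
    by apply: eq_ball_inv inv0 => t _; rewrite F0'.
- move=> r1 a1 t [k [b [_ [_ kR le' _]]]]; apply: leq_trans (leq_addr _ _) (leq_trans le' _).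
  by rewrite leq_add2r leq_add2l leq_mul2r kR orbT.
- move=> r1 a1 t [k [b [[rb1 le1 mx1] [cR kR tE [inv1 ex1 es1]]]]] F; keep F.
  rewrite (@eval_reg _ _ _ _ b) // => b0.
  have nv1 i : i < size nvl -> a1 aNV i = nth 0 nvl i by move=> h; rewrite (proj2 F) // F0' // nv.
  case: mx1 => [b00|[znv zb]]; first by rewrite b00 in b0.
  have zn := nvn znv; have [adj1 st1 fr1 cn1 mk1] := inv1.
  set z := r1 rBU in znv zb zn.
  have gain := greedy_gain inv1 le1.
  have cb : b <= count (unhit a1) nvl.
    by rewrite -zb cn1; apply: sub_count => v /andP[].
  have M0 : 0 < M.
    have : size (nb z) <= M.
      have := @uniq_sum_le [:: z] nvl (fun u => size (nb u)) isT.
      by rewrite big_seq1; apply=> u; rewrite inE => /eqP ->.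
    by apply: leq_trans; rewrite -nvP.
  have c0 : 0 < count (unhit a1) nvl by apply: leq_trans cb; rewrite lt0n.
  (* A round starts only while an unhit ball remains; then [roundR] applies to the rounds already
     completed, and this one makes [R.+1]. *)
  have kR' : k <= R.
    by apply: roundR; apply: leq_trans cR; rewrite leq_pmull.
  run; freeze r2 a2 Er Ea; subst a2.
  have r2x : r2 rX = z by rewrite Er; su.
  have r2t : r2 rTAG = 0 by rewrite Er; su.
  have mk : forall y, predT y = ~~ (a1 aMK y < 0) by [].
  apply: wp_conseq (wp_frame (@search_wp n ST w J nb w0 bigW nST JST J0 nJ Esym Eirr nb_n nb_ST
    predT 0 z r2 a1 _ r2x r2t _ _ zn isT adj1 mk es1)) _ => //.
  move=> r3 a3 t3 [[q [[uq qP t3E] [es3 mo3 cp3]]] F3]; keep F3.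
  have F3' := proj2 F3.
  have nv3 i : i < size nvl -> a3 aNV i = nth 0 nvl i by move=> h; rewrite F3' // nv1.
  have inv3 : ball_inv n ST alp nb nvl a3.
    apply: eq_ball_inv inv1 => t'; rewrite !inE.
    by do ![case/predU1P=> [->|]; first by rewrite F3'] => /eqP ->; rewrite F3'.
  have PE3 u : Pl n ST a3 u = Pl n ST a1 u by rewrite /Pl !F3'.
  have qnv : {subset q <= nvl}.
    by move=> u /qP[_ _ [->|]] //; rewrite nvP.
  have volq : volume nb q <= M by apply: uniq_sum_le.
  have sq : size q <= M.
    by apply: leq_trans volq; apply: size_le_volume => u /qnv; rewrite nvP.
  apply: wp_seq.
  apply: wp_conseq (wp_frame (@hit_all_wp n ST w alp J nb nvl w0 bigW nST JST J0 alp0 unv nvn z r3 a3 _ _ _ _ _ zn nv3 inv3)) _ => //.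
  move=> r4 a4 t4 [[t4E inv4 ht4] F4]; keep F4; have F4' := proj2 F4.
  have PE4 u : Pl n ST a4 u = Pl n ST a3 u by rewrite /Pl !F4'.
  have nv4 i : i < size nvl -> a4 aNV i = nth 0 nvl i by move=> h; rewrite F4' // nv3.
  apply: wp_conseq (wp_frame (@scan_best_wp n ST w alp J nvl w0 bigW nST JST J0 alp0 unv nvn r4 a4 t4 _ nv4)) _ => //.
  move=> r5 a5 t5 [[-> [b' [rb5 le5 mx5]]] F5]; have F5' := proj2 F5.
  have PE5 u : Pl n ST a5 u = Pl n ST a1 u by rewrite -PE3 -PE4 /Pl !F5'.
  have ht5 v : v \in nvl -> a5 aHT v = if z \in Pl n ST a1 v then 0 else a1 aHT v.
    by move=> vnv; rewrite F5' // ht4 // PE3 [a3 aHT]F3'.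
  have hz : count (hits n ST a3 z) nvl = b.
    by rewrite -zb cn1; apply: eq_count => v; rewrite /hits PE3 F3'.
  have cntE : count (unhit a1) nvl = b + count (unhit a5) nvl.
    rewrite -zb cn1 -!sum_nat_count -big_split /= big_seq [RHS]big_seq.
    apply: eq_bigr => v vnv; rewrite /unhit /hits ht5 //.
    by case: (z \in _); case: (a1 aHT v != 0).
  exists k.+1, b'; split; first by split=> //; rewrite ?F5'.
  split=> //.
  + rewrite expnS mulnCA expnS [leqRHS]mulnCA.
    have g2 : M * count (unhit a5) nvl <= (M - alp) * count (unhit a1) nvl.
      have e : M * count (unhit a5) nvl + b * M = M * count (unhit a1) nvl.
        by rewrite cntE mulnDr addnC mulnC.
      by rewrite mulnBl -e; move: gain; slia.
    by rewrite mulnA; apply: leq_trans (leq_mul g2 (leqnn _)) _; rewrite -mulnA leq_mul2l cR orbT.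
  + have c1 : (size q + volume nb q) * (4 * J + 3) <= 2 * M * (4 * J + 3).
      by rewrite leq_mul2r; apply/orP; right; move: sq volq; slia.
    move: t4E tE; rewrite hz cntE mulSn mulnDl /cost.
    move: c1 t3E; move: ((size q + _) * _) (2 * M * _) (k * _) => X Y Z.
    by move: (b * alp) (count _ _ * alp) => U V; slia.
  + split.
    * by apply: eq_ball_inv inv4 => t' _; rewrite F5'.
    * move=> v vnv; rewrite PE5 ht5 //.
      have -> : a5 aDG (n + v) = a1 aDG (n + v) by rewrite F5' // F4' // F3'.
      have e5 : a5 aEST = a3 aEST by rewrite F5' // F4'.
      rewrite e5; case: ifP => [zP _ _|zP hb hv]; first by exists z.
      have [z' z'P cz'] := ex1 v vnv hb hv.
      by exists z' => //; apply: complete_mono mo3 cz'.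
    * by rewrite F5' // F4'.
- move=> r1 a1 t [k [b [[rb1 le1 mx1] [cR kR tE [inv1 ex1 es1]]]]] F.
  rewrite (@eval_reg _ _ _ _ b) // => b0; rewrite {}b0 in le1 mx1.
  split=> //.
  + apply: leq_trans (leq_addr _ _) (leq_trans tE _).
    by rewrite leq_add2r leq_add2l leq_mul2r kR orbT.
  + move=> v vnv hb; apply: ex1 => //; have [adj1 st1 fr1 cn1 mk1] := inv1.
    apply/eqP/negPn/negP => hv; have [[[[bs uP Pn] _] _] _ _] := st1 v vnv.
    (* A heavy ball is longer than its inner part, hence nonempty; left unhit, it would give its
       first vertex a positive count. *)
    have Pn0 : nth 0 (Pl n ST a1 v) 0 \in Pl n ST a1 v.
      by rewrite mem_nth // (leq_ltn_trans _ hb).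
    have [_ dz] := Pn _ Pn0; rewrite -nvP in dz; have := le1 _ dz.
    rewrite cn1 leqn0 => /eqP c0; have : has (hits n ST a1 (nth 0 (Pl n ST a1 v) 0)) nvl.
      by apply/hasP; exists v => //; rewrite /hits hv Pn0.
    by rewrite has_count c0.
Qed.
End Greedy.

(** * Local searches *)

Definition mark := for_ ri rC (Store aMK (Get aQ (Reg ri)) (Reg rTAG)).

(** An empty inner ball means that the degree of the vertex alone reaches alpha. Its ball is then
    the vertex itself, which must be a landmark, and the local search is skipped. The call of [bfs]
    follows inner balls; [search] then uses graph edges inside the marked set. *)
Definition light :=
  for_ rO rNV
    (rX <~ Get aNV (Reg rO) ;;
     If (Get aDG (Reg rN .+ Reg rX))
       (rTAG <~ Const 0 ;; rOF <~ Reg rN ;; rBUD <~ Reg rST .* Reg rST ;; rKK <~ Reg rK ;;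
        bfs ;;
        rTAG <~ Reg rO .+ Const 1 ;;
        mark ;;
        search)
       Skip).

Section Levels.
Variables (n k bud alp vol h x : nat) (nbB : nat -> seq nat) (U : seq nat) (d p : nat -> nat).
Hypothesis inv : bfs_inv n nbB predT x U h d p vol bud k.
Hypothesis k1 : 1 < k.
Hypothesis xB : x \in nbB x.

Let ball j := [seq u <- U | d u <= j].

(** A vertex of depth at most [j.+1] other than [x] lies in the row of its parent, and [x] lies in
    its own. Weights 1 bound the number of vertices; degrees as weights bound the volume at the last
    level. *)
Lemma level_sum (om : nat -> nat) j :
  (forall u : nat, u \in U -> \sum_(y <- nbB u) om y <= alp) ->
  \sum_(y <- ball j.+1) om y <= size (ball j) * alp.
Proof.
case: inv => [[L [[uU _ _ _] [dx _ _ [_ [_ par]]]] _] _ _ _ _] H.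
apply: (@leq_trans (\sum_(y <- flatten [seq nbB u | u <- ball j]) om y)).
  apply: uniq_sum_le; first exact: filter_uniq.
  move=> y; rewrite mem_filter => /andP[dy yU]; apply/flatten_mapP.
  have [->|yx] := eqVneq y x; first by exists x; rewrite // mem_filter dx (bfs_x inv).
  have [h1 h2 _ h4] := par y yU yx; exists (p y) => //.
  by rewrite mem_filter (mem_take h1) andbT -ltnS -h4.
rewrite big_flatten big_map -sum1_size big_distrl /= big_seq [leqRHS]big_seq.
by apply: leq_sum => u; rewrite mem_filter mul1n => /andP[_ /H].
Qed.

Lemma level_size j : (forall u : nat, u \in U -> size (nbB u) <= alp) ->
  size (ball j) <= alp ^ j.
Proof.
move=> H; elim: j => [|j IH].
  case: inv => [[L [[uU _ _ _] [dx _ _ [_ [_ par]]]] _] _ _ _ _].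
  apply: (@uniq_leq_size _ _ [:: x]); first exact: filter_uniq.
  move=> y; rewrite mem_filter leqn0 inE => /andP[/eqP dy yU].
  by have [//|yx] := eqVneq y x; have [_ _ _] := par y yU yx; rewrite dy.
rewrite -sum1_size expnSr; apply: leq_trans (level_sum _ _) _.
  by move=> u uU; rewrite sum1_size; apply: H.
by rewrite leq_mul2r IH orbT.
Qed.

Let depth (u : nat) : u \in U -> d u <= k.-1.
Proof.
case: inv => [[L [_ [dx _ _ [_ [_ par]]]] _] _ sc _ _] uU.
have [->|ux] := eqVneq u x; first by rewrite dx.
have [h1 _ _ ->] := par u uU ux; have [_ lt] := sc _ h1.
by rewrite -ltnS prednK // (ltn_trans _ k1).
Qed.

Lemma level_volume nb : (forall u : nat, u \in U -> volume nb (nbB u) <= alp) ->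
  (forall u : nat, u \in U -> size (nbB u) <= alp) -> volume nb U <= alp ^ k.-1.
Proof.
move=> H1 H2; have -> : U = ball k.-2.+1.
  by apply/esym/all_filterP/allP => u /depth; case: (k) k1 => [|[]].
apply: leq_trans (level_sum _ H1) _.
have -> : alp ^ k.-1 = alp ^ k.-2 * alp by rewrite -expnSr; case: (k) k1 => [|[]].
by rewrite leq_mul2r level_size // orbT.
Qed.

(** Expanded vertices have depth at most [k - 2]. The strict bound on the rows leaves one unit per
    vertex for its expansion. *)
Lemma level_time : (forall u : nat, u \in U -> size (nbB u) < alp) -> h + vol <= alp ^ k.-1.
Proof.
move=> H; case: inv => [[L [[uU _ _ _] _] _] hU sc vE _].
have sub (u : nat) : u \in take h U -> u \in ball k.-2.
  move=> ut; rewrite mem_filter (mem_take ut) andbT; have [_] := sc u ut.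
  by case: (k) k1 => [|[]].
apply: (@leq_trans (\sum_(u <- take h U) alp)).
  rewrite vE /volume -{1}(size_takel hU) -sum1_size -big_split /= big_seq [leqRHS]big_seq.
  by apply: leq_sum => u /mem_take /H; rewrite add1n.
apply: leq_trans (uniq_sum_le (t := ball k.-2) _ (take_uniq _ uU) sub) _.
have -> : alp ^ k.-1 = alp ^ k.-2 * alp by rewrite -expnSr; case: (k) k1 => [|[]].
rewrite big_const_seq count_predT iter_addn_0 mulnC leq_mul2r.
by apply/orP; right; apply: level_size => u /H /ltnW.
Qed.

(* A cycle all of whose delta-balls are stored is covered by walking around it
   from both sides in steps of length delta. *)
Lemma level_cover (nb : nat -> seq nat) s t delta : symmetric (edge nb) ->
  (h < size U -> k <= (d (nth 0 U h)).+1) ->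
  cycfun (edge nb) s t -> t 0 = x -> s <= 2 * (k - 1) * delta ->
  (forall j (y : nat) l, j <= s -> l <= delta -> walk (edge nb) (t j) y l -> y \in nbB (t j)) ->
  forall i, i <= s -> t i \in U.
Proof.
move=> Esym ex.
have cl (u y : nat) : u \in U -> d u < k - 1 -> y \in nbB u -> y \in U /\ d y <= (d u).+1.
  move=> uU du yu; have ut : u \in take h U.
    by apply: (bfs_closed inv _ uU du) => hs; rewrite leq_subLR add1n ex.
  by case: inv => _ _ /(_ u ut)[sc _] _ _; apply: sc.
have half t' : cycfun (edge nb) s t' -> t' 0 = x ->
   (forall j (y : nat) l, j <= s -> l <= delta -> walk (edge nb) (t' j) y l -> y \in nbB (t' j)) ->
   forall jj i, i <= jj * delta -> jj <= k - 1 -> i <= s -> t' i \in U /\ d (t' i) <= jj.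
  move=> ct t0 B; elim=> [|jj IH] i ij jk si.
    move: ij; rewrite mul0n leqn0 => /eqP ->; rewrite t0 (bfs_x inv).
    by case: inv => [[L [_ [-> _ _ _]] _] _ _ _ _].
  (* One search step advances [delta] positions; truncated subtraction lets the first one start at
     [t' 0]. *)
  have i1 : i - delta <= jj * delta by rewrite leq_subLR -mulSn.
  have i2 : i - delta <= s by apply: leq_trans (leq_subr _ _) si.
  have [tU td] := IH _ i1 (ltnW jk) i2.
  have wk := @walk_cycfun _ _ s t' (i - delta) i ct (introT andP (conj (leq_subr _ _) si)).
  have ld : i - (i - delta) <= delta by slia.
  have [h1 h2] := cl _ _ tU (leq_ltn_trans td jk) (B _ _ _ i2 ld wk).
  by split=> //; apply: leq_trans h2 _; rewrite ltnS.
move=> ct t0 sd B i si.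
have [le|gt] := leqP i ((k - 1) * delta).
  by case: (half t ct t0 B _ _ le (leqnn _) si).
have ct' := cycfun_rev Esym ct; have [_ ts0 _] := ct.
have := half _ ct' _ _ (k - 1) (s - i); rewrite subKn //.
case=> //; first by rewrite subn0 ts0.
- by move=> j y l js; apply: B; apply: leq_subr.
- by move: sd gt; rewrite -mulnA; slia.
- exact: leq_subr.
Qed.
End Levels.

Section Light.
Variables (n ST w alp J k : nat) (nb : nat -> seq nat) (nvl : seq nat).
Hypothesis w0 : 0 < w.
Hypothesis bigW : (ST + 10) ^ 3 < 2 ^ w.
Hypothesis nST : n < ST.
Hypothesis JST : J <= ST.
Hypothesis J0 : 0 < J.
Hypothesis nJ : n <= 2 ^ J.
Hypothesis k1 : 1 < k.
Hypothesis Esym : symmetric (edge nb).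
Hypothesis Eirr : irreflexive (edge nb).
Hypothesis nb_n : forall u y : nat, u < n -> y \in nb u -> y < n.
Hypothesis nb_ST : forall u, u < n -> size (nb u) < ST.
Hypothesis unv : uniq nvl.
Hypothesis nvn : forall u : nat, u \in nvl -> u < n.
Hypothesis nvP : forall u : nat, (u \in nvl) = (0 < size (nb u)).

Definition inner (a : nat -> nat -> nat) u := mkseq (fun j => a aAD ((n + u) * ST + j)) (a aDG (n + u)).

Definition light_done (a : nat -> nat -> nat) v (est : nat -> nat) := forall s t delta,
  cycfun (edge nb) s t -> 2 < s -> t 0 = v -> s <= 2 * (k - 1) * delta ->
  (forall j (y : nat) l, j <= s -> l <= delta -> walk (edge nb) (t j) y l -> y \in inner a (t j)) ->
  le0 (est v) s.

Definition ball_tab (a : nat -> nat -> nat) :=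
  [/\ adjrep n ST nb (a aDG) (a aAD) 0,
      forall v : nat, v \in nvl -> ball_ok n alp nb v (Pl n ST a v) (a aDG (n + v)) &
      forall v : nat, v < n -> v \notin nvl -> a aDG (n + v) = 0].

Let snv : size nvl <= n. Proof. exact: sizeq_n. Qed.

Lemma inner_take a v : ball_ok n alp nb v (Pl n ST a v) (a aDG (n + v)) ->
  inner a v = take (a aDG (n + v)) (Pl n ST a v).
Proof.
move=> [[le _ _] _]; apply: (@eq_from_nth _ 0); rewrite size_mkseq ?size_takel // => i lt.
by rewrite nth_mkseq // nth_take // nth_mkseq //; move: le; rewrite size_mkseq; apply: leq_trans.
Qed.

Lemma mark_wp (U : seq nat) tag r a tau : r rC = size U -> r rTAG = tag -> size U < 2 ^ w ->
  (forall i, i < size U -> a aQ i = nth 0 U i) ->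
  wp w mark (fun r' a' t => t = tau + size U /\
    forall y : nat, a' aMK y = if y \in U then tag else a aMK y) r a tau.
Proof.
move=> rc rt sW aq; rewrite /mark.
apply: (@wp_for _ _ _ (size U) _ (fun i r' a' t => t = tau + i /\
   forall y : nat, a' aMK y = if y \in take i U then tag else a aMK y) (tau + size U)) => //.
- by rewrite addn0 take0.
- by move=> i r' a' t iN [-> _]; rewrite leq_add2l.
- move=> i r1 a1 t iN [-> mk] ri' F; keep F.
  have aq1 : a1 aQ i = nth 0 U i by rewrite (proj2 F) // aq.
  run; su; rewrite addnS; split=> // y; rewrite (take_nth 0) // mem_rcons inE.
  by have [->|yu] := eqVneq y (nth 0 U i); rewrite ?updS // updN.
- by move=> r1 a1 t [-> mk] _; rewrite take_size in mk.
Qed.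

Lemma light_wp r a tau : r rNV = size nvl -> r rN = n -> r rST = ST -> r rJ = J -> r rK = k ->
  (forall i, i < size nvl -> a aNV i = nth 0 nvl i) -> ball_tab a -> (forall y, a aMK y = 0) ->
  esound nb (a aEST) ->
  wp w light (fun r' a' t =>
    [/\ t <= tau + size nvl * (2 * alp ^ k.-1 + 2 * alp ^ k.-1 * (4 * J + 3) + 1),
        esound nb (a' aEST), forall z v, le0 (a aEST z) v -> le0 (a' aEST z) v &
        forall v : nat, v \in nvl -> 0 < a aDG (n + v) -> light_done a v (a' aEST)]) r a tau.
Proof.
move=> rnv rn rst rj rk nv tab mk0 es0.
have W3 := word_small bigW; have WI := word_idx bigW.
have WS : ST * ST < 2 ^ w by apply: leq_ltn_trans (leq_addr 0 _) (WI ST 0 _ _); slia.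
have [adj bok fr] := tab.
set X := alp ^ k.-1; set C := 2 * X + 2 * X * (4 * J + 3) + 1.
have inP (v : nat) : v \in nvl -> [/\ uniq (inner a v), {subset inner a v <= nvl},
    volume nb (inner a v) < alp & 0 < a aDG (n + v) -> v \in inner a v].
  move=> vnv; have bo := bok v vnv; rewrite inner_take //; have [[b1 b2 b3] [b4 _ _ b5 _]] := bo.
  split=> //; first exact: take_uniq.
  by move=> u /mem_take /b3[]; rewrite nvP.
have in0 (v : nat) : v < n -> v \notin nvl -> inner a v = [::].
  by move=> vn vnv; rewrite /inner fr.
have inN (v y : nat) : v < n -> y \in inner a v -> y \in nvl.
  move=> vn; have [vnv|vnv] := boolP (v \in nvl); last by rewrite in0.
  by case: (inP v vnv) => _ sub _ _; apply: sub.
rewrite /light.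
apply: (@wp_for _ _ _ (size nvl) _ (fun i r' a' t => [/\ t <= tau + i * C,
   esound nb (a' aEST), forall z v, le0 (a aEST z) v -> le0 (a' aEST z) v &
   (forall y, a' aMK y <= i) /\
   forall v : nat, v \in take i nvl -> 0 < a aDG (n + v) -> light_done a v (a' aEST)])
   (tau + size nvl * C)) => //.
- by apply: W3; move: snv; slia.
- by rewrite mul0n addn0 take0; split=> //; split=> // y; rewrite mk0.
- move=> i r' a' t iN [le _ _ _]; apply: leq_trans le _.
  by rewrite leq_add2l leq_mul2r iN orbT.
- move=> i r1 a1 t iN [le es1 mo1 [mk1 ld1]] ri' F; keep F; have F' := proj2 F.
  have nv1 : a1 aNV i = nth 0 nvl i by rewrite F' // nv.
  have x_nv : nth 0 nvl i \in nvl by rewrite mem_nth.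
  set x := nth 0 nvl i in nv1 x_nv; have xn := nvn x_nv.
  have tk : take i.+1 nvl = rcons (take i nvl) x by rewrite (take_nth 0).
  have dgx : a1 aDG (n + x) = a aDG (n + x) by rewrite F'.
  have C1 : t.+1 <= tau + i.+1 * C by rewrite mulSn; move: le; rewrite {2}/C; slia.
  run; apply: (@wp_if _ _ _ _ (a aDG (n + x))); first by ev.
  + move=> dg0; rewrite -lt0n in dg0.
    run; freeze r2 a2 Er Ea; subst a2.
    have [r2b r2k r2x] : [/\ r2 rBUD = ST * ST, r2 rKK = k & r2 rX = x] by rewrite Er; su.
    have nbB_n (u y : nat) : u < n -> y \in inner a u -> y < n.
      by move=> un /(inN _ _ un) /nvn.
    have nbB_ST (u : nat) : u < n -> size (inner a u) < ST.
      move=> un; apply: leq_ltn_trans nST; have [unv'|unv'] := boolP (u \in nvl); last by rewrite in0.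
      have [ui si _ _] := inP u unv'; apply: sizeq_n => // y /si; exact: nvn.
    have adjB : adjrep n ST (inner a) (a1 aDG) (a1 aAD) n.
      move=> u un; rewrite !F' // size_mkseq; split=> // j js.
      by rewrite nth_mkseq.
    have mkB : forall y, predT y = ~~ (a1 aMK y < 0) by [].
    apply: wp_conseq (wp_frame (@bfs_wp n ST w (inner a) predT x w0 bigW nST nbB_n nbB_ST (ST * ST) k n 0
      r2 a1 t.+1 _ _ _ _ _ _ xn (leqnn n) adjB mkB)) _ => //; try by rewrite Er; su.
    move=> r3 a3 t3 [[U [h [vol [[r3h r3v qu ->] bi ex]]]] F3]; keep F3; have F3' := proj2 F3.
    have bi' := bi; case: bi' => [[L [[uU U0 U_gt0 Un] [dx px so [di [dL par]]]] _] hU sc vE _].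
    have sU := sizeq_n uU Un; have [rc qi qp] := qu.
    have [_ _ _ xB0] := inP x x_nv; have xB := xB0 dg0.
    have Unv : {subset U <= nvl}.
      move=> u uU'; have [->//|ux] := eqVneq u x; have [h1 h2 _ _] := par u uU' ux.
      by apply: inN h2; apply: Un; apply: mem_take h1.
    have volU (u : nat) : u \in U -> volume nb (inner a u) < alp.
      by move=> /Unv /inP[].
    have szU (u : nat) : u \in U -> size (inner a u) < alp.
      move=> uU'; apply: leq_ltn_trans (volU u uU'); apply: size_le_volume => y yi.
      by rewrite -nvP; case: (inP u (Unv _ uU')) => _ sub _ _; apply: sub.
    (* The budget [ST * ST] is out of reach, so only the depth limit can stop this search early. *)
    have exU : h < size U -> k <= (a3 aD (nth 0 U h)).+1.
      move=> hs; case: ex => // [he|he]; first by rewrite he ltnn in hs.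
      exfalso; have := @volume_le n ST (inner a) nbB_ST (take h.+1 U) (fun u ut => Un u (mem_take ut)).
      rewrite size_takel // (take_nth 0) // /volume -cats1 big_cat big_seq1 -/(volume _ (take h U)) -vE.
      move=> le'; have : ST * ST <= n * ST.
        by apply: leq_trans he (leq_trans le' _); rewrite leq_mul2r (leq_trans hs sU) orbT.
      by rewrite leq_mul2r; move: nST sU hs; slia.
    have vU : volume nb U <= X.
      by apply: (level_volume bi k1 xB) => u /[dup] /volU /ltnW ? /szU /ltnW.
    have tU : h + vol <= X by apply: (level_time bi k1 xB szU).
    have sUX : size U <= X.
      by apply: leq_trans vU; apply: size_le_volume => u /Unv; rewrite nvP.
    have iW : i + 1 < 2 ^ w by apply: W3; move: iN snv; slia.
    run.
    freeze r4 a4 Er4 Ea4; subst a4.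
    have r4t : r4 rTAG = i.+1 by rewrite Er4; su; rewrite addn1.
    have r4c : r4 rC = size U by rewrite Er4; su.
    have sUW : size U < 2 ^ w by apply: W3; move: sU; slia.
    apply: wp_conseq (wp_frame (@mark_wp U i.+1 r4 a3 _ r4c r4t sUW qi)) _.
    move=> r5 a5 t5 [[-> mk5] F5]; keep F5; have F5' := proj2 F5.
    (* Earlier marks are at most [i], so exactly the vertices of [U] pass the test with tag
       [i.+1]. *)
    have mkE y : [pred y | y \in U] y = ~~ (a5 aMK y < i.+1).
      rewrite mk5 /=; case: (y \in U); first by rewrite ltnn.
      by rewrite F3' // ltnS mk1.
    have adj5 : adjrep n ST nb (a5 aDG) (a5 aAD) 0 by rewrite !F5' // !F3' // !F'.
    have es5 : esound nb (a5 aEST) by rewrite F5' // F3'.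
    have xU : x \in U by rewrite -U0 mem_nth.
    apply: wp_conseq (wp_frame (@search_wp n ST w J nb w0 bigW nST JST J0 nJ Esym Eirr nb_n nb_ST
      [pred y | y \in U] i.+1 x r5 a5 _ _ _ _ _ xn xU adj5 mkE es5)) _ => //.
    move=> r6 a6 t6 [[q [[uq qP t6E] [es6 mo6 cp6]]] F6]; have F6' := proj2 F6.
    have vq : volume nb q <= X.
      by apply: leq_trans vU; apply: uniq_sum_le => // u /qP[].
    have sq : size q <= X.
      by apply: leq_trans vq; apply: size_le_volume => u /qP[_ /Unv]; rewrite nvP.
    split=> //.
    * apply: leq_trans t6E _; rewrite [i.+1 * C]mulSn.
      have : (size q + volume nb q) * (4 * J + 3) <= 2 * X * (4 * J + 3).
        by rewrite leq_mul2r; apply/orP; right; move: sq vq; slia.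
      have CE : C = 2 * X + 2 * X * (4 * J + 3) + 1 by [].
      move: le tU sUX CE; move: ((size q + _) * _) (2 * X * _) (i * C) => Y Z IC; generalize C => C' {C1}; clear; slia.
    * by move=> z v /mo1 lz; apply: mo6; rewrite F5' // F3'.
    * split=> [y|v].
        rewrite F6' // mk5; case: (y \in U) => //; rewrite F3' //.
        exact: leq_trans (mk1 y) (leqnSn i).
      rewrite tk mem_rcons inE => /predU1P[->|vt] dv; last first.
        move=> s tt dl h1 h2 h3 h4 h5; apply: mo6; rewrite F5' // F3' //.
        exact: (ld1 v vt dv s tt dl h1 h2 h3 h4 h5).
      move=> s tt dl h1 h2 h3 h4 h5.
      have cov := level_cover bi k1 Esym exU h1 h3 h4 h5.
      (* The search starts on the cycle, at [tt 0] itself; distance 0 leaves no error. *)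
      have := cp6 s tt 0 0 h1 h2 cov (leq0n _).
      by rewrite muln0 addn0 h3; apply; apply: walk0.
  + move=> dg0; run; split=> //; split=> [y|v].
      exact: leq_trans (mk1 y) (leqnSn i).
    by rewrite tk mem_rcons inE => /predU1P[->|vt]; [rewrite dg0|apply: ld1].
- by move=> r1 a1 t [le es1 mo1 [mk1 ld1]] _; rewrite take_size in ld1.
Qed.
End Light.

(** * The algorithm *)

Definition main :=
  rST <~ Reg rN .+ Reg rM .+ Reg rM ;;
  build_graph ;; log_setup ;; alpha_setup ;; balls ;; greedy ;; light.

(** The first two terms of the binomial expansion: Bernoulli's inequality in homogeneous form,
    without division. *)
Lemma bernoulli x y q : x ^ q.+1 + q.+1 * y * x ^ q <= (x + y) ^ q.+1.
Proof.
elim: q => [|q IH]; first by rewrite !expn1 expn0 mul1n muln1.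
rewrite [leqRHS]expnS; apply: leq_trans (leq_mul (leqnn _) IH).
by rewrite !(expnS x); move: (x ^ q) => X; clear IH; nia.
Qed.

(* The number of greedy rounds: M is the volume of the graph, a ball has volume
   at least al, so each round divides the number of remaining balls by M / (M - al). *)
Lemma rounds (M al N L t : nat) : 0 < al -> 0 < M -> N < 2 ^ L ->
  M ^ t <= N * (M - al) ^ t -> t <= (M %/ al).+1 * L.
Proof.
move=> al0 M0 NL; set q := (M %/ al).+1; have [//|lt] := leqP t (q * L).
have [Ma|aM] := posnP (M - al).
  have t0 : 0 < t by apply: leq_ltn_trans lt.
  by rewrite Ma exp0n // muln0 leqn0 expn_eq0 (gtn_eqF M0).
have qM : M <= q * al by apply/ltnW; rewrite ltn_ceil.
(* By [bernoulli], since [q * al >= M >= M - al]: every [q] rounds at least halve the bound. *)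
have B : 2 * (M - al) ^ q <= M ^ q.
  have := bernoulli (M - al) al (M %/ al); rewrite subnK; last by move: aM; clear; lia.
  apply: leq_trans; rewrite -/q mul2n -addnn leq_add2l /q expnS leq_mul2r.
  by apply/orP; right; apply: leq_trans (leq_subr _ _) qM.
have mono x y e : x <= y -> x ^ e <= y ^ e by case: e => // e; rewrite leq_exp2r.
(* More than [q * L] rounds contain [L] halvings; with at least one ball left this would force
   [2 ^ L <= N]. *)
have D : 2 ^ L * (M - al) ^ t <= M ^ t.
  rewrite -(subnKC (ltnW lt)) [_ ^ (_ + _)]expnD [M ^ (_ + _)]expnD [_ ^ (q * L)]expnM.
  by rewrite [M ^ (q * L)]expnM mulnA -expnMn leq_mul ?mono // leq_subr.
move/(leq_trans D); rewrite leq_pmul2r ?expn_gt0 ?aM // leqNgt NL.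
by [].
Qed.

Lemma volume_nbs l (nvl : seq nat) : uniq nvl -> (forall h, h \in l -> h.1 \in nvl) ->
  volume (nbs l) nvl = size l.
Proof.
move=> un; rewrite /volume; elim: l => [|h l IH] H.
  by rewrite big1_seq // => u _; rewrite /nbs.
under eq_bigr => u _ do rewrite /nbs /=.
transitivity (\sum_(u <- nvl) ((h.1 == u) + size (nbs l u))).
  by apply: eq_bigr => u _; case: eqP => /= _; rewrite /nbs ?size_map.
rewrite big_split /= IH => [|g gl]; last by apply: H; rewrite inE gl orbT.
rewrite sum_nat_count (eq_count (a2 := pred1 h.1)) => [|u]; last by rewrite /= eq_sym.
by rewrite count_uniq_mem // H ?mem_head.
Qed.

Lemma ceil_divn_mul s y : 0 < y -> s <= y * ceil_divn s y.
Proof.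
move=> y0; rewrite /ceil_divn; have := divn_eq (s + y.-1) y; have := @ltn_pmod (s + y.-1) y y0.
by rewrite [_ * y]mulnC; move: ((_ + _) %% _) (y * _) => c d; move: y0; clear; lia.
Qed.

Section Main.
Variables (n k w : nat) (es : seq (nat * nat)).
Let m := size es.
Let ST := n + m + m.
Let nb := nbs (halves es).
Hypothesis w0 : 0 < w.
Hypothesis bigW : (ST + 10) ^ 3 < 2 ^ w.
Hypothesis n1 : 1 < n.
Hypothesis m0 : 0 < m.
Hypothesis mn : m <= n ^ 2.
Hypothesis k1 : 1 < k.
Hypothesis kW : k < 2 ^ w.
Hypothesis esn : forall e, e \in es -> [/\ e.1 < n, e.2 < n & e.1 != e.2].

(** Quantified over all cycles through [v]: minimality enters only in the comparison with [SC]. *)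
Definition approx (est : nat -> nat) := forall v s t, v < n -> cycfun (edge nb) s t -> t 0 = v -> 2 < s ->
  le0 (est v) (s + 2 * ceil_divn s (2 * (k - 1))).

Let Esym : symmetric (edge nb).
Proof. by move=> u y; rewrite /edge !mem_nbs !mem_halves orbC. Qed.

Let Eirr : irreflexive (edge nb).
Proof.
by move=> u; rewrite /edge mem_nbs mem_halves orbb; apply/negP => /esn[_ _]; rewrite eqxx.
Qed.

Let nb_n (u y : nat) : u < n -> y \in nb u -> y < n.
Proof. by move=> _; rewrite mem_nbs mem_halves => /orP[] /esn[]. Qed.

Let nb_ST u : u < n -> size (nb u) < ST.
Proof. by move=> un; apply: leq_ltn_trans (size_nbs _ _) _; rewrite size_halves /ST /m; lia. Qed.

Lemma main_wp r a tau : r rN = n -> r rM = m -> r rK = k -> r rNV = 0 ->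
  (forall i, i < m -> a 0 i = (nth (0, 0) es i).1 /\ a 1 i = (nth (0, 0) es i).2) ->
  (forall t i, 1 < t -> a t i = 0) ->
  wp w main (fun r' a' t => [/\ esound nb (a' aEST), approx (a' aEST) &
    exists J al N R, [/\ 2 ^ J.-1 < n, 0 < al <= m, al = 1 \/ n * al ^ k <= m ^ 2, m ^ 2 < n * al.+1 ^ k &
      [/\ N <= n, N <= 2 * m, R = (2 * m %/ al).+1 * J.+1 &
       t <= tau + m + J + al * (4 * J).+2 + N * (3 * al + 1) +
         (N + R.+1 * (2 * N + 2 * (2 * m) * (4 * J + 3) + 1) + N * al) +
         N * (2 * al ^ k.-1 + 2 * al ^ k.-1 * (4 * J + 3) + 1)]]]) r a tau.
Proof.
move=> rn rm rk rnv aes a0.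
have W3 := word_small bigW; have WI := word_idx bigW.
have nST : n < ST by rewrite /ST; move: m0; slia.
have mST : m <= ST by rewrite /ST; slia.
rewrite /main; run; try by apply: W3; rewrite /ST; slia.
freeze r1 a1 Er Ea; subst a1.
have r1s : r1 rST = ST by rewrite Er; su.
have esn' e : e \in es -> e.1 < n /\ e.2 < n by move=> /esn[].
have s2 : 2 * size es < ST by rewrite /ST /m; move: n1; slia.
apply: wp_conseq (wp_frame (@build_graph_wp n ST w w0 bigW nST es r1 a tau r1s _ _ s2 esn' aes _)) _ => //.
  by move=> i; rewrite a0.
move=> r2 a2 t2 [[-> [nvl [adj fr rnv' unv [nv nvP]]]] F2]; keep F2; have F2' := proj2 F2.
have nvn (u : nat) : u \in nvl -> u < n.
  rewrite nvP; case E: (nbs _ u) => [//|y s] _; have : y \in nb u by rewrite /nb E mem_head.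
  by rewrite mem_nbs mem_halves => /orP[] /esn[].
have snv : size nvl <= n by apply: sizeq_n.
have vol : volume nb nvl = 2 * m.
  rewrite volume_nbs ?size_halves // => -[u y] h; rewrite nvP /=.
  by move: h; rewrite -mem_nbs; case: (nbs _ u).
have snm : size nvl <= 2 * m by rewrite -vol; apply: size_le_volume => u; rewrite nvP.
run; apply: wp_conseq (wp_frame (@log_setup_wp n m ST w w0 bigW nST mST r2 a2 _ _ n1)) _ => //.
move=> r3 a3 t3 [[J [rJ' J0 nJ Jn le3]] F3]; keep F3; have F3' := proj2 F3.
have JST : J <= ST.
  by have := ltn_expl J.-1 (ltnSn 1); move: Jn nST; move: (2 ^ _) => X; slia.
(* From [m <= n ^ 2] and [n <= 2 ^ J], [m ^ 2 <= 2 ^ (4 * J)]. *)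
have mD : m ^ 2 < 2 ^ (4 * J).+1.
  apply: (@leq_ltn_trans (2 ^ (4 * J))); last by rewrite ltn_exp2l.
  rewrite -[4]/(2 * 2) -mulnA [2 * (2 * J)]mulnC expnM leq_exp2r // mulnC expnM.
  by apply: leq_trans mn _; rewrite leq_exp2r.
have n0 : 0 < n by slia.
run; apply: wp_conseq (wp_frame (@alpha_setup_wp n m k ST w (4 * J).+1 w0 bigW nST mST r3 a3 _ _ _ _ n0 m0 k1 kW mD)) _ => //.
move=> r4 a4 t4 [[al [ral /andP[al0 alm] al1 al2 le4]] F4]; keep F4; have F4' := proj2 F4.
have aE t : t \notin warrs build_graph -> a4 t = a t.
  by move=> h; rewrite F4' // F3' // F2'.
have nv4 i : i < size nvl -> a4 aNV i = nth 0 nvl i by move=> h; rewrite F4' // F3' // nv.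
have nvP' (u : nat) : u \in nvl -> u < n /\ 0 < size (nb u) by move=> h; split; rewrite -?nvP ?nvn.
have mk4 y : a4 aMK y = 0 by rewrite aE ?a0.
have inv4 : balls_inv n ST al nb [::] a4.
  split=> // [u un|v vn _|u]; first by rewrite !F4' // !F3' //; apply: adj.
    by split=> [|u un]; [rewrite F4' // F3' // fr // leq_addr|rewrite aE ?a0].
  by rewrite aE ?a0.
run; apply: wp_conseq (wp_frame (@balls_wp n ST w al nb w0 bigW nST Esym nb_n nb_ST al0 nvl r4 a4 t4
  _ _ _ _ unv nv4 nvP' mk4 inv4)) _ => //.
move=> r5 a5 t5 [[le5 [adj5 st5 fr5 cnt5]] F5]; keep F5; have F5' := proj2 F5.
have inv5 : ball_inv n ST al nb nvl a5.
  split=> // [v vn|v vn h|y].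
  - by have [h1 h2] := st5 v vn; split=> //; rewrite h2; case: (_ < _).
  - by case: (fr5 v vn h).
  - by rewrite F5'.
(* Vacuous at this point: every heavy ball is still flagged. *)
have ex5 : explored n ST nb nvl a5.
  by move=> v vn h1 h2; have [_] := st5 v vn; rewrite h1 h2.
have es5 : esound nb (a5 aEST) by move=> v; rewrite F5' // aE // a0.
have nv5 i : i < size nvl -> a5 aNV i = nth 0 nvl i by move=> h; rewrite F5' // nv4.
set R := (2 * m %/ al).+1 * J.+1.
have roundR t : volume nb nvl ^ t <= size nvl * (volume nb nvl - al) ^ t -> t <= R.
  rewrite vol; apply: rounds => //; first by slia.
  (* [rounds] needs a strict bound while [n] may equal [2 ^ J], whence [J.+1]. *)
  by apply: leq_ltn_trans snv (leq_ltn_trans nJ _); rewrite ltn_exp2l.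
run; apply: wp_conseq (wp_frame (@greedy_wp n ST w al J R nb nvl w0 bigW nST JST J0 nJ Esym Eirr nb_n nb_ST al0
  unv nvn nvP roundR r5 a5 t5 _ _ _ _ nv5 inv5 ex5 es5)) _ => //.
move=> r6 a6 t6 [[le6 [adj6 st6 fr6 _ mk6] es6 hv6] F6]; keep F6; have F6' := proj2 F6.
have nv6 i : i < size nvl -> a6 aNV i = nth 0 nvl i by move=> h; rewrite F6' // nv5.
have tab6 : ball_tab n ST al nb nvl a6.
  by split=> // v /st6[[]].
run; apply: wp_conseq (@light_wp n ST w al J k nb nvl w0 bigW nST JST J0 nJ k1 Esym Eirr nb_n nb_ST unv nvn nvP
  r6 a6 t6 _ _ _ _ _ nv6 tab6 mk6 es6) _ => //.
move=> r7 a7 t7 [le7 es7 mo7 ld7]; split=> //.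
  move=> v s t vn ct t0 s2'; set delta := ceil_divn _ _.
  have sd : s <= 2 * (k - 1) * delta by apply: ceil_divn_mul; slia.
  have tE i : i <= s -> t i \in nvl.
    have [c1 c2 _] := ct; rewrite leq_eqVlt => /predU1P[->|lt].
      by rewrite c2 nvP; have := c1 0 (ltn_trans (ltn0Sn 1) s2'); rewrite /edge /nb; case: (nbs _ _).
    by rewrite nvP; have := c1 i lt; rewrite /edge /nb; case: (nbs _ _).
  have [[j [js [hv wz]]]|no] := pselect (exists j, j <= s /\
      (a6 aDG (n + t j) < size (Pl n ST a6 (t j)) /\ forall z : nat, z \in Pl n ST a6 (t j) ->
       exists2 l, l <= delta & walk (edge nb) (t j) z l)).
    have [z zP cz] := hv6 _ (tE j js) hv; have [l ld wl] := wz z zP.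
    have wl' : walk (arc nb predT) z (t j) l.
      by apply: sub_walk (walk_sym Esym wl) => u y; rewrite /edge /arc => ->.
    have := mo7 _ _ (cz s t j l ct s2' (fun i _ => isT) js wl'); rewrite t0 /le0.
    by move=> /andP[-> le] /=; apply: leq_trans le _; rewrite leq_add2l leq_mul2l ld orbT.
  have B j (y : nat) l : j <= s -> l <= delta -> walk (edge nb) (t j) y l -> y \in inner n ST a6 (t j).
    move=> js ld wl; have [[bo _] _ _] := st6 _ (tE j js); rewrite (inner_take bo).
    have [_ [_ _ _ _ /(_ delta)[h|h]]] := bo; last exact: h wl.
    by case: no; exists j.
  (* The walk of length 0 puts [v] into its own inner ball, which is thus nonempty: the local search
     from [v] was not skipped. *)
  have vv : v \in inner n ST a6 v.
    by have := B 0 v 0 (leq0n _) (leq0n _); rewrite t0; apply; apply: walk0.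
  have vnv : v \in nvl by rewrite -t0 tE.
  have d0 : 0 < a6 aDG (n + v) by move: vv; rewrite /inner; case: (a6 aDG _).
  have := ld7 v vnv d0 s t delta ct s2' t0 sd B.
  by rewrite /le0 => /andP[-> le] /=; apply: leq_trans le (leq_addr _ _).
exists J, al, (size nvl), R; rewrite al0; split=> //; split=> //.
rewrite vol in le6; apply: leq_trans le7 _; rewrite leq_add2r.
apply: leq_trans le6 _; move: le3 le4 le5.
move: (R.+1 * _) (size nvl * al) (size nvl * (3 * al + 1)) (al * _) => X1 X2 X3 X4.
by clear; lia.
Qed.
End Main.

(** * From the edge listing to the graph *)

Lemma set2_inj (T : finType) (a b c d : T) : [set a; b] = [set c; d] ->
  (a, b) = (c, d) \/ (b, a) = (c, d).
Proof.
move=> e; have : a \in [set c; d] by rewrite -e set21.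
have : b \in [set c; d] by rewrite -e set22.
have : c \in [set a; b] by rewrite e set21.
have : d \in [set a; b] by rewrite e set22.
by rewrite !inE => /orP[]/eqP dE /orP[]/eqP cE /orP[]/eqP bE /orP[]/eqP aE; (left; congruence) || (right; congruence).
Qed.

Section Listing.
Variables (n : nat) (G : sgraph n) (es : seq ('I_n * 'I_n)).
Hypothesis esG : edge_listing G es.

Let es' := [seq (val p.1, val p.2) | p <- es].
Let nb := nbs (halves es').

Lemma listing_size : size es = #|edges G|.
Proof. by rewrite cardE -(perm_size esG) size_map. Qed.

Lemma listing_le : size es <= n ^ 2.
Proof.
rewrite listing_size; apply: leq_trans (leq_imset_card _ _) _.
by apply: leq_trans (max_card _) _; rewrite card_prod card_ord mulnn.
Qed.

Lemma listing_adj p : p \in es -> G p.1 p.2.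
Proof.
move=> pes; have : [set p.1; p.2] \in edges G.
  by rewrite -mem_enum -(perm_mem esG); apply/mapP; exists p.
case/imsetP=> q; rewrite inE => Gq /set2_inj[[-> ->] //|[-> ->]].
by rewrite adj_sym.
Qed.

Lemma edge_listed (u y : 'I_n) : edge nb (val u) (val y) = G u y.
Proof.
rewrite /edge mem_nbs mem_halves; apply/orP/idP => [[]/mapP[p /listing_adj h [/val_inj -> /val_inj ->]] //|Guy].
  by rewrite adj_sym.
have : [set u; y] \in enum (edges G).
  by rewrite mem_enum; apply/imsetP; exists (u, y); rewrite ?inE.
rewrite -(perm_mem esG) => /mapP[[a b] pes /set2_inj[[-> ->]|[-> ->]]].
  by left; apply/mapP; exists (a, b).
by right; apply/mapP; exists (a, b).
Qed.

Lemma listing_range e : e \in es' -> [/\ e.1 < n, e.2 < n & e.1 != e.2].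
Proof.
case/mapP=> p /listing_adj h -> /=; split=> //; apply/negP => /eqP /val_inj e12.
by move: h; rewrite e12 adj_irr.
Qed.

Lemma hascyc_listed (v : 'I_n) l : hascyc nb v l <-> has_cycle G v l.
Proof.
have E (c : seq 'I_n) : ucycle (edge nb) (map val c) = ucycle G c :> Prop.
  congr is_true; rewrite /ucycleb (map_inj_uniq val_inj) (@cycle_map _ _ val); congr (_ && _).
  by apply: eq_cycle => u y; apply: edge_listed.
split=> [[l2 [c [sc uc vc _]]]|/andP[l2 /existsP[c /andP[uc vc]]]].
  (* Vertices are plain numbers here; one on a cycle has a successor, and edges join only numbers
     below [n]. *)
  have cn (x : nat) : x \in c -> x < n.
    case/andP: uc => cc _ xc; have := next_cycle cc xc.
    by rewrite /edge mem_nbs mem_halves => /orP[] /listing_range[].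
  have [c' Ec] : exists c' : seq 'I_n, c = map val c'.
    elim: c cn {sc uc vc} => [|x c IH] H; first by exists [::].
    have [c' ->] := IH (fun y yc => H y (mem_behead (s := x :: c) yc)).
    by exists (Ordinal (H x (mem_head _ _)) :: c').
  have sc' : size c' == l by rewrite -sc Ec size_map.
  rewrite /has_cycle l2; apply/existsP; exists (Tuple sc').
  by move: uc vc; rewrite Ec E (mem_map val_inj) => uc vc; apply/andP.
split=> //; exists (map val c); rewrite size_map size_tuple (mem_map val_inj).
by split=> //; rewrite E.
Qed.

(** A nonzero estimate comes with an actual cycle through the vertex that is no longer. This gives
    the lower bound, and forces the value 0 where no cycle exists. *)
Lemma good_estimate_listed k est (v : 'I_n) : esound nb est -> approx n k es' est ->
  good_estimate k (SC G v) (est v).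
Proof.
move=> so ap; rewrite /good_estimate; case E: (SC G v) => [s|].
  have [/hascyc_listed[s2 [c [sc uc vc _]]] mi] := (SC_SomeP G v s).1 E.
  have [t [ct t0 _ _]] := cycfun_of uc vc; rewrite sc in ct.
  have /andP[e0 ->] := ap _ _ _ (ltn_ord v) ct t0 s2; rewrite andbT.
  have [l le /hascyc_listed hc] := so v (lt0n_neq0 e0).
  exact: leq_trans (mi l hc) le.
have [//|/so[l _ /hascyc_listed hc]] := eqVneq (est v) 0.
by have := (SC_NoneP G v).1 E l; rewrite hc.
Qed.

Lemma no_edge_SC (v : 'I_n) : es = [::] -> SC G v = None.
Proof.
move=> e0; apply/SC_NoneP => l; apply/negP => /andP[l2 /existsP[c /andP[/andP[cc _] vc]]].
by have := next_cycle cc vc; rewrite -edge_listed /edge mem_nbs /es' e0.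
Qed.
End Listing.

(* Without edges all estimates keep the value 0, which stands for infinity. *)
Definition program := If (Reg rM) main Skip.

Lemma coin_prob_all (R : realType) T (A : pred (T.-tuple bool)) : (forall cs, A cs) ->
  coin_prob R A = 1%R.
Proof.
move=> h; rewrite /coin_prob.
have -> : [set cs | A cs] = setT by apply/setP => cs; rewrite !inE h.
by rewrite cardsT card_tuple card_bool GRing.natrX GRing.divff // GRing.expf_neq0 // Num.Theory.pnatr_eq0.
Qed.

Lemma program_exec n (G : sgraph n) (es : seq ('I_n * 'I_n)) k w :
  1 < k -> edge_listing G es -> (n + k) ^ 10 <= 2 ^ w ->
  exists t r' a', [/\ exec w program (nth 0 [:: n; size es; k])
    (fun t => nth 0 (nth [::] [:: [seq val p.1 | p <- es]; [seq val p.2 | p <- es]] t)) t r' a',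
    forall v : 'I_n, good_estimate k (SC G v) (a' aEST v) &
    t = 0 \/ 0 < size es /\ exists J al N R, [/\ 2 ^ J.-1 < n, 0 < al <= size es,
      al = 1 \/ n * al ^ k <= size es ^ 2, size es ^ 2 < n * al.+1 ^ k &
      [/\ N <= n, N <= 2 * size es, R = (2 * size es %/ al).+1 * J.+1 &
       t <= size es + J + al * (4 * J).+2 + N * (3 * al + 1) +
         (N + R.+1 * (2 * N + 2 * (2 * size es) * (4 * J + 3) + 1) + N * al) +
         N * (2 * al ^ k.-1 + 2 * al ^ k.-1 * (4 * J + 3) + 1)]]].
Proof.
move=> k1 esG big; set r := nth 0 _; set a : nat -> nat -> nat := fun t => nth 0 (nth [::] _ t).
have a0 t i : 1 < t -> a t i = 0.
  by case: t => [|[|t]] // _; rewrite /a /= nth_nil nth_nil.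
have rE : r 1 = size es by [].
have [m0|m0] := posnP (size es).
  exists 0, r, a; split; first by apply: ExIf; rewrite /= rE m0; constructor.
    by move=> v; rewrite (no_edge_SC esG) ?(size0nil m0) //= a0.
  by left.
set es' := [seq (val p.1, val p.2) | p <- es].
have se : size es' = size es by rewrite size_map.
have n1 : 1 < n.
  have [p pe] : exists p, p \in es by case: (es) m0 => // p s _; exists p; apply: mem_head.
  have [h1 h2 h3] := listing_range esG (map_f _ pe).
  by move: h1 h2 h3 => /=; clear; lia.
have mn := listing_le esG.
have W : [/\ 0 < w, (n + size es' + size es' + 10) ^ 3 < 2 ^ w & k < 2 ^ w].
  (* As [size es <= n ^ 2] and [n], [k] are at least 2, the third power suffices; its cube is the
     ninth power, and the tenth makes the bound strict. *)
  have w3 : n + size es' + size es' + 10 <= (n + k) ^ 3.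
    rewrite se; move: mn n1 k1; rewrite !expnS expn0 !muln1; clear; nia.
  have nk : 1 < n + k by move: n1; clear; lia.
  have lt : (n + k) ^ 9 < 2 ^ w by apply: leq_trans big; rewrite ltn_exp2l.
  split; last first.
  - apply: leq_ltn_trans lt; apply: leq_trans (leq_addl n k) _.
    by rewrite -[leqLHS]expn1 leq_exp2l.
  - by apply: leq_ltn_trans lt; rewrite -[9]/(3 * 3) expnM leq_exp2r.
  - by case: (w) lt => //; rewrite expn0 ltnS leqn0 expn_eq0; move: nk; clear; lia.
have [w0 bigW kW] := W; have mn' : size es' <= n ^ 2 by rewrite se.
have m0' : 0 < size es' by rewrite se.
have aes i : i < size es' -> a 0 i = (nth (0, 0) es' i).1 /\ a 1 i = (nth (0, 0) es' i).2.
  by move=> i_lt; rewrite -(nth_map _ 0 fst i_lt) -(nth_map _ 0 snd i_lt) -!map_comp.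
have := @main_wp n k w es' w0 bigW n1 m0' mn' k1 kW (listing_range esG) r a 0.
case=> // t [r' [a' [ex [so ap bd]]]]; rewrite se !add0n in bd.
exists t, r', a'; split; first by apply: ExIf; rewrite /= rE -lt0n m0.
  by move=> v; apply: (good_estimate_listed esG).
by right.
Qed.

(** Local searches are charged to [X], landmark searches to [m * R.+1], and the rest to [m] or [X];
    [1 < k] gives [N * al <= X] for the terms linear in [al]. *)
Lemma ticks_le t m J al N k X R : 0 < al <= m -> 1 < k -> N <= 2 * m -> X = N * al ^ k.-1 ->
  t <= m + J + al * (4 * J).+2 + N * (3 * al + 1) +
    (N + R.+1 * (2 * N + 2 * (2 * m) * (4 * J + 3) + 1) + N * al) +
    N * (2 * al ^ k.-1 + 2 * al ^ k.-1 * (4 * J + 3) + 1) ->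
  t <= 12 * J.+1 * (m + X) + 17 * J.+1 * (m * R.+1).
Proof.
move=> /andP[al0 alm] k1 Nm XE h; apply: leq_trans h _.
have NX : N * al <= X.
  by rewrite XE leq_mul2l -{1}[al]expn1 leq_pexp2l ?orbT //; case: (k) k1 => [|[]].
have b1 : al * (4 * J).+2 <= m * (4 * J).+2 by rewrite leq_mul2r alm orbT.
have b2 : R.+1 * (2 * N + 2 * (2 * m) * (4 * J + 3) + 1) <= R.+1 * (17 * J.+1 * m).
  by rewrite leq_mul2l; apply/orP; right; move: Nm al0 alm; clear; nia.
have b3 : N * (2 * al ^ k.-1 + 2 * al ^ k.-1 * (4 * J + 3) + 1) = 8 * J.+1 * X + N.
  by rewrite XE; move: (al ^ _) => Y; clear; lia.
rewrite b3 mulnDr muln1 mulnCA; move: NX b1 b2 al0 alm Nm.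
rewrite [17 * J.+1 * (m * _)]mulnCA [m * (17 * J.+1 * _)]mulnCA.
have -> : R.+1 * (17 * J.+1 * m) = 17 * J.+1 * (m * R.+1) by clear; lia.
have -> : 12 * J.+1 * (m + X) = 12 * m + 12 * (J * m) + 12 * X + 12 * (J * X) by clear; lia.
have -> : 8 * J.+1 * X = 8 * X + 8 * (J * X) by clear; lia.
have -> : m * (4 * J).+2 = 4 * (J * m) + 2 * m by clear; lia.
move: (R.+1 * _) (17 * _ * _) (al * _) (J * X) => Y1 Y2 Y3 Y4 h1 h2 h3 h4 h5 h6.
have : J <= J * m by rewrite leq_pmulr //; move: h4 h5; clear; lia.
by move: (J * m) h1 h2 h3 h4 h5 h6; clear; lia.
Qed.

Import Order.TTheory GRing.Theory Num.Theory.
Local Open Scope ring_scope.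

(** * Bounds with real powers and logarithms *)

Section Bounds.
Variable R : realType.
Implicit Types (n m k al N J : nat).

Lemma log_bound n J : (2 ^ J.-1 < n)%N -> J.+1%:R <= 2 * (1 + ln n%:R) :> R.
Proof.
(* The inequality [1 + x <= exp x] at [x = -1/2] gives [exp (1/2) <= 2]. *)
move=> lt; have l2 : 2^-1 <= ln 2 :> R.
  rewrite -[2^-1](expRK) ler_ln ?posrE ?expR_gt0 //.
  have := expR_ge1Dx (- 2^-1 : R); rewrite expRN; move=> h.
  have e0 := expR_gt0 (2^-1 : R).
  have : expR 2^-1 * (1 - 2^-1) <= expR 2^-1 * (expR 2^-1)^-1 :> R by rewrite ler_pM2l.
  by rewrite divff ?lt0r_neq0 //; move: (expR _) => e; lra.
have h : ln (2 ^+ J.-1) <= ln n%:R :> R.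
  by rewrite ler_ln ?posrE ?exprn_gt0 ?ltr0n ?(leq_ltn_trans _ lt) // -natrX ler_nat ltnW.
rewrite lnXn // -[_ *+ J.-1]mulr_natl in h.
have hh : J.-1%:R * 2^-1 <= ln n%:R :> R by apply: le_trans h; rewrite ler_wpM2l.
have : J.+1%:R <= J.-1%:R + 2 :> R by rewrite -natrD ler_nat; lia.
by lra.
Qed.

(** With the k-th roots [P] of [m] and [Q] of [n], the target satisfies [Y * P ^ 2 = m ^ 2 * Q].
    Multiplying each claim by [P ^ 2] leaves polynomial inequalities that follow from the position
    of [al] relative to [P ^ 2 / Q]. *)
Lemma size_bounds n m k al N (Y0 : R) : (1 < k)%N -> (0 < m)%N -> (0 < al <= m)%N -> (1 < n)%N ->
  al = 1%N \/ (n * al ^ k <= m ^ 2)%N -> (m ^ 2 < n * al.+1 ^ k)%N -> (N <= n)%N -> (N <= 2 * m)%N ->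
  Y0 = m%:R `^ (2 - 2 / k%:R) * n%:R `^ (k%:R^-1) ->
  [/\ m%:R <= Y0, (N * al ^ k.-1)%:R <= 2 * Y0 & m%:R ^+ 2 <= 2 * Y0 * al%:R].
Proof.
move=> k1 m0 /andP[al0 alm] n1 al1 al2 Nn Nm ->.
have k0 : k%:R != 0 :> R by rewrite pnatr_eq0; case: (k) k1.
set x := k%:R^-1; set P := m%:R `^ x : R; set Q := n%:R `^ x : R.
have PE : P ^+ k = m%:R by rewrite /P -powR_mulrn ?powR_ge0 // -powRrM mulVf // powRr1.
have QE : Q ^+ k = n%:R by rewrite /Q -powR_mulrn ?powR_ge0 // -powRrM mulVf // powRr1.
have P0 : 0 < P by apply: powR_gt0; rewrite ltr0n.
have Q0 : 0 < Q by apply: powR_gt0; rewrite ltr0n ltnW.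
have big (e : nat) (z : R) : 0 <= z -> (0 < e)%N -> z ^+ k = e%:R -> 1 <= z.
  move=> z0 e0 zE; rewrite -(@ler_pXn2r _ k) ?nnegrE ?ler01 ?(ltnW k1) //.
  by rewrite expr1n zE ler1n.
have P1 : 1 <= P by apply: (big m) => //; apply: ltW.
have Q1 : 1 <= Q by apply: (big n) => //; [apply: ltW|apply: ltnW].
set Y := _ * Q; have YE : Y * P ^+ 2 = m%:R ^+ 2 * Q.
  have -> : P ^+ 2 = m%:R `^ (2 * x) by rewrite mulrC powRrM powR_mulrn // ltW.
  rewrite /Y mulrAC -powRD; last by rewrite pnatr_eq0 (gtn_eqF m0) implybT.
  by rewrite subrK powR_mulrn.
have Pk : P ^+ 2 <= m%:R by rewrite -PE ler_weXn2l.
have P20 : 0 < P ^+ 2 by rewrite exprn_gt0.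
have mY : m%:R <= Y.
  rewrite -(ler_pM2r P20) YE expr2 -mulrA ler_pM2l ?ltr0n //.
  by apply: le_trans Pk _; rewrite ler_peMr.
split=> //.
(* Where the maximum with 1 is attained by 1, the upper bound on [al] may fail; [N <= 2 * m] takes
   its place. *)
- case: al1 => [->|le].
    by rewrite exp1n muln1; apply: le_trans (_ : (2 * m)%:R <= _); rewrite ?ler_nat // natrM ler_pM2l.
  have QP : Q * al%:R <= P ^+ 2.
    rewrite -(@ler_pXn2r _ k) ?nnegrE ?(ltnW k1) ?(ltW P20) ?mulr_ge0 ?(ltW Q0) //.
    by rewrite exprMn QE -exprM mulnC exprM PE -!natrX -natrM ler_nat.
  have ek : k = k.-1.+1 by case: (k) k1.
  apply: (@le_trans _ _ (n * al ^ k.-1)%:R); first by rewrite ler_nat leq_mul2r Nn orbT.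
  apply: (@le_trans _ _ Y); last by rewrite -subr_ge0 [X in 0 <= X](_ : _ = Y); [apply: le_trans mY; apply: ler0n|ring].
  have mE : m%:R ^+ 2 = (P ^+ 2) ^+ k.-1 * P ^+ 2 by rewrite -exprSr -ek -PE -!exprM mulnC.
  have nE : n%:R = Q ^+ k.-1 * Q by rewrite -exprSr -ek.
  rewrite -(ler_pM2r P20) YE mE [leRHS]mulrAC ler_pM2r // natrM natrX nE mulrAC ler_pM2r // -exprMn.
  by apply: lerXn2r; rewrite ?nnegrE ?(ltW P20) ?mulr_ge0 ?(ltW Q0).
- have lt : P ^+ 2 < Q * al.+1%:R.
    rewrite -(@ltr_pXn2r _ k) ?nnegrE ?(ltnW k1) ?(ltW P20) ?mulr_ge0 ?(ltW Q0) //.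
    by rewrite [(Q * _) ^+ k]exprMn QE -exprM mulnC exprM PE -!natrX -natrM ltr_nat.
  rewrite -(ler_pM2r P20) [leRHS](_ : _ = 2 * (m%:R ^+ 2 * Q) * al%:R); last by rewrite -YE; ring.
  (* Rounding alpha down costs a factor [al.+1 / al <= 2]. *)
  have : P ^+ 2 <= 2 * (Q * al%:R).
    apply: le_trans (ltW lt) _; rewrite mulrCA ler_pM2l // -natrM ler_nat; move: al0; lia.
  have m20 : 0 < m%:R ^+ 2 :> R by rewrite exprn_gt0 // ltr0n.
  move=> h; rewrite -(ler_pM2l m20) in h; apply: le_trans h _.
  by rewrite le_eqVlt; apply/orP; left; apply/eqP; ring.
Qed.
End Bounds.

Theorem theorem20 (R : realType) (a : nat) :
  exists (P : cmd) (C d b : nat),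
  forall (n : nat) (G : sgraph n) (es : seq ('I_n * 'I_n)) (k w : nat),
    (2 <= k)%N -> edge_listing G es -> ((n + k) ^ b.+2 <= 2 ^ w)%N ->
    exists T : nat,
      T%:R <= C%:R * (1 + ln n%:R) ^+ d
              * (1 + #|edges G|%:R `^ (2 - 2 / k%:R) * n%:R `^ (k%:R^-1)) :> R
      /\ 1 - (n%:R ^+ a)^-1 <= coin_prob R (success P w G es k (T:=T)).
Proof.
(* One logarithm comes from binary lifting, the other from the number of rounds. The estimates below
   give [36 * 2 + 136 * 4 = 616 <= 699]; one more unit pays for the successor in [t.+1]. The value 8
   makes the word hypothesis a tenth power. *)
exists program, (csize program * 700)%N, 2%N, 8 => n G es k w k1 esG big.
have [t [r' [a' [ex ok bd]]]] := program_exec k1 esG big.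
have [T Tle steps] := exec_steps ex; exists T; split; last first.
  rewrite coin_prob_all => [|cs].
    by rewrite lerBlDr lerDl invr_ge0 exprn_ge0.
  by rewrite /success /init steps; apply/forallP => v; apply: ok.
rewrite -(listing_size esG); set Y := _ `^ _ * _; set g := 1 + ln n%:R.
have Y0 : 0 <= Y by rewrite mulr_ge0 ?powR_ge0.
have g1 : 1 <= g.
  by rewrite lerDl; have [->|n0] := posnP n; [rewrite ln0|rewrite ln_ge0 // ler1n].
have g20 : 0 <= g ^+ 2 by rewrite sqr_ge0.
suff tY : t%:R <= 699 * g ^+ 2 * Y.
  apply: le_trans (_ : (csize program * t.+1)%:R <= _); first by rewrite ler_nat.
  have : 1 <= g ^+ 2 by rewrite exprn_ege1.
  have -> : (csize program * 700)%:R * g ^+ 2 * (1 + Y) = (csize program)%:R * (700 * (g ^+ 2 * (1 + Y))).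
    by rewrite natrM !mulrA.
  rewrite natrM ler_pM2l ?ltr0n ?csize_gt0 // -natr1; move: (mulr_ge0 g20 Y0) tY.
  rewrite -[699 * _ * Y]mulrA mulrDr mulr1; move: (g ^+ 2) => h; move: (h * Y) => hY.
  by lra.
case: bd => [->|[m0 [J [al [N [S [Jn al0 al1 al2 [Nn Nm SE le]]]]]]]].
  by rewrite -mulrA mulr_ge0 // mulr_ge0.
have n1 : (1 < n)%N by apply: leq_ltn_trans Jn; rewrite expn_gt0.
have [h1 h2 h3] := size_bounds k1 m0 al0 n1 al1 al2 Nn Nm (erefl Y).
have Lg := log_bound R Jn; have := ticks_le al0 k1 Nm erefl le.
set X := (N * _)%N in h2 *; set L := J.+1%:R in Lg.
(* Multiplying by [al] removes the integer quotient in [S]; [al <= m] absorbs the rounding terms. *)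
have Sal : (size es * S.+1)%:R * al%:R <= 4 * L * (size es)%:R ^+ 2 :> R.
  rewrite /L -natrX -!natrM ler_nat SE.
  have := leq_trunc_div (2 * size es) al; move: al0 m0; move: (_ %/ _)%N => q; clear.
  by nia.
have al00 : 0 < al%:R :> R by rewrite ltr0n; case/andP: al0.
have Sle : (size es * S.+1)%:R <= 8 * L * Y.
  rewrite -(ler_pM2r al00); apply: le_trans Sal _; have L0 : 0 <= L by apply: ler0n.
  by move: ((size es)%:R ^+ 2) h3 => z h3; nra.
rewrite -(ler_nat R) natrD !natrM natrD -/L => le'; apply: le_trans le' _.
have L0 : 0 <= L by apply: ler0n.
have LG : L <= 2 * g ^+ 2.
  by apply: le_trans Lg _; rewrite ler_pM2l // expr2 ler_peMr // (le_trans ler01).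
have LL : L * L <= 4 * g ^+ 2.
  have -> : 4 * g ^+ 2 = (2 * g) * (2 * g) by ring.
  by rewrite ler_pM.
have LY : L * Y <= 2 * g ^+ 2 * Y by rewrite ler_wpM2r.
have LLY : L * L * Y <= 4 * g ^+ 2 * Y by rewrite ler_wpM2r.
have B1 : 12 * L * ((size es)%:R + X%:R) <= 12 * L * (3 * Y).
  by rewrite ler_wpM2l ?mulr_ge0 //; move: h1 h2; lra.
have B2 : 17 * L * (size es * S.+1)%:R <= 17 * L * (8 * L * Y) by rewrite ler_wpM2l ?mulr_ge0.
rewrite natrM in B2; move: B1 B2 LY LLY (mulr_ge0 g20 Y0).
have -> : 12 * L * (3 * Y) = 36 * (L * Y) by ring.
have -> : 17 * L * (8 * L * Y) = 136 * (L * L * Y) by ring.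
rewrite -!(mulrA _ (g ^+ 2) Y); move: (L * L * Y) (L * Y) (g ^+ 2 * Y) => z1 z2 z3.
by move: (12 * L * _) (17 * L * _) => z4 z5; lra.
Qed.
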